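(* Assume that the solution $\omega$ of the transformed problem (T) described in the context satisfies the regularity assumption (R) of the context, and let $\mathcal W_h^n$ be the numerical approximation of $\omega^n=\omega(\cdot,t_n)$ given by the fully discrete finite element scheme (FD) of the context. Then, with $T<\infty$ and $\tau$ sufficiently small, $$\sqrt{\tau\sum_{n=1}^{N}\|\omega^n-\mathcal W_h^n\|^2}\le C(T)\left(\tau^{\frac12+\frac32\alpha_0}+h^2\right),$$ where $C(T)$ is a positive constant independent of $N$ (equivalently of $\tau=T/N$) and $h$.
   Context: Parameters: $T>0$, $\sigma>0$, $r\ge 0$, a bounded interval $(\bar a,\bar b)$; $(\cdot,\cdot)$ and $\|\cdot\|$ are the inner product and norm of $L^2(\bar a,\bar b)$, $H^{m}=H^m(\bar a,\bar b)$, $H^0=L^2$, and $\nabla=\partial_x$. The variable exponent satisfies $\alpha\in W^{1,\infty}(0,T)$, $0<\alpha(t)\le\alpha^*<1$ on $[0,T]$, and $\alpha'(0)=0$. Put $\alpha_0=\alpha(0)$, $k(t)=\frac{t^{-\alpha(t)}}{\Gamma(1-\alpha(t))}$, $\beta_{\mu}(t)=\frac{t^{\mu-1}}{\Gamma(\mu)}$, and $(g_1*g_2)(t)=\int_0^t g_1(t-s)g_2(s)\,ds$. Define $$q(t)=(\beta_{\alpha_0}*k)(t)=\int_0^1\frac{(t\varsigma)^{\alpha_0-\alpha(t\varsigma)}}{\Gamma(1-\alpha(t\varsigma))}\,\frac{(1-\varsigma)^{\alpha_0-1}\varsigma^{-\alpha_0}}{\Gamma(\alpha_0)}\,d\varsigma,\qquad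 q(0)=1,$$ and assume $q$ is differentiable on $[0,T]$ with $|q(t)|+|q'(t)|\le C_q$ for some constant $C_q$. Transformed problem (T): given a source $f(x,t)$ and an initial datum $\bar c_t(x)$ (a function of $x$ only), let $\bar c_t^*(x)=\exp\left(-(\frac12-\frac{r}{\sigma^2})x\right)\bar c_t(x)$, $\chi(x,t)=\exp\left(-(\frac12-\frac r{\sigma^2})x\right)f(x,t)$, $\lambda=\frac12\left(\frac\sigma2+\frac r\sigma\right)^2$, and $F(x,t)=\beta_{\alpha_0}(t)*\big(\tfrac12\sigma^2\partial_x^2\bar c_t^*(x)-\lambda\bar c_t^*(x)+\chi(x,t)\big)$. Then $\omega$ solves $$\omega+q'*\omega-\tfrac12\sigma^2\beta_{\alpha_0}*\partial_x^2\omega+\lambda\beta_{\alpha_0}*\omega=F\ \text{ on }(\bar a,\bar b)\times(0,T),\qquad \omega(\bar a,t)=\omega(\bar b,t)=0,\quad \omega(x,0)=0.$$ The data are assumed sufficiently regular, in particular $F(\cdot,t)\in L^2(\bar a,\bar b)$ at the time grid points. Regularity assumption (R): there is a constant $C$ with $$t\,\|\partial_t^2\omega(t)\|_{H^{2m}}+\|\partial_t\omega(t)\|_{H^{2m}}\le C t^{\alpha_0-1}\quad\text{for a.e. }t\in(0,T],\ m=0,1.$$ Scheme (FD): for a positive integer $N$ let $\tau=T/N$, $t_n=n\tau$, $F^n=F(\cdot,t_n)$, and for $1\le j\le n\le N$ $$\varpi_{n,j}=\frac1\tau\int_{t_{n-1}}^{t_n}\int_{t_{j-1}}^{\min(t,t_j)}q'(t-s)\,ds\,dt,\qquad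 \widetilde\varpi_{n,j}=\frac1\tau\int_{t_{n-1}}^{t_n}\int_{t_{j-1}}^{\min(t,t_j)}\beta_{\alpha_0}(t-s)\,ds\,dt.$$ Take a quasi-uniform partition of $[\bar a,\bar b]$ with mesh diameter $h$ and let $S_h\subset H_0^1(\bar a,\bar b)$ be the space of continuous piecewise linear functions with respect to the partition that vanish at $\bar a$ and $\bar b$. For $1\le n\le N$, $\mathcal W_h^n\in S_h$ satisfies, for all $\Lambda\in S_h$, $$(\mathcal W_h^n,\Lambda)+\Big(\sum_{j=1}^n\varpi_{n,j}\mathcal W_h^j,\Lambda\Big)+\lambda\Big(\sum_{j=1}^n\widetilde\varpi_{n,j}\mathcal W_h^j,\Lambda\Big)+\tfrac12\sigma^2\Big(\sum_{j=1}^n\widetilde\varpi_{n,j}\nabla\mathcal W_h^j,\nabla\Lambda\Big)=(F^n,\Lambda).$$ *)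

(* Defs.v *)
From mathcomp Require Import all_boot all_order all_algebra.
From mathcomp Require Import all_classical all_reals all_analysis.

Set Implicit Arguments.
Unset Strict Implicit.
Unset Printing Implicit Defensive.

Import Order.TTheory GRing.Theory Num.Theory.
Import numFieldNormedType.Exports.

Local Open Scope classical_set_scope.
Local Open Scope ring_scope.

(* Functions of space and time are curried with time first: u t x. Only their
   values for t in [0, T] and x in [a, b] matter. *)

Section Spaces.
Context {R : realType}.
Local Notation mu := (@lebesgue_measure R).
Implicit Types (a b c : R) (u v phi : R -> R).

Definition is_L2 a b u : Prop := u \_ `]a, b[ \in Lfun mu 2%:E.

Definition L2inner a b u v : R := \int[mu]_(x in `]a, b[) (u x * v x).

Definition L2norm a b u : R := fine 'N[mu]_2%:E[EFin \o (u \_ `]a, b[)].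

Definition C1_test a b phi : Prop :=
  [/\ forall x, derivable phi x 1, continuous (derive1 phi) &
      exists c d, [/\ a < c, d < b & forall x, ~~ (c <= x <= d) -> phi x = 0]].

(* Test functions of class C^1 define the same weak derivatives as smooth
   ones. *)
Definition weak_deriv a b u v : Prop :=
  [/\ locally_integrable `]a, b[ u, locally_integrable `]a, b[ v &
      forall phi, C1_test a b phi ->
        \int[mu]_(x in `]a, b[) (u x * derive1 phi x) =
        - \int[mu]_(x in `]a, b[) (v x * phi x)].

(* u belongs to H^m(a, b) and D 0 = u, D 1, ..., D m are its successive weak
   derivatives. *)
Definition Hm_derivs a b (m : nat) u (D : nat -> R -> R) : Prop :=
  [/\ D 0%N = u,
      forall i, (i < m)%N -> weak_deriv a b (D i) (D i.+1) &
      forall i, (i <= m)%N -> is_L2 a b (D i)].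

Definition H2_second_deriv a b u v : Prop :=
  exists2 D, Hm_derivs a b 2 u D & D 2%N = v.

(* Weak derivatives being unique almost everywhere, the set below has at most
   one element; the norm is +oo when u does not belong to H^m(a, b). *)
Definition Hnorm a b (m : nat) u : \bar R :=
  ereal_inf [set (Num.sqrt (\sum_(i < m.+1) L2norm a b (D i) ^+ 2))%:E
            | D in [set D | Hm_derivs a b m u D]].

Definition W1oo a b u : Prop :=
  exists2 v, weak_deriv a b u v &
    ('N[mu]_+oo[EFin \o (u \_ `]a, b[)] < +oo)%E /\
    ('N[mu]_+oo[EFin \o (v \_ `]a, b[)] < +oo)%E.

(* u is differentiable at t relatively to D, with derivative l (one-sided at
   the end points when D is a closed interval). *)
Definition deriv_within (D : set R) u (t l : R) : Prop :=
  (u s - u t) / (s - t) @[s --> within D t^'] --> l.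

End Spaces.

Section Problem.
Context {R : realType}.
Local Notation mu := (@lebesgue_measure R).
Implicit Types (T sigma r a b nu t x : R) (alpha dq : R -> R).
Implicit Types (f omega : R -> R -> R) (ct d2c : R -> R).

Definition Gamma (z : R) : R :=
  \int[mu]_(x in `]0, +oo[) (x `^ (z - 1) * expR (- x)).

Definition time_conv (g1 g2 : R -> R) t : R :=
  \int[mu]_(s in `[0, t]) (g1 (t - s) * g2 s).

Definition beta nu t : R := t `^ (nu - 1) / Gamma nu.

Definition kfun alpha t : R := t `^ (- alpha t) / Gamma (1 - alpha t).

(* The convolution integral vanishes at t = 0, where q takes its limit value. *)
Definition qfun alpha t : R :=
  if t == 0 then 1 else time_conv (beta (alpha 0)) (kfun alpha) t.

(* alpha is the continuous representative, so that alpha 0 makes sense. *)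
Definition variable_exponent T (astar : R) alpha : Prop :=
  [/\ W1oo 0 T alpha,
      {within `[0, T], continuous alpha},
      astar < 1,
      forall t, 0 <= t <= T -> 0 < alpha t <= astar &
      deriv_within `[0, T] alpha 0 0].

Definition q_regular T alpha dq : Prop :=
  (forall t, 0 <= t <= T -> deriv_within `[0, T] (qfun alpha) t (dq t)) /\
  (exists Cq, forall t, 0 <= t <= T -> `|qfun alpha t| + `|dq t| <= Cq).

Definition lambda sigma r : R := 2^-1 * (sigma / 2 + r / sigma) ^+ 2.

Definition weightx sigma r x : R := expR (- (2^-1 - r / sigma ^+ 2) * x).

Definition cstar sigma r ct x : R := weightx sigma r x * ct x.

Definition chi sigma r f t x : R := weightx sigma r x * f t x.

(* d2c stands for the second derivative of cstar sigma r ct. *)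
Definition Fsource sigma r alpha f ct d2c t x : R :=
  time_conv (beta (alpha 0))
    (fun s => 2^-1 * sigma ^+ 2 * d2c x - lambda sigma r * cstar sigma r ct x
              + chi sigma r f s x) t.

Definition data_regular T sigma r a b alpha f ct d2c : Prop :=
  [/\ H2_second_deriv a b (cstar sigma r ct) d2c,
      forall t, 0 < t <= T -> {ae mu, forall x, a < x < b ->
        mu.-integrable `[0, t]
          (fun s => (beta (alpha 0) (t - s) * chi sigma r f s x)%:E)} &
      forall t, 0 < t <= T -> is_L2 a b (Fsource sigma r alpha f ct d2c t)].

(* omega is the representative that is continuous on [0, T] x [a, b]. The
   equation is imposed at every time t in (0, T], and not only almost
   everywhere, because the source is sampled at the grid points. *)
Definition solves_T T sigma r a b alpha dq f ct d2c omega : Prop :=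
  [/\ {within `[0, T] `*` `[a, b], continuous (fun p : R * R => omega p.1 p.2)},
      forall t, 0 <= t <= T -> omega t a = 0 /\ omega t b = 0,
      forall x, a <= x <= b -> omega 0 x = 0 &
      exists omega_xx : R -> R -> R,
      [/\ measurable_fun (`]0, T[ `*` `]a, b[)
            (fun p : R * R => omega_xx p.1 p.2),
          {ae mu, forall t, 0 < t < T ->
            H2_second_deriv a b (omega t) (omega_xx t)} &
          forall t, 0 < t <= T -> {ae mu, forall x, a < x < b ->
            omega t x + time_conv dq (omega ^~ x) t
            - 2^-1 * sigma ^+ 2 * time_conv (beta (alpha 0)) (omega_xx ^~ x) t
            + lambda sigma r * time_conv (beta (alpha 0)) (omega ^~ x) t
            = Fsource sigma r alpha f ct d2c t x}]].

(* omega_t and omega_tt are the weak time derivatives of omega: joint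
   measurability and weak differentiability in t for almost every x. *)
Definition regularity_R T a b (alpha0 : R) omega : Prop :=
  exists omega_t omega_tt : R -> R -> R,
  [/\ measurable_fun (`]0, T[ `*` `]a, b[) (fun p : R * R => omega_t p.1 p.2),
      measurable_fun (`]0, T[ `*` `]a, b[) (fun p : R * R => omega_tt p.1 p.2),
      {ae mu, forall x, a < x < b ->
        weak_deriv 0 T (omega ^~ x) (omega_t ^~ x)},
      {ae mu, forall x, a < x < b ->
        weak_deriv 0 T (omega_t ^~ x) (omega_tt ^~ x)} &
      exists C : R, {ae mu, forall t, 0 < t <= T ->
        forall m : nat, (m <= 1)%N ->
        (t%:E * Hnorm a b m.*2 (omega_tt t) + Hnorm a b m.*2 (omega_t t)
         <= (C * t `^ (alpha0 - 1))%:E)%E}].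

End Problem.

Section Scheme.
Context {R : realType}.
Local Notation mu := (@lebesgue_measure R).
Implicit Types (T tau sigma r a b : R) (s : seq R) (u : R -> R).

Definition weight tau (K : R -> R) (n j : nat) : R :=
  tau^-1 * \int[mu]_(t in `[n.-1%:R * tau, n%:R * tau])
             \int[mu]_(y in `[j.-1%:R * tau, Num.min t (j%:R * tau)]) K (t - y).

(* A partition of [a, b] is given, as in itv_partition, by the sequence s of its
   nodes other than a. *)
Definition node a s (i : nat) : R := nth a (a :: s) i.

Definition elt_size a s (i : nat) : R := node a s i.+1 - node a s i.

Definition mesh a s : R := \big[Num.max/0]_(i < size s) elt_size a s i.

Definition quasi_uniform (kappa : R) a s : Prop :=
  forall i, (i < size s)%N -> mesh a s <= kappa * elt_size a s i.

Definition in_Sh a b s u : Prop :=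
  [/\ {within `[a, b], continuous u},
      forall i, (i < size s)%N -> exists c0 c1, forall x,
        node a s i <= x <= node a s i.+1 -> u x = c0 + c1 * x,
      u a = 0 & u b = 0].

(* For u in S_h, derive1 u is the gradient away from the nodes, which form a null
   set. *)
Definition fd_scheme T sigma r a b (alpha0 : R) (dq : R -> R)
    (F : R -> R -> R) (N : nat) s (W : nat -> R -> R) : Prop :=
  let tau := T / N%:R in
  let w := weight tau dq in
  let wt := weight tau (beta alpha0) in
  forall n, (1 <= n <= N)%N -> in_Sh a b s (W n) /\
    forall L, in_Sh a b s L ->
      L2inner a b (W n) L
      + L2inner a b (fun x => \sum_(1 <= j < n.+1) w n j * W j x) L
      + lambda sigma r *
          L2inner a b (fun x => \sum_(1 <= j < n.+1) wt n j * W j x) L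
      + 2^-1 * sigma ^+ 2 *
          L2inner a b (fun x => \sum_(1 <= j < n.+1) wt n j * derive1 (W j) x) (derive1 L)
      = L2inner a b (F (n%:R * tau)) L.

End Scheme.

(* Main.v *)
Require Import Defs.
From mathcomp Require Import all_boot all_order all_algebra.
From mathcomp Require Import all_classical all_reals all_analysis.
From mathcomp Require Import measurable_realfun lra ring zify.

(* The quadrature weights are such that the scheme applies the exact
   convolution operators, at the grid times, to the interpolant of the discrete
   solution that is piecewise linear in time. In one space dimension the Ritz
   projection is nodal interpolation, so the stiffness form of omega against a
   function L of S_h only involves the nodal values of omega: it is a
   combination of differences u(p) - u(q) ("kinks"), equal to minus the
   integral of u'' times L. Pairing omega with L, or applying such a combination
   to it, gives a function G of time with |G'| <= M t^(al-1) and
   |G''| <= M t^(al-2) in a weak sense, where M is a multiple of the L^2 norm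
   of L; this controls the error of linear interpolation in time, and Young's
   inequality for sequences turns it into the order 1/2 + 3 al/2 in l^2. The
   matrix of the weights of beta is a convex Toeplitz matrix, hence positive (by
   the Fejer decomposition), and the weights of q' are O(tau), so that testing
   the error equation with I_h omega - W and the discrete Gronwall inequality
   conclude. The interpolation error in space is bounded by testing with sums of
   hat functions weighted by the interpolation defects. *)

Set Implicit Arguments.
Unset Strict Implicit.
Unset Printing Implicit Defensive.

Import Order.TTheory GRing.Theory Num.Theory.
Import numFieldNormedType.Exports.

Local Open Scope classical_set_scope.
Local Open Scope ring_scope.

(** * Integrals of real-valued functions *)

Section integration.
Context {R : realType}.
Local Notation mu := (@lebesgue_measure R).
Implicit Types (A B D : set R) (f g h k u v : R -> R).

(** The regularity assumption gives weak time derivatives for almost every position and Sobolev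
    norms for almost every time, hence nothing at a given grid time. Every estimate is therefore
    obtained by duality, with explicit spline test functions, and Fubini's theorem links the two
    almost-everywhere statements. No bound on the second space derivative of [omega] itself is
    assumed either: the stiffness form, which vanishes at time 0, inherits a bound from its time
    derivative, and that bound is turned into one on the L^2 norm of [omega_xx]. Without it, the
    equation could not be tested in space. The order comes from a discrete convolution. On the time
    cell [i] the interpolation defect is of size [tau^al i^(al-2)], a summable sequence, and it is
    convolved with the integrals of the kernel over the cells. For [beta] these are, up to a
    constant, [tau^al ((k+1)^al - k^al)]; the increments being at most 1, their squares sum to at
    most [N^al]. Thus [tau] times the sum of the squared truncation errors is of size [tau^(1 + 4
    al) N^al = T^al tau^(1 + 3 al)]. *)

#[global] Instance ae_lebesgue_filter : Filter (almost_everywhere mu).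
Proof. exact: ae_filter_ringOfSetsType. Qed.

Definition itg A f := mu.-integrable A (EFin \o f).

Lemma itg_meas A f : itg A f -> measurable_fun A f.
Proof. by move=> /integrableP[/measurable_EFinP]. Qed.

Lemma itgS A B f : measurable A -> measurable B -> B `<=` A -> itg A f -> itg B f.
Proof. by move=> mA mB BA; exact: integrableS. Qed.

Lemma eq_itg A f g : measurable A -> (forall x, A x -> f x = g x) -> itg A f -> itg A g.
Proof.
move=> mA fg; apply: eq_integrable => // x /set_mem Ax /=.
by rewrite fg.
Qed.

Lemma itgD A f g : measurable A -> itg A f -> itg A g -> itg A (fun x => f x + g x).
Proof.
move=> mA If Ig; rewrite /itg (_ : EFin \o _ = (EFin \o f) \+ (EFin \o g))%E.
  exact: integrableD.
by apply/funext.
Qed.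

Lemma itgZ A c f : measurable A -> itg A f -> itg A (fun x => c * f x).
Proof.
move=> mA If; rewrite /itg (_ : EFin \o _ = (fun x => c%:E * (EFin \o f) x)%E).
  exact: integrableZl.
by apply/funext.
Qed.

Lemma itgN A f : measurable A -> itg A f -> itg A (fun x => - f x).
Proof.
by move=> mA If; apply: (eq_itg mA _ (itgZ (-1) mA If)) => x _; rewrite mulN1r.
Qed.

Lemma itgB A f g : measurable A -> itg A f -> itg A g -> itg A (fun x => f x - g x).
Proof. by move=> mA If Ig; exact: itgD (itgN mA Ig). Qed.

Lemma itg_norm A f : itg A f -> itg A (fun x => `|f x|).
Proof. exact: integrable_norm. Qed.

Lemma le_itg A f g : measurable A -> measurable_fun A f ->
  (forall x, A x -> `|f x| <= g x) -> itg A g -> itg A f.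
Proof.
move=> mA mf fg Ig; apply: le_integrable Ig => //; first exact/measurable_EFinP.
move=> x Ax /=; rewrite lee_fin (le_trans (fg _ Ax)) ?ler_norm//.
Qed.

Lemma le_itg_ae A f g : measurable A -> measurable_fun A f ->
  {ae mu, forall x, A x -> `|f x| <= g x} -> itg A g -> itg A f.
Proof.
move=> mA mf fg Ig; apply/integrableP; split; first exact/measurable_EFinP.
have /integrableP[mg Ioo] := Ig.
apply: le_lt_trans Ioo; apply: ae_ge0_le_integral => //.
- by do 2 apply: measurableT_comp => //.
- exact: measurableT_comp.
apply: filterS fg => x fg Ax /=; rewrite lee_fin (le_trans (fg Ax)) ?ler_norm//.
Qed.

Lemma itg_sum (I : Type) (s : seq I) (F : I -> R -> R) A : measurable A ->
  (forall i, itg A (F i)) -> itg A (fun x => \sum_(i <- s) F i x).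
Proof.
move=> mA IF; elim: s => [|i s IH].
  by apply: (@eq_itg _ (cst 0)) => // [x _|]; [rewrite big_nil|exact: integrable0].
by apply: (@eq_itg _ (fun x => F i x + \sum_(j <- s) F j x)) => [//|x _|];
  [rewrite big_cons|exact: itgD].
Qed.

Lemma bnd_itg A f C : measurable A -> (mu A < +oo)%E -> measurable_fun A f ->
  (forall x, A x -> `|f x| <= C) -> itg A f.
Proof.
move=> mA Aoo mf fC; apply: (@le_itg _ _ (cst C)) => //.
apply/integrableP; split; first exact/measurable_EFinP.
rewrite (@integral_cst _ _ _ mu A mA `|C%:E|%E) lte_mul_pinfty//.
Qed.

Lemma bnd_mul_itg A f g C : measurable A -> measurable_fun A g ->
  (forall x, A x -> `|g x| <= C) -> itg A f -> itg A (fun x => f x * g x).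
Proof.
move=> mA mg gC If; apply: (@le_itg _ _ (fun x => C * `|f x|)) => //.
- by apply: measurable_funM => //; exact: itg_meas.
- move=> x Ax; rewrite normrM mulrC ler_wpM2r ?gC//.
- by apply: itgZ => //; exact: itg_norm.
Qed.

Lemma eq_Rint A g f : (forall x, A x -> f x = g x) ->
  \int[mu]_(x in A) f x = \int[mu]_(x in A) g x.
Proof. by move=> fg; apply: eq_Rintegral => x /set_mem; exact: fg. Qed.

Lemma RintD A f g : measurable A -> itg A f -> itg A g ->
  \int[mu]_(x in A) (f x + g x) = \int[mu]_(x in A) f x + \int[mu]_(x in A) g x.
Proof. by move=> mA If Ig; rewrite RintegralD. Qed.

Lemma RintB A f g : measurable A -> itg A f -> itg A g ->
  \int[mu]_(x in A) (f x - g x) = \int[mu]_(x in A) f x - \int[mu]_(x in A) g x.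
Proof. by move=> mA If Ig; rewrite RintegralB. Qed.

Lemma RintZ A c f : measurable A -> itg A f ->
  \int[mu]_(x in A) (c * f x) = c * \int[mu]_(x in A) f x.
Proof. by move=> mA If; rewrite RintegralZl. Qed.

Lemma ae_eq_Rint A f g : measurable A -> measurable_fun A f -> measurable_fun A g ->
  {ae mu, forall x, A x -> f x = g x} ->
  \int[mu]_(x in A) f x = \int[mu]_(x in A) g x.
Proof.
move=> mA mf mg fg; congr fine; apply: ae_eq_integral => //.
- exact/measurable_EFinP.
- exact/measurable_EFinP.
by apply: filterS fg => x fg Ax /=; rewrite fg.
Qed.

Lemma le_Rint A f g : measurable A -> itg A f -> itg A g ->
  (forall x, A x -> f x <= g x) -> \int[mu]_(x in A) f x <= \int[mu]_(x in A) g x.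
Proof. by move=> *; exact: le_Rintegral. Qed.

(** Replacing [f] by [min f g], which equals it almost everywhere, reduces to an inequality valid
    everywhere. *)
Lemma le_Rint_ae A f g : measurable A -> itg A f -> itg A g ->
  {ae mu, forall x, A x -> f x <= g x} ->
  \int[mu]_(x in A) f x <= \int[mu]_(x in A) g x.
Proof.
move=> mA If Ig fg.
rewrite (@ae_eq_Rint A f (fun x => Num.min (f x) (g x))) //.
- apply: le_Rint => // [|x _]; last by rewrite ge_min lexx orbT.
  apply: (@le_itg _ _ (fun x => `|f x| + `|g x|)) => //.
  + by apply: measurable_minr => //; exact: itg_meas.
  + by move=> x _; rewrite minEle; case: ifP => _; rewrite ?lerDl ?lerDr.
  + by apply: itgD => //; exact: itg_norm.
- exact: itg_meas.
- by apply: measurable_minr => //; exact: itg_meas.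
- by apply: filterS fg => x fg Ax; rewrite min_l ?fg.
Qed.

Lemma norm_Rint_le A f g : measurable A -> itg A f -> itg A g ->
  {ae mu, forall x, A x -> `|f x| <= g x} ->
  `|\int[mu]_(x in A) f x| <= \int[mu]_(x in A) g x.
Proof.
move=> mA If Ig fg; apply: le_trans (le_normr_Rintegral _ _) _ => //.
by apply: le_Rint_ae => //; exact: itg_norm.
Qed.

Lemma Rint_sum (I : Type) (s : seq I) (F : I -> R -> R) A : measurable A ->
  (forall i, itg A (F i)) ->
  \int[mu]_(x in A) (\sum_(i <- s) F i x) = \sum_(i <- s) \int[mu]_(x in A) F i x.
Proof.
move=> mA IF; elim: s => [|i s IH].
  rewrite big_nil (@eq_Rintegral _ _ _ _ _ (cst 0)); first by rewrite Rintegral_cst// mul0r.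
  by move=> x _; rewrite big_nil.
rewrite big_cons -IH -RintegralD//; [|exact: IF|exact: itg_sum].
by apply: eq_Rintegral => x _; rewrite big_cons.
Qed.

Lemma Rint_cst_itv (a b c : R) : a <= b -> \int[mu]_(x in `]a, b[) c = c * (b - a).
Proof.
move=> ab; rewrite Rintegral_cst//= (@lebesgue_measure_itv R `]a, b[)/= lte_fin.
by case: ltP => // ba; rewrite (_ : b - a = 0)//; lra.
Qed.

Lemma itv_fin (i : interval R) (a b : R) : [set` i] `<=` `[a, b] -> (mu [set` i] < +oo)%E.
Proof.
move=> ib; apply: le_lt_trans (_ : (mu `[a, b] < +oo)%E).
  by apply: le_measure => //; rewrite inE.
by rewrite lebesgue_measure_itv/=; case: ifP => _; rewrite ?ltry// -EFinB ltry.
Qed.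

Lemma itg_cont (a b : R) f : {within `[a, b], continuous f} -> itg `[a, b] f.
Proof. by move=> cf; apply: continuous_compact_integrable => //; exact: segment_compact. Qed.

Lemma itg_oo_cc (a b : R) f : itg `[a, b] f -> itg `]a, b[ f.
Proof. by apply: itgS => //; exact: subset_itv_oo_cc. Qed.

Lemma Rint_oo_cc (a b : R) f : itg `]a, b[ f ->
  \int[mu]_(x in `]a, b[) f x = \int[mu]_(x in `[a, b]) f x.
Proof.
move=> If; congr fine; apply/esym; apply: (integral_itv_bndoo true false).
by apply/measurable_EFinP; exact: itg_meas.
Qed.

Lemma integrable_fine_itg A (F : R -> \bar R) : measurable A -> mu.-integrable A F ->
  itg A (fine \o F).
Proof.
move=> mA IF; apply: (@le_integrable _ (measurableTypeR R) R mu A mA _ F _ _ IF).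
  by apply/measurable_EFinP; apply: measurableT_comp => //; exact: measurable_int IF.
by move=> x _ /=; case: (F x) => [r| |] /=; rewrite ?normr0 ?lexx ?leey.
Qed.

(** An integrable function is finite almost everywhere, so sending its infinite values to 0 changes
    nothing. This brings the slice integrals of Fubini's theorem back to the reals. *)
Lemma Rint_fine A (F : R -> \bar R) : measurable A -> mu.-integrable A F ->
  \int[mu]_(x in A) fine (F x) = fine (\int[mu]_(x in A) F x)%E.
Proof.
move=> mA IF; congr fine; apply: ae_eq_integral => //.
- by apply/measurable_EFinP; apply: measurableT_comp => //; exact: measurable_int IF.
- exact: measurable_int IF.
by have := @integrable_ae _ (measurableTypeR R) R mu A mA F IF; apply: filterS => x F1 Ax; rewrite fineK// F1.
Qed.

(** By Tonelli's theorem, an integrable majorant of the slice integrals of [|h|], valid for almost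
    every [t], makes the zero extension of [h] integrable on the plane. Integrability of almost
    every slice is recorded because pulling a factor out of a slice integral requires it. *)
Lemma Rfubini A B (h : R -> R -> R) k : measurable A -> measurable B ->
  measurable_fun (A `*` B) (fun p : R * R => h p.1 p.2) -> itg A k ->
  {ae mu, forall t, A t -> (\int[mu]_(x in B) `|h t x|%:E <= (k t)%:E)%E} ->
  [/\ itg A (fun t => \int[mu]_(x in B) h t x),
      itg B (fun x => \int[mu]_(t in A) h t x),
      {ae mu, forall x, B x -> itg A (h ^~ x)} &
      \int[mu]_(t in A) \int[mu]_(x in B) h t x =
      \int[mu]_(x in B) \int[mu]_(t in A) h t x].
Proof.
move=> mA mB mh Ik hk.
pose f := EFin \o ((fun p : R * R => h p.1 p.2) \_ (A `*` B)).
have mAB : measurable (A `*` B) by exact: measurableX.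
have mf : measurable_fun setT f.
  by apply/measurable_EFinP; apply/(measurable_restrictT _ mAB).
have fE t x : A t -> f (t, x) = ((h t \_ B) x)%:E.
  move=> At; rewrite /f /= !patchE; case: ifPn => [/set_mem|/negP].
    by case=> /= _ Bx; rewrite mem_set.
  by move=> nAB; rewrite memNset// => Bx; apply: nAB; exact/mem_set.
have fE' t x : B x -> f (t, x) = (((h ^~ x) \_ A) t)%:E.
  move=> Bx; rewrite /f /= !patchE; case: ifPn => [/set_mem|/negP].
    by case=> /= At _; rewrite mem_set.
  by move=> nAB; rewrite memNset// => At; apply: nAB; exact/mem_set.
have fN t x : ~ A t -> f (t, x) = 0%E.
  by move=> At; rewrite /f /= patchE memNset// => -[].
have fN' t x : ~ B x -> f (t, x) = 0%E.
  by move=> At; rewrite /f /= patchE memNset// => -[].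
have mI : measurable_fun setT (fun t => \int[mu]_x `|f (t, x)|)%E.
  apply: (@measurable_fun_fubini_tonelli_F _ _ (measurableTypeR R)
    (measurableTypeR R) R mu (abse \o f)) => //=.
  exact: measurableT_comp.
have in1 t : A t -> (\int[mu]_x `|f (t, x)| = \int[mu]_(x in B) `|h t x|%:E)%E.
  move=> At; rewrite [RHS]integral_mkcond; apply: eq_integral => x _.
  by rewrite fE// !patchE; case: ifP => //= _; rewrite normr0.
have If : ((mu \x mu)%E).-integrable setT f.
  apply/integrable12ltyP => //.
  have /integrableP[mk koo] := Ik.
  apply: le_lt_trans koo; rewrite [leRHS]integral_mkcond.
  apply: ae_ge0_le_integral => //.
  - by move=> t _; exact: integral_ge0.
  - by move=> t _; rewrite patchE; case: ifP.
  - by apply/(measurable_restrictT _ mA); exact: measurableT_comp.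
  apply: filterS hk => t hk _; rewrite patchE; case: ifPn => [/set_mem At|/negP nA].
    rewrite in1// (le_trans (hk At))// lee_fin ler_norm//.
  rewrite integral0_eq// => x _; rewrite fN ?abse0// => At; apply: nA; exact/mem_set.
have FE t : A t -> (\int[mu]_x f (t, x) = \int[mu]_(x in B) (h t x)%:E)%E.
  move=> At; rewrite [RHS]integral_mkcond; apply: eq_integral => x _.
  by rewrite fE// !patchE; case: ifP.
have GE x : B x -> (\int[mu]_t f (t, x) = \int[mu]_(t in A) (h t x)%:E)%E.
  move=> Bx; rewrite [RHS]integral_mkcond; apply: eq_integral => t _.
  by rewrite fE'// !patchE; case: ifP.
have FN t : ~ A t -> (\int[mu]_x f (t, x) = 0)%E.
  by move=> At; rewrite integral0_eq// => x _; rewrite fN.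
have GN x : ~ B x -> (\int[mu]_t f (t, x) = 0)%E.
  by move=> At; rewrite integral0_eq// => t _; rewrite fN'.
have IF := integrable_fubini_F If.
have IG : mu.-integrable setT (fubini_G mu f).
  apply/integrableP; split; first exact: (@measurable_fubini_G _ _ (measurableTypeR R) (measurableTypeR R) R mu mu f If).
  have /(@integrable21ltyP _ _ (measurableTypeR R) (measurableTypeR R) R mu mu f mf) := If; apply: le_lt_trans.
  apply: ge0_le_integral => //.
  - apply: measurableT_comp => //.
    exact: (@measurable_fubini_G _ _ (measurableTypeR R) (measurableTypeR R) R mu mu f If).
  - apply: (@measurable_fun_fubini_tonelli_G _ _ (measurableTypeR R)
      (measurableTypeR R) R mu (abse \o f)) => //=.
    exact: measurableT_comp.
  move=> x _; apply: le_abse_integral => //.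
  exact: (measurableT_comp mf (measurable_pair2 x)).
have a2 := ae_integrable2 If.
have IFA := @integrableS _ (measurableTypeR R) R mu _ _ _ measurableT mA (@subsetT _ _) IF.
have IGB := @integrableS _ (measurableTypeR R) R mu _ _ _ measurableT mB (@subsetT _ _) IG.
split.
- apply: eq_itg (integrable_fine_itg mA IFA) => // t At.
  by rewrite /= /fubini_F FE.
- apply: eq_itg (integrable_fine_itg mB IGB) => // x Bx.
  by rewrite /= /fubini_G GE.
- apply: filterS a2 => x a2 Bx.
  rewrite /itg -(setTI A).
  apply/(@integrable_restrict _ (measurableTypeR R) R mu A mA setT measurableT).
  apply: (@eq_integrable _ (measurableTypeR R) R mu _ measurableT _ _ _ a2) => t _.
  by rewrite fE'// !patchE; case: ifP.
transitivity (\int[mu]_(t in A) fine (fubini_F mu f t)).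
  by apply: eq_Rintegral => t /set_mem At; rewrite /fubini_F FE.
transitivity (\int[mu]_(x in B) fine (fubini_G mu f x)); last first.
  by apply: eq_Rintegral => x /set_mem Bx; rewrite /fubini_G GE.
rewrite (Rint_fine mA IFA) (Rint_fine mB IGB); congr fine.
rewrite integral_mkcond [RHS]integral_mkcond.
have := Fubini If; rewrite -/(fubini_F mu f) -/(fubini_G mu f) => FG.
have -> : (fubini_F mu f) \_ A = fubini_F mu f.
  apply/funext => t; rewrite patchE; case: ifPn => // /negP nA.
  by rewrite /fubini_F FN// => At; apply: nA; exact/mem_set.
have -> : (fubini_G mu f) \_ B = fubini_G mu f; last by [].
apply/funext => t; rewrite patchE; case: ifPn => // /negP nA.
by rewrite /fubini_G GN// => At; apply: nA; exact/mem_set.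
Qed.

End integration.

(** * Mollified kinks *)

Section mollified_kink.
Context {R : realType}.
Local Notation mu := (@lebesgue_measure R).
Implicit Types (f g u : R -> R) (x y l e : R).

(** A Taylor expansion with quadratic remainder: stronger than having derivative [l] at [x], stable
    under sums, multiples and shifts, and provable for truncated powers by case analysis on signs.
    The constant may depend on [x]. *)
Definition quad f x l := exists C, forall h, `|h| <= 1 ->
  `|f (x + h) - f x - l * h| <= C * h ^+ 2.

Lemma quadD f g x l k : quad f x l -> quad g x k ->
  quad (fun y => f y + g y) x (l + k).
Proof.
move=> [C fC] [D gD]; exists (C + D) => h h1.
rewrite (_ : _ - _ - _ = (f (x + h) - f x - l * h) + (g (x + h) - g x - k * h)); last by ring.
by rewrite (le_trans (ler_normD _ _))// mulrDl lerD ?fC ?gD.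
Qed.

Lemma quadZ c f x l : quad f x l -> quad (fun y => c * f y) x (c * l).
Proof.
move=> [C fC]; exists (`|c| * C) => h h1.
rewrite (_ : _ - _ - _ = c * (f (x + h) - f x - l * h)); last by ring.
by rewrite normrM -mulrA ler_wpM2l ?fC.
Qed.

Lemma quad_sum (I : Type) (s : seq I) (F : I -> R -> R) x (L : I -> R) :
  (forall i, quad (F i) x (L i)) ->
  quad (fun y => \sum_(i <- s) F i y) x (\sum_(i <- s) L i).
Proof.
move=> FL; elim: s => [|i s [C IH]].
  by exists 0 => h _; rewrite !big_nil !subrr mul0r subr0 normr0 mul0r.
have [D iD] := FL i; exists (D + C) => h h1; rewrite !big_cons.
have := iD h h1; have := IH h h1.
set a := \sum_(_ <- _) F _ (x + h); set b := \sum_(_ <- _) F _ x; set c := \sum_(_ <- _) _.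
move=> ? ?; rewrite (_ : _ - _ - _ = (F i (x + h) - F i x - L i * h) + (a - b - c * h)); last by ring.
by rewrite (le_trans (ler_normD _ _))// mulrDl lerD.
Qed.

Lemma quad_shift c f x l : quad f (x + c) l -> quad (fun y => f (y + c)) x l.
Proof. by move=> [C fC]; exists C => h h1; have := fC h h1; rewrite (addrAC x c h). Qed.

Lemma quad_derive f x l : quad f x l -> is_derive x 1 f l.
Proof.
move=> [C fC].
have cv : h^-1 *: (f (h *: 1 + x) - f x) @[h --> 0^'] --> l.
  apply/cvgrPdist_le => e e0.
  have C0 : 0 <= C.
    by have := fC 1; rewrite normr1 lexx expr1n !mulr1 => /(_ isT) /(le_trans (normr_ge0 _)).
  pose d := Num.min 1 (e / (C + 1)).
  have d0 : 0 < d by rewrite lt_min ltr01 divr_gt0//; lra.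
  near=> h.
  have h0 : h != 0 by near: h; exact: nbhs_dnbhs_neq.
  have hd : `|h| < d by near: h; apply: dnbhs0_lt.
  move: (hd); rewrite lt_min => /andP[h1 hC].
  have := fC h (ltW h1).
  rewrite -[h *: 1]/(h * 1) mulr1 (addrC h x) => Ch; rewrite distrC.
  rewrite -[_ *: _]/(_ * _) (_ : _ - l = h^-1 * (f (x + h) - f x - l * h)); last first.
    by field.
  rewrite normrM normfV ler_pdivrMl ?normr_gt0// (le_trans Ch)//.
  rewrite -(ger0_norm (sqr_ge0 h)) normrX expr2 mulrCA ler_wpM2l//.
  rewrite (le_trans (ler_wpM2l C0 (ltW hC)))//.
  rewrite mulrCA ger_pMr// ler_pdivrMr; lra.
split; first by apply/cvg_ex; exists l.
by apply: cvg_lim.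
Unshelve. all: by end_near.
Qed.

Definition pp y : R := Num.max y 0.

Lemma ppE y : pp y = if 0 <= y then y else 0.
Proof. by rewrite /pp; case: leP => // y0; rewrite ?max_l ?max_r// ltW. Qed.

Lemma pp_ge0 y : 0 <= pp y. Proof. by rewrite le_max lexx orbT. Qed.

Lemma quad_pp2 x : quad (fun y => pp y ^+ 2) x (2 * pp x).
Proof.
exists 1 => h h1; rewrite !ppE ler_norml.
by do 2 case: ifP => /= ?; apply/andP; split; nra.
Qed.

Lemma quad_pp3 x : quad (fun y => pp y ^+ 3) x (3 * pp x ^+ 2).
Proof.
exists (3 * `|x| + 1) => h; rewrite ler_norml => /andP[h1 h2].
rewrite ler_norml !ppE; have h20 := sqr_ge0 h.
have x3 : 3 * `|x| * h ^+ 2 + h ^+ 2 = (3 * `|x| + 1) * h ^+ 2 by ring.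
case: ifP => xh; case: ifP => x0.
- rewrite -x3 ger0_norm//.
  have -> : (x + h) ^+ 3 - x ^+ 3 - 3 * x ^+ 2 * h = 3 * x * h ^+ 2 + h * h ^+ 2 by ring.
  have : 0 <= x * h ^+ 2 by rewrite mulr_ge0.
  by move=> xh2; apply/andP; split; nra.
- have xl : x < 0 by rewrite ltNge x0.
  have n0 : 0 <= `|x| * h ^+ 2 by rewrite mulr_ge0.
  have y1 : 0 <= (x + h) ^+ 3 by exact: exprn_ge0.
  have y2 : (x + h) ^+ 3 <= h ^+ 2.
    rewrite exprS -[leRHS]mul1r ler_pM ?sqr_ge0//; first lra.
    by rewrite ler_sqr ?nnegrE; lra.
  by rewrite expr0n /= expr0n/= !mulr0 mul0r !subr0 -x3; apply/andP; split; lra.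
- have kx : x + h < 0 by rewrite ltNge xh.
  rewrite -x3 ger0_norm// expr0n /= sub0r.
  have a1 : 0 <= x * (- h - x) * (- h) by rewrite !mulr_ge0; lra.
  have a2 : 0 <= x * (- h - x) * (- h + x) by rewrite !mulr_ge0; lra.
  have a3 : 0 <= x ^+ 2 * (- h) by rewrite mulr_ge0 ?sqr_ge0; lra.
  have a4 : 0 <= x ^+ 3 by rewrite exprn_ge0.
  have -> : - x ^+ 3 - 3 * x ^+ 2 * h = 3 * (x ^+ 2 * - h) - x ^+ 3 by ring.
  have e1 : x * (- h - x) * (- h) = x * h ^+ 2 - x ^+ 2 * (- h) by ring.
  have e2 : x * (- h - x) * (- h + x) = x * h ^+ 2 - x ^+ 3 by ring.
  by apply/andP; split; lra.
- have n0 : 0 <= `|x| * h ^+ 2 by rewrite mulr_ge0.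
  by rewrite -x3 !expr0n /= !mulr0 !mul0r !subrr; apply/andP; split; lra.
Qed.

(** The convolution of the positive part with the hat of half-width [e] and integral 1, in closed
    form as a second difference of truncated cubes. [moll1] and [moll2] are its derivatives: a
    smoothed step, and the hat itself, which approximates a Dirac mass. All three are exact outside
    [[-e, e]]. *)
Definition moll e y := (pp (y + e) ^+ 3 - 2 * pp y ^+ 3 + pp (y - e) ^+ 3) / (6 * e ^+ 2).
Definition moll1 e y := (pp (y + e) ^+ 2 - 2 * pp y ^+ 2 + pp (y - e) ^+ 2) / (2 * e ^+ 2).
Definition moll2 e y := (pp (y + e) - 2 * pp y + pp (y - e)) / e ^+ 2.

Lemma quad_ext f g x l k : f =1 g -> l = k -> quad f x l -> quad g x k.
Proof. by move=> fg <- [C fC]; exists C => h h1; rewrite -!fg fC. Qed.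

Lemma quad_moll e x : e != 0 -> quad (moll e) x (moll1 e x).
Proof.
move=> e0.
apply: (quad_ext _ _ (quadZ (6 * e ^+ 2)^-1 (quadD (quadD (quad_shift (quad_pp3 (x + e)))
  (quadZ (-2) (quad_pp3 x))) (quad_shift (quad_pp3 (x - e)))))).
  by move=> y; rewrite /moll mulrC; congr (_ * _); ring.
by rewrite /moll1; field.
Qed.

Lemma quad_moll1 e x : e != 0 -> quad (moll1 e) x (moll2 e x).
Proof.
move=> e0.
apply: (quad_ext _ _ (quadZ (2 * e ^+ 2)^-1 (quadD (quadD (quad_shift (quad_pp2 (x + e)))
  (quadZ (-2) (quad_pp2 x))) (quad_shift (quad_pp2 (x - e)))))).
  by move=> y; rewrite /moll1 mulrC; congr (_ * _); ring.
by rewrite /moll2; field.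
Qed.

Lemma moll_le e y : 0 < e -> y <= - e -> [/\ moll e y = 0, moll1 e y = 0 & moll2 e y = 0].
Proof.
move=> e0 ye; rewrite /moll /moll1 /moll2 /pp !max_r; try lra.
by split; rewrite ?expr0n /= ?mulr0 ?subrr ?addr0 ?mul0r.
Qed.

Lemma moll_ge e y : 0 < e -> e <= y -> [/\ moll e y = y, moll1 e y = 1 & moll2 e y = 0].
Proof.
move=> e0 ye; rewrite /moll /moll1 /moll2 /pp !max_l; try lra.
by split; field; lra.
Qed.

Lemma moll2_ge0 e y : 0 < e -> 0 <= moll2 e y.
Proof.
move=> e0; rewrite divr_ge0 ?sqr_ge0// !ppE.
by do 3 case: ifP => ?; lra.
Qed.

Lemma moll1_ge0_le1 e y : 0 < e -> 0 <= moll1 e y <= 1.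
Proof.
move=> e0; have e2 : 0 < 2 * e ^+ 2 by rewrite mulr_gt0// exprn_gt0.
rewrite /moll1 ler_pdivrMr// mul1r !ppE; apply/andP; split; last first.
  by do 3 case: ifP => ?; nra.
apply: divr_ge0; last exact: ltW.
by do 3 case: ifP => ?; nra.
Qed.

Lemma continuous_pp : continuous pp.
Proof. by move=> x; apply: (@continuous_max _ _ id (cst 0)); [exact: cvg_id|exact: cvg_cst]. Qed.

Lemma continuous_moll2 e : continuous (moll2 e).
Proof.
have cp k : continuous (fun y => pp (y + k)).
  move=> x; apply: (@continuous_comp _ _ _ (fun y => y + k) pp); last exact: continuous_pp.
  by apply: cvgD; [exact: cvg_id|exact: cvg_cst].
move=> x; apply: cvgM; last exact: cvg_cst.
apply: cvgD; last exact: cp.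
apply: cvgB; first exact: cp.
by apply: cvgM; [exact: cvg_cst|exact: continuous_pp].
Qed.

Lemma quad_continuous f (df : R -> R) : (forall x, quad f x (df x)) -> continuous f.
Proof.
move=> fq x; have [fd _] := quad_derive (fq x).
by apply: differentiable_continuous; exact/derivable1_diffP.
Qed.

Lemma moll_mono e x y : 0 < e -> x <= y -> 0 <= moll e y - moll e x <= y - x.
Proof.
move=> e0 xy; have e0' : e != 0 by rewrite gt_eqF.
have [c _ ->] : exists2 c, c \in `[x, y] & moll e y - moll e x = moll1 e c * (y - x).
  apply: MVT_segment => // [z _|]; first exact/quad_derive/quad_moll.
  apply: continuous_subspaceT; apply: (@quad_continuous _ (moll1 e)) => z.
  exact: quad_moll.
have /andP[c0 c1] := moll1_ge0_le1 c e0.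
by rewrite mulr_ge0 ?subr_ge0//= ler_piMl ?subr_ge0.
Qed.

Lemma moll_lip e x y : 0 < e -> `|moll e y - moll e x| <= `|y - x|.
Proof.
move=> e0; wlog xy : x y / x <= y => [H|].
  by case: (leP x y) => [/H//|/ltW/H]; rewrite distrC (distrC x).
have /andP[m0 m1] := moll_mono e0 xy.
by rewrite !ger0_norm// subr_ge0.
Qed.

Lemma pp_lip x y : `|pp y - pp x| <= `|y - x|.
Proof.
wlog xy : x y / x <= y => [H|].
  by case: (leP x y) => [/H//|/ltW/H]; rewrite distrC (distrC x).
rewrite [leRHS]ger0_norm ?subr_ge0// ler_norml !ppE.
by do 2 case: ifP => ?; apply/andP; split; lra.
Qed.

Lemma moll_pp e y : 0 < e -> `|moll e y - pp y| <= e.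
Proof.
move=> e0; case: (leP y (- e)) => [ye|ye].
  by have [-> _ _] := moll_le e0 ye; rewrite /pp max_r ?subrr ?normr0 ?ltW//; lra.
case: (leP e y) => ey.
  by have [-> _ _] := moll_ge e0 ey; rewrite /pp max_l ?subrr ?normr0 ?ltW//; lra.
have [m0 _ _] := moll_le e0 (lexx (- e)); have [me _ _] := moll_ge e0 (lexx e).
have /andP[] := moll_mono e0 (ltW ye); have /andP[] := moll_mono e0 (ltW ey).
by rewrite m0 me ler_norml ppE => *; case: ifP => ?; apply/andP; split; lra.
Qed.

Lemma Rint_moll2 a b c e : 0 < e -> a < b -> a <= c - e -> c + e <= b ->
  \int[mu]_(y in `]a, b[) moll2 e (y - c) = 1.
Proof.
move=> e0 ab ac cb; have e0' : e != 0 by rewrite gt_eqF.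
have cm2 : continuous (fun y => moll2 e (y - c)).
  move=> x; apply: (@continuous_comp _ _ _ (fun y => y - c) (moll2 e)); last exact: continuous_moll2.
  by apply: cvgB; [exact: cvg_id|exact: cvg_cst].
have q x : quad (fun y => moll1 e (y - c)) x (moll2 e (x - c)).
  exact/quad_shift/quad_moll1.
have cm1 := quad_continuous q.
rewrite Rint_oo_cc; last by apply/itg_oo_cc/itg_cont/continuous_subspaceT.
rewrite /Rintegral (@continuous_FTC2 _ _ (fun y => moll1 e (y - c)))//.
- have [_ -> _] := @moll_ge e (b - c) e0 ltac:(lra).
  have [_ -> _] := @moll_le e (a - c) e0 ltac:(lra).
  by rewrite -EFinB subr0.
- exact: continuous_subspaceT.
- split; [|apply: cvg_at_right_filter; exact: cm1|apply: cvg_at_left_filter; exact: cm1].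
  by move=> x _; have [] := quad_derive (q x).
- by move=> x _; rewrite derive1E; have [_ ->] := quad_derive (q x).
Qed.

(** The shifted hat is a probability density carried by [[c - e, c + e]], so the integral is an
    average of values of [u] within [k] of [u0]. *)
Lemma Rint_bump (a b c e u0 k : R) u : 0 < e -> a < b -> a <= c - e -> c + e <= b ->
  {within `[a, b], continuous u} ->
  (forall y, a <= y <= b -> `|y - c| <= e -> `|u y - u0| <= k) ->
  `|\int[mu]_(y in `]a, b[) (u y * moll2 e (y - c)) - u0| <= k.
Proof.
move=> e0 ab ac cb cu uk.
have cm2 : continuous (fun y => moll2 e (y - c)).
  move=> x; apply: (@continuous_comp _ _ _ (fun y => y - c) (moll2 e)); last exact: continuous_moll2.
  by apply: cvgB; [exact: cvg_id|exact: cvg_cst].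
have Im : itg `]a, b[ (fun y => moll2 e (y - c)).
  by apply/itg_oo_cc/itg_cont/continuous_subspaceT.
have Iu : itg `]a, b[ (fun y => u y * moll2 e (y - c)).
  have cm2' := @continuous_subspaceT _ _ `[a, b] _ cm2.
  by apply/itg_oo_cc/itg_cont => x; apply: cvgM; [exact: cu|exact: cm2'].
have mab : measurable (`]a, b[ : set R) by exact: measurable_itv.
rewrite -[u0]mulr1 -(Rint_moll2 e0 ab ac cb) -RintegralZl// -RintegralB//; last exact: itgZ.
rewrite -[leRHS]mulr1 -(Rint_moll2 e0 ab ac cb) -RintegralZl//.
apply: norm_Rint_le => //.
- by apply: itgB => //; exact: itgZ.
- exact: itgZ.
apply: aeW => y /=; rewrite in_itv/= => /andP[ay yb].
rewrite -mulrBl normrM (ger0_norm (moll2_ge0 _ e0)).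
case: (lerP `|y - c| e) => yc.
  by rewrite ler_wpM2r ?moll2_ge0// uk// !ltW.
have -> : moll2 e (y - c) = 0; last by rewrite !mulr0.
move: yc; rewrite ltr_normr => /orP[] yc; first by have [] := @moll_ge e (y - c) e0 (ltW yc).
by have [] := @moll_le e (y - c) e0 ltac:(lra).
Qed.

Lemma within_cont_eps a b u x : {within `[a, b], continuous u} -> a <= x <= b ->
  forall e, 0 < e -> exists2 d, 0 < d & forall y, a <= y <= b -> `|y - x| < d -> `|u y - u x| < e.
Proof.
move=> /subspace_continuousP cu xab e e0.
have /cvgrPdist_lt /(_ e e0) := cu x ltac:(by rewrite /= in_itv).
rewrite near_withinE => /nbhs_ballP [d /= d0 dP]; exists d => // y yab yx.
by rewrite distrC; apply: dP; rewrite /ball/= ?in_itv//= distrC.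
Qed.

End mollified_kink.

Lemma C1_test_quad (R : realType) (a b c d : R) (f df : R -> R) :
  (forall x, quad f x (df x)) -> continuous df -> a < c -> d < b ->
  (forall x, ~~ (c <= x <= d) -> f x = 0) -> C1_test a b f /\ derive1 f = df.
Proof.
move=> fq cdf ac db f0; have fE : derive1 f = df.
  by apply/funext => x; rewrite derive1E; have [_ ->] := quad_derive (fq x).
split=> //; split; last by exists c, d.
  by move=> x; have [] := quad_derive (fq x).
by rewrite fE.
Qed.

Lemma cvg_bigsum (R : realType) (T : Type) (F : set_system T) {FF : Filter F}
    (I : Type) (s : seq I) (f : I -> T -> R) (l : I -> R) :
  (forall i, f i x @[x --> F] --> l i) ->
  \sum_(i <- s) f i x @[x --> F] --> \sum_(i <- s) l i.
Proof.
move=> fl; elim: s => [|i s IH].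
  rewrite big_nil (_ : (fun x => _) = cst 0); first exact: cvg_cst.
  by apply/funext => x; rewrite big_nil.
rewrite big_cons (_ : (fun x => _) = (fun x => f i x + \sum_(j <- s) f j x)).
  by apply: cvgD.
by apply/funext => x; rewrite big_cons.
Qed.

(** * Combinations of kinks and their smoothing inside the interval *)

Section kinks.
Context {R : realType} (a b : R) (I : finType) (m p q : I -> R).
Local Notation mu := (@lebesgue_measure R).
Hypothesis ab : a < b.
Hypothesis pI : forall i, a <= p i <= b.
Hypothesis qI : forall i, a <= q i <= b.

(** The pairing of [u] with the second distributional derivative of [kL], a measure with mass [m i]
    at [p i] and [- m i] at [q i]. Its total mass is 0, so [kL] is constant to the right of all
    kinks; the constant is the sum of the [m i * (q i - p i)], whence the moment condition in the
    sequel. *)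
Definition kf (u : R -> R) : R := \sum_i m i * (u (p i) - u (q i)).
Definition kL (y : R) : R := \sum_i m i * (pp (y - p i) - pp (y - q i)).

(* The kinks are moved towards the midpoint, which keeps the first moment
   condition and leaves room for the mollification inside (a, b). *)
Definition shrink (d x : R) : R := (a + b) / 2 + (1 - d) * (x - (a + b) / 2).
Definition kwidth (d : R) : R := d * (b - a) / 4.
(** [F] stands for [moll], [moll1] or [moll2]: one formula covers the smoothed kinks and their first
    two derivatives. *)
Definition kmoll (F : R -> R -> R) (d y : R) : R :=
  \sum_i m i * (F (kwidth d) (y - shrink d (p i)) - F (kwidth d) (y - shrink d (q i))).

Lemma kwidth_gt0 d : 0 < d -> 0 < kwidth d.
Proof. by move=> d0; rewrite divr_gt0// mulr_gt0// subr_gt0. Qed.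

(** An end point moves inwards by [d * (b - a) / 2], twice the half-width of the bumps; a bump
    centred at a shrunk point thus keeps a margin [kwidth d] to both ends. *)
Lemma shrink_itv d x : 0 < d < 1 -> a <= x <= b ->
  a + 2 * kwidth d <= shrink d x <= b - 2 * kwidth d.
Proof.
move=> /andP[d0 d1] /andP[ax xb]; rewrite /shrink /kwidth.
have h1 : 0 <= (1 - d) * (x - a) by rewrite mulr_ge0; lra.
have h2 : 0 <= (1 - d) * (b - x) by rewrite mulr_ge0; lra.
by apply/andP; split; lra.
Qed.

Lemma quad_kmoll (F G : R -> R -> R) d :
  (forall e x, e != 0 -> quad (F e) x (G e x)) -> 0 < d ->
  forall x, quad (kmoll F d) x (kmoll G d x).
Proof.
move=> FG d0 x; have k0 : kwidth d != 0 by rewrite gt_eqF// kwidth_gt0.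
apply: quad_sum => i.
apply: (quad_ext _ _ (quadZ (m i) (quadD (quad_shift (FG _ (x - shrink d (p i)) k0))
  (quadZ (-1) (quad_shift (FG _ (x - shrink d (q i)) k0)))))).
  by move=> y /=; rewrite mulN1r.
by rewrite mulN1r.
Qed.

(** The three alternatives are the behaviours of [moll2], [moll1] and [moll] to the right of a kink.
    The constants cancel in each difference, and the linear parts leave [1 - d] times the first
    moment. *)
Lemma kmoll_out (F : R -> R -> R) d x : 0 < d < 1 ->
  (forall e y, 0 < e -> y <= - e -> F e y = 0) ->
  ((forall e y, 0 < e -> e <= y -> F e y = 0) \/
   (forall e y, 0 < e -> e <= y -> F e y = 1) \/
   (forall e y, 0 < e -> e <= y -> F e y = y) /\ \sum_i m i * (q i - p i) = 0) ->
  ~~ (a + kwidth d <= x <= b - kwidth d) -> kmoll F d x = 0.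
Proof.
move=> d01 Fle Fge; have /andP[d0 d1] := d01; have k0 := kwidth_gt0 d0.
rewrite negb_and -!ltNge => /orP[xl|xr].
  apply: big1 => i _.
  have /andP[? ?] := shrink_itv d01 (pI i); have /andP[? ?] := shrink_itv d01 (qI i).
  by rewrite !Fle ?subrr ?mulr0//; lra.
have e1 i : kwidth d <= x - shrink d (p i) by have /andP[? ?] := shrink_itv d01 (pI i); lra.
have e2 i : kwidth d <= x - shrink d (q i) by have /andP[? ?] := shrink_itv d01 (qI i); lra.
case: Fge => [F0|[F1|[FE mpq]]].
- by apply: big1 => i _; rewrite !F0 ?subrr ?mulr0.
- by apply: big1 => i _; rewrite !F1 ?subrr ?mulr0.
transitivity ((1 - d) * \sum_i m i * (q i - p i)); last by rewrite mpq mulr0.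
rewrite /kmoll mulr_sumr; apply: eq_bigr => i _.
by rewrite !FE// /shrink; ring.
Qed.

Lemma continuous_kmoll2 d : continuous (kmoll (@moll2 R) d).
Proof.
move=> x; apply: cvg_bigsum => i; apply: cvgM; first exact: cvg_cst.
have c c' : continuous (fun y : R => moll2 (kwidth d) (y - c')).
  move=> z; apply: (@continuous_comp _ _ _ (fun y => y - c') (moll2 _)).
    by apply: cvgB; [exact: cvg_id|exact: cvg_cst].
  exact: continuous_moll2.
by apply: cvgB; exact: c.
Qed.

Lemma kmoll1_test d : 0 < d < 1 ->
  C1_test a b (kmoll (@moll1 R) d) /\ derive1 (kmoll (@moll1 R) d) = kmoll (@moll2 R) d.
Proof.
move=> d01; have /andP[d0 d1] := d01; have k0 := kwidth_gt0 d0.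
have ak : a < a + kwidth d by rewrite ltrDl.
have bk : b - kwidth d < b by rewrite gtrDl oppr_lt0.
have c2 : continuous (kmoll (@moll2 R) d) by exact: continuous_kmoll2.
apply: (C1_test_quad (quad_kmoll (@quad_moll1 R) d0) c2 ak bk).
move=> x; apply: kmoll_out => //; first by move=> e y e0 /(moll_le e0)[].
by right; left => e y e0 /(moll_ge e0)[].
Qed.

Lemma kmoll_test d : \sum_i m i * (q i - p i) = 0 -> 0 < d < 1 ->
  C1_test a b (kmoll (@moll R) d) /\ derive1 (kmoll (@moll R) d) = kmoll (@moll1 R) d.
Proof.
move=> mpq d01; have /andP[d0 d1] := d01; have k0 := kwidth_gt0 d0.
have ak : a < a + kwidth d by rewrite ltrDl.
have bk : b - kwidth d < b by rewrite gtrDl oppr_lt0.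
have c1 := quad_continuous (quad_kmoll (@quad_moll1 R) d0).
apply: (C1_test_quad (quad_kmoll (@quad_moll R) d0) c1 ak bk).
move=> x; apply: kmoll_out => //; first by move=> e y e0 /(moll_le e0)[].
by right; right; split=> // e y e0 /(moll_ge e0)[].
Qed.

Lemma kmoll2_out d x : 0 < d < 1 -> ~~ (a + kwidth d <= x <= b - kwidth d) ->
  kmoll (@moll2 R) d x = 0.
Proof.
move=> d01; apply: kmoll_out => //; first by move=> e y e0 /(moll_le e0)[].
by left => e y e0 /(moll_ge e0)[].
Qed.

(** Smoothing and displacement each cost a multiple of [d] per kink. Uniformity in [y] is what makes
    the L^2 norms of the smoothed kinks converge. *)
Lemma kmoll_kL : exists2 K, 0 <= K &
  forall d y, 0 < d < 1 -> `|kmoll (@moll R) d y - kL y| <= K * d.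
Proof.
exists (\sum_i `|m i| * (2 * (b - a))).
  by apply: sumr_ge0 => i _; rewrite !mulr_ge0// subr_ge0 ltW.
move=> d y d01; have /andP[d0 d1] := d01; have k0 := kwidth_gt0 d0.
have one x : a <= x <= b -> `|moll (kwidth d) (y - shrink d x) - pp (y - x)| <= d * (b - a).
  move=> /andP[ax xb].
  rewrite -(subrKA (pp (y - shrink d x))) (le_trans (ler_normD _ _))//.
  have h1 := moll_pp (y - shrink d x) k0.
  have h2 := pp_lip (y - x) (y - shrink d x).
  have h3 : `|y - shrink d x - (y - x)| <= d * (b - a) / 2.
    rewrite (_ : _ - _ = d * (x - (a + b) / 2)); last by rewrite /shrink; ring.
    rewrite normrM gtr0_norm// -mulrA ler_wpM2l ?(ltW d0)// ler_norml.
    by apply/andP; split; lra.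
  have h4 : kwidth d <= d * (b - a) / 2.
    have : 0 < d * (b - a) by rewrite mulr_gt0// subr_gt0.
    by rewrite /kwidth; lra.
  by rewrite (le_trans (lerD h1 h2))//; lra.
rewrite /kmoll /kL -sumrB mulr_suml (le_trans (ler_norm_sum _ _ _))//.
apply: ler_sum => i _; rewrite -mulrBr normrM -mulrA ler_wpM2l//.
have := one _ (pI i); have := one _ (qI i).
set A := moll _ _; set B := pp _; set C := moll _ _; set D := pp _ => h1 h2.
rewrite (_ : C - A - (D - B) = (C - D) - (A - B)); last by ring.
by rewrite (le_trans (ler_normB _ _))// mulrC; lra.
Qed.

(** Two translates of a 1-Lipschitz function differ by at most the distance between their kinks: a
    bound free of [d]. *)
Lemma kmoll_lip d y : 0 < d < 1 ->
  `|kmoll (@moll R) d y| <= \sum_i `|m i| * `|q i - p i|.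
Proof.
move=> /andP[d0 d1]; have k0 := kwidth_gt0 d0.
rewrite (le_trans (ler_norm_sum _ _ _))//; apply: ler_sum => i _.
rewrite normrM ler_wpM2l// (le_trans (moll_lip _ _ k0))//.
rewrite (_ : _ - _ = (1 - d) * (q i - p i)); last by rewrite /shrink; ring.
by rewrite normrM ler_piMl// ger0_norm; lra.
Qed.

Lemma kmoll1_bound d y : 0 < d < 1 -> `|kmoll (@moll1 R) d y| <= \sum_i `|m i|.
Proof.
move=> /andP[d0 d1]; have k0 := kwidth_gt0 d0.
rewrite (le_trans (ler_norm_sum _ _ _))//; apply: ler_sum => i _.
rewrite normrM ler_piMr//.
have /andP[? ?] := moll1_ge0_le1 (y - shrink d (p i)) k0.
have /andP[? ?] := moll1_ge0_le1 (y - shrink d (q i)) k0.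
by rewrite ler_norml; apply/andP; split; lra.
Qed.

Lemma kmoll2_cvg (u : R -> R) : {within `[a, b], continuous u} ->
  \int[mu]_(y in `]a, b[) (u y * kmoll (@moll2 R) d y) @[d --> 0^'+] --> kf u.
Proof.
move=> cu.
have mab : measurable (`]a, b[ : set R) by exact: measurable_itv.
have one x : a <= x <= b ->
    \int[mu]_(y in `]a, b[) (u y * moll2 (kwidth d) (y - shrink d x)) @[d --> 0^'+] --> u x.
  move=> xab; apply/cvgrPdist_le => e e0.
  have [r r0 rP] := within_cont_eps cu xab e0.
  near=> d.
  have d0 : 0 < d by near: d; exact: nbhs_right_gt.
  have d1 : d < 1 by near: d; apply: nbhs_right_lt; exact: ltr01.
  have dr : d < r / (b - a).
    by near: d; apply: nbhs_right_lt; rewrite divr_gt0// subr_gt0.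
  have d01 : 0 < d < 1 by rewrite d0.
  have /andP[s1 s2] := shrink_itv d01 xab; have k0 := kwidth_gt0 d0.
  rewrite distrC; apply: Rint_bump => //; try lra.
  move=> y yab ys; apply/ltW/rP => //.
  move: dr; rewrite ltr_pdivlMr ?subr_gt0// => dr.
  apply: le_lt_trans dr.
  rewrite -(subrKA (shrink d x)) (le_trans (ler_normD _ _))//.
  have h3 : `|shrink d x - x| <= d * (b - a) / 2.
    rewrite (_ : _ - _ = d * ((a + b) / 2 - x)); last by rewrite /shrink; ring.
    have /andP[? ?] := xab.
    rewrite normrM gtr0_norm// -mulrA ler_wpM2l ?(ltW d0)// ler_norml.
    by apply/andP; split; lra.
  by have := ys; rewrite /kwidth in k0 *; lra.
have II d x : itg `]a, b[ (fun y => u y * moll2 (kwidth d) (y - shrink d x)).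
  have cm2 : continuous (fun y => moll2 (kwidth d) (y - shrink d x)).
    move=> z; apply: (@continuous_comp _ _ _ (fun y => y - _) (moll2 _)).
      by apply: cvgB; [exact: cvg_id|exact: cvg_cst].
    exact: continuous_moll2.
  have cm2' := @continuous_subspaceT _ _ `[a, b] _ cm2.
  by apply/itg_oo_cc/itg_cont => z; apply: cvgM; [exact: cu|exact: cm2'].
rewrite (_ : (fun d => _) = (fun d => \sum_i m i *
    (\int[mu]_(y in `]a, b[) (u y * moll2 (kwidth d) (y - shrink d (p i))) -
     \int[mu]_(y in `]a, b[) (u y * moll2 (kwidth d) (y - shrink d (q i)))))); last first.
  apply/funext => d.
  rewrite (@eq_Rint _ _ (fun y => \sum_i m i *
    (u y * moll2 (kwidth d) (y - shrink d (p i)) - u y * moll2 (kwidth d) (y - shrink d (q i))))).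
    rewrite Rint_sum//; last by move=> i; apply: itgZ => //; exact: itgB.
    by apply: eq_bigr => i _; rewrite RintZ ?RintB//; exact: itgB.
  move=> y _; rewrite /kmoll mulr_sumr; apply: eq_bigr => i _; ring.
apply: cvg_bigsum => i; apply: cvgM; first exact: cvg_cst.
by apply: cvgB; exact: one.
Unshelve. all: by end_near.
Qed.

End kinks.

Lemma cvg_bound_lim (R : realType) (f : R -> R) (l X K : R) :
  f d @[d --> 0^'+] --> l -> 0 <= K ->
  (forall d, 0 < d < 1 -> `|f d| <= X + K * d) -> `|l| <= X.
Proof.
move=> /cvgrPdist_le fl K0 fX; apply/ler_addgt0Pr => e e0.
have e2 : 0 < e / 2 by rewrite divr_gt0.
have [d [dl d01 dK]] : exists d, [/\ `|l - f d| <= e / 2, 0 < d < 1 & K * d <= e / 2].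
  near (0 : R)^'+ => d; exists d; split.
  - by near: d; exact: fl.
  - apply/andP; split; first by near: d; exact: nbhs_right_gt.
    by near: d; apply: nbhs_right_lt; exact: ltr01.
  - have d0 : 0 < d by near: d; exact: nbhs_right_gt.
    apply: (@le_trans _ _ ((K + 1) * d)); first by rewrite mulrDl lerDl mul1r ltW.
    rewrite mulrC -ler_pdivlMr; last lra.
    by apply: ltW; near: d; apply: nbhs_right_lt; rewrite divr_gt0//; lra.
rewrite -(subrK (f d) l) (le_trans (ler_normD _ _))//.
by have := fX d d01; lra.
Unshelve. all: by end_near.
Qed.

Lemma pp_continuous_shift (R : realType) (c : R) : continuous (fun y : R => pp (y - c)).
Proof.
move=> z; apply: (@continuous_comp _ _ _ (fun y => y - c) (@pp R)).
  by apply: cvgB; [exact: cvg_id|exact: cvg_cst].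
exact: continuous_pp.
Qed.

Lemma kL_continuous (R : realType) (I : finType) (m P Q : I -> R) : continuous (kL m P Q).
Proof.
move=> x; apply: cvg_bigsum => i; apply: cvgM; first exact: cvg_cst.
by apply: cvgB; exact: pp_continuous_shift.
Qed.

(** * Square-integrable functions *)

Section L2.
Context {R : realType}.
Local Notation mu := (@lebesgue_measure R).
Variables (a b : R).
Implicit Types (u v w : R -> R).

Let D : set R := `]a, b[.
Let mD : measurable D. Proof. exact: measurable_itv. Qed.

Lemma is_L2P u : is_L2 a b u <-> measurable_fun D u /\ itg D (fun x => u x ^+ 2).
Proof.
have E : (fun x => (u \_ D) x ^+ 2) = (fun x => u x ^+ 2) \_ D.
  by apply/funext => x; rewrite !patchE; case: ifP => // _; rewrite expr0n.
split=> [u2|[mu2 Iu]].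
  have mu2 : measurable_fun setT (u \_ D).
    by move: u2; rewrite /is_L2 inE => /andP[+ _]; rewrite inE.
  split; first exact/(measurable_restrictT _ mD).
  have := Lfun2_integrable_sqr u2; rewrite E => Iu.
  rewrite /itg -(setTI D).
  apply/(@integrable_restrict _ (measurableTypeR R) R mu D mD setT measurableT).
  by rewrite -restrict_EFin in Iu.
have mu3 : measurable_fun setT (u \_ D) by apply/(measurable_restrictT _ mD).
rewrite /is_L2 inE; apply/andP; split; first by rewrite inE.
rewrite inE /= /finite_norm unlock /=.
have Iu' : (\int[mu]_x (`|(u \_ D) x| `^ 2)%:E < +oo)%E.
  have /integrableP[_] := Iu; rewrite integral_mkcond; apply: le_lt_trans.
  rewrite le_eqVlt; apply/orP; left; apply/eqP; apply: eq_integral => x _.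
  rewrite !patchE; case: ifP => _ /=; last by rewrite normr0 powR0.
  by rewrite powR_mulrn// normrX.
by rewrite poweR_lty.
Qed.

Lemma L2norm_sqE u : is_L2 a b u -> L2norm a b u ^+ 2 = \int[mu]_(x in D) (u x ^+ 2).
Proof.
move=> /is_L2P[mu2 Iu].
have i0 : (0 <= \int[mu]_(x in D) (u x ^+ 2)%:E)%E.
  by apply: integral_ge0 => x _; rewrite lee_fin sqr_ge0.
rewrite /L2norm /Rintegral unlock /= fine_poweR.
have -> : (\int[mu]_x (`|(u \_ D) x| `^ 2)%:E = \int[mu]_(x in D) (u x ^+ 2)%:E)%E.
  rewrite [RHS]integral_mkcond; apply: eq_integral => x _.
  rewrite !patchE; case: ifP => _ /=; last by rewrite normr0 powR0.
  by rewrite powR_mulrn// -normrX ger0_norm// sqr_ge0.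
rewrite -powR_mulrn ?powR_ge0// -powRrM mulVf// powRr1// fine_ge0//.
Qed.

Lemma L2norm_ge0 u : 0 <= L2norm a b u.
Proof. by rewrite fine_ge0// Lnorm_ge0. Qed.

Lemma L2_itgM u v : is_L2 a b u -> is_L2 a b v -> itg D (fun x => u x * v x).
Proof.
move=> /is_L2P[mu2 Iu] /is_L2P[mv Iv].
apply: (le_itg mD _ _ (itgD mD Iu Iv)); first exact: measurable_funM.
move=> x _; rewrite ler_norml; apply/andP; split.
  by have := sqr_ge0 (u x + v x); have := sqr_ge0 (u x); have := sqr_ge0 (v x); nra.
by have := sqr_ge0 (u x - v x); have := sqr_ge0 (u x); have := sqr_ge0 (v x); nra.
Qed.

Lemma L2D u v : is_L2 a b u -> is_L2 a b v -> is_L2 a b (fun x => u x + v x).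
Proof.
move=> uL vL; have Iuv := L2_itgM uL vL.
move: uL vL => /is_L2P[mu2 Iu] /is_L2P[mv Iv].
apply/is_L2P; split; first exact: measurable_funD.
apply: eq_itg (itgD mD (itgD mD Iu Iv) (itgZ 2 mD Iuv)) => // x _; ring.
Qed.

Lemma L2Z c u : is_L2 a b u -> is_L2 a b (fun x => c * u x).
Proof.
move=> /is_L2P[mu2 Iu]; apply/is_L2P; split; first exact: measurable_funM.
by apply: eq_itg (itgZ (c ^+ 2) mD Iu) => // x _; rewrite exprMn.
Qed.

Lemma L2_norm u : is_L2 a b u -> is_L2 a b (fun x => `|u x|).
Proof.
move=> /is_L2P[mu2 Iu]; apply/is_L2P; split; first exact: measurableT_comp.
by apply: eq_itg Iu => // x _; rewrite -normrX ger0_norm// sqr_ge0.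
Qed.

Lemma L2norm_abs u : is_L2 a b u -> L2norm a b (fun x => `|u x|) = L2norm a b u.
Proof.
move=> uL; apply/eqP; rewrite -(eqrXn2 (ltn0Sn 1)) ?L2norm_ge0//.
rewrite !L2norm_sqE//; last exact: L2_norm.
by apply/eqP; apply: eq_Rint => x _; rewrite -normrX ger0_norm// sqr_ge0.
Qed.

Lemma bnd_L2 u B : measurable_fun D u -> (forall x, D x -> `|u x| <= B) -> is_L2 a b u.
Proof.
move=> mu2 uB; apply/is_L2P; split => //.
apply: (@bnd_itg _ _ _ (B ^+ 2)) => //.
- by apply: (@itv_fin _ _ a b); exact: subset_itv_oo_cc.
- exact: measurable_funX.
move=> x Dx; rewrite normrX ler_sqr ?nnegrE// ?uB//.
exact: le_trans (uB _ Dx).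
Qed.

Lemma cont_bounded u : {within `[a, b], continuous u} ->
  exists2 B, 0 <= B & forall x, a <= x <= b -> `|u x| <= B.
Proof.
move=> cu.
have cK := @continuous_compact _ _ u _ cu (@segment_compact R a b).
have [B [Breal BP]] := compact_bounded cK.
exists (`|B| + 1); first by rewrite addr_ge0.
move=> x xab; apply: BP; last by exists x => //=; rewrite in_itv.
by rewrite (le_lt_trans (ler_norm _))// ltrDl.
Qed.

Lemma cont_L2 u : {within `[a, b], continuous u} -> is_L2 a b u.
Proof.
move=> cu; have [B _ uB] := cont_bounded cu.
apply: (@bnd_L2 _ B); first by apply: itg_meas; apply: itg_oo_cc; exact: itg_cont.
by move=> x; rewrite /D /= in_itv/= => /andP[ax xb]; rewrite uB// !ltW.
Qed.

(** Discriminant argument: the squared norm of [u + t v] is a nonnegative quadratic in [t]. *)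
Lemma CauchySchwarz u v : is_L2 a b u -> is_L2 a b v ->
  `|\int[mu]_(x in D) (u x * v x)| <= L2norm a b u * L2norm a b v.
Proof.
move=> uL vL; have Iuv := L2_itgM uL vL.
have /is_L2P[_ Iu] := uL; have /is_L2P[_ Iv] := vL.
set B := \int[mu]_(x in D) _.
have H t : 0 <= L2norm a b u ^+ 2 + 2 * t * B + t ^+ 2 * L2norm a b v ^+ 2.
  rewrite !L2norm_sqE// -!RintZ// -!RintD//.
  - apply: Rintegral_ge0 => x _.
    by rewrite (_ : _ + _ = (u x + t * v x) ^+ 2) ?sqr_ge0//; ring.
  - by apply: itgD => //; exact: itgZ.
  - exact: itgZ.
  - exact: itgZ.
rewrite -ler_sqr ?nnegrE ?mulr_ge0 ?L2norm_ge0// -normrX ger0_norm ?sqr_ge0// exprMn.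
have [v0|v0] := eqVneq (L2norm a b v) 0.
  rewrite v0 expr0n /= mulr0; have [->|B0] := eqVneq B 0; first by rewrite expr0n.
  (* The leading coefficient vanishes; this [t] would give the remaining affine function the value
     -1. *)
  have := H (- (L2norm a b u ^+ 2 + 1) / (2 * B)).
  rewrite v0 expr0n /= mulr0 addr0.
  rewrite (_ : 2 * _ * B = - (L2norm a b u ^+ 2 + 1)); first lra.
  by field.
have v2 : 0 < L2norm a b v ^+ 2 by rewrite exprn_gt0// lt_neqAle eq_sym v0 L2norm_ge0.
have := H (- B / L2norm a b v ^+ 2).
rewrite (_ : _ + _ = L2norm a b u ^+ 2 - B ^+ 2 / L2norm a b v ^+ 2); last by field.
by rewrite subr_ge0 ler_pdivrMr.
Qed.

Lemma L2norm_triangle u v : is_L2 a b u -> is_L2 a b v ->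
  L2norm a b (fun x => u x + v x) <= L2norm a b u + L2norm a b v.
Proof.
move=> uL vL; have Iuv := L2_itgM uL vL.
have /is_L2P[_ Iu] := uL; have /is_L2P[_ Iv] := vL.
rewrite -ler_sqr ?nnegrE ?addr_ge0 ?L2norm_ge0//.
rewrite L2norm_sqE; last exact: L2D.
rewrite (@eq_Rint _ _ (fun x => u x ^+ 2 + v x ^+ 2 + 2 * (u x * v x))); last by move=> x _; ring.
rewrite RintD//; [|exact: itgD|exact: itgZ].
rewrite RintD// RintZ// -!L2norm_sqE//.
by have := CauchySchwarz uL vL; rewrite ler_norml => /andP[_]; nra.
Qed.

Lemma L2norm_bound u B : measurable_fun D u -> (forall x, D x -> `|u x| <= B) -> a <= b ->
  L2norm a b u ^+ 2 <= B ^+ 2 * (b - a).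
Proof.
move=> mu2 uB ab; have uL := bnd_L2 mu2 uB; have /is_L2P[_ Iu] := uL.
rewrite L2norm_sqE// -(Rint_cst_itv _ ab); apply: le_Rint => //.
  apply: (@bnd_itg _ _ _ `|B ^+ 2|) => //.
  by apply: (@itv_fin _ _ a b); exact: subset_itv_oo_cc.
move=> x Dx; rewrite -(ger0_norm (sqr_ge0 (u x))) normrX ler_sqr ?nnegrE// ?uB//.
exact: le_trans (uB _ Dx).
Qed.

Lemma EFin_Rint (A : set R) u : measurable A -> itg A u ->
  (\int[mu]_(x in A) (u x)%:E = (\int[mu]_(x in A) u x)%:E)%E.
Proof.
move=> mA Iu; rewrite fineK//.
exact: (@integrable_fin_num _ (measurableTypeR R) R mu A mA (EFin \o u) Iu).
Qed.

(** The extended-real form in which [Rfubini] asks for its majorant. *)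
Lemma L2_int_abs_le u v : is_L2 a b u -> is_L2 a b v ->
  (\int[mu]_(x in D) `|u x * v x|%:E <= (L2norm a b u * L2norm a b v)%:E)%E.
Proof.
move=> uL vL; rewrite (EFin_Rint mD (itg_norm (L2_itgM uL vL))) lee_fin.
have := CauchySchwarz (L2_norm uL) (L2_norm vL).
rewrite !L2norm_abs//; apply: le_trans.
rewrite ger0_norm; last by apply: Rintegral_ge0 => x _; rewrite mulr_ge0.
by rewrite le_eqVlt; apply/orP; left; apply/eqP; apply: eq_Rint => x _; rewrite normrM.
Qed.

Lemma Rint_supp (A B : set R) u : measurable A -> measurable B -> B `<=` A ->
  (forall x, A x -> ~ B x -> u x = 0) ->
  \int[mu]_(x in A) u x = \int[mu]_(x in B) u x.
Proof.
move=> mA mB BA u0; rewrite Rintegral_mkcond [RHS]Rintegral_mkcond.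
apply: eq_Rintegral => x _; rewrite !patchE.
case: ifPn => [/set_mem Ax|/negP nA]; case: ifPn => [/set_mem Bx|/negP nB] //.
  by rewrite u0// => Bx; apply: nB; exact/mem_set.
by exfalso; apply: nA; apply/mem_set/BA.
Qed.

End L2.

(** * Reflections and translations of the line *)

Section reflection.
Context {R : realType}.
Local Notation mu := (@lebesgue_measure R).

Let phi (c : R) : measurableTypeR R -> measurableTypeR R := fun x => c - x.

Lemma measurable_reflect c : measurable_fun setT (phi c).
Proof. by apply: measurable_funB => //; exact: measurable_cst. Qed.

(** By uniqueness of Lebesgue measure it is enough to measure preimages of half-open intervals; a
    reflection only exchanges the closed end and the open one. *)
Lemma lebesgue_measure_reflect (c : R) (A : set R) : measurable A ->
  pushforward mu (phi c) A = mu A.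
Proof.
move=> mA.
have mphi := measurable_reflect c.
pose nu : measure _ _ := pushforward mu (phi c).
apply/esym; apply: (@lebesgue_measure_unique R (nu mphi)) => //= _ [[x y]] _ <-.
rewrite /nu /pushforward /=.
rewrite (_ : _ @^-1` _ = `[c - y, c - x[%classic); last first.
  by apply/seteqP; split => z /=; rewrite /phi !in_itv/= => /andP[? ?]; apply/andP; split; lra.
rewrite (@lebesgue_measure_itv R `]x, y]) (@lebesgue_measure_itv R `[c - y, c - x[) /= !lte_fin.
by rewrite ltrD2l ltrN2 -!EFinB; case: ifP => // _; congr (_%:E); ring.
Qed.

Lemma reflect_itg_Rint (c : R) (A : set R) (f : R -> R) : measurable A -> itg A f ->
  itg ((fun x => c - x) @^-1` A) (fun x => f (c - x)) /\
  \int[mu]_(x in (fun x => c - x) @^-1` A) f (c - x) = \int[mu]_(x in A) f x.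
Proof.
move=> mA If.
have mphi := measurable_reflect c.
have mphiA : measurable ((fun x => c - x) @^-1` A).
  by rewrite -(setTI (_ @^-1` _)); exact: mphi.
pose F : measurableTypeR R -> \bar R := (EFin \o f) \_ A.
have mF : measurable_fun setT F.
  by apply/(measurable_restrictT _ mA); apply/measurable_EFinP; exact: itg_meas.
have Fphi : F \o phi c = (EFin \o (fun x => f (c - x))) \_ ((fun x => c - x) @^-1` A).
  apply/funext => x; rewrite /= /F !patchE /phi.
  by rewrite (_ : (x \in _) = (c - x \in A)).
have nuE g : (\int[pushforward mu (phi c)]_x g x = \int[mu]_x g x)%E.
  by apply: eq_measure_integral => B mB _; exact: lebesgue_measure_reflect.
have IF : mu.-integrable setT (F \o phi c).
  apply/integrableP; split; first exact: measurableT_comp.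
  rewrite [ltLHS](_ : _ = \int[pushforward mu (phi c)]_x `|F x|)%E; last first.
    rewrite (@ge0_integral_pushforward _ _ _ _ _ _ mphi mu setT (abse \o F))//.
    - exact: measurableT_comp.
    - by move=> y _ /=.
  rewrite nuE; have /integrableP[_] := If; rewrite integral_mkcond.
  apply: le_lt_trans; rewrite le_eqVlt; apply/orP; left; apply/eqP.
  by apply: eq_integral => x _; rewrite /F !patchE; case: ifP => //; rewrite abse0.
have I2 : itg ((fun x => c - x) @^-1` A) (fun x => f (c - x)).
  rewrite /itg -(setTI (_ @^-1` _)).
  apply/(@integrable_restrict _ (measurableTypeR R) R mu _ mphiA setT measurableT).
  by rewrite -Fphi.
split=> //; rewrite /Rintegral; congr fine.
rewrite integral_mkcond [RHS]integral_mkcond -Fphi.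
have := @integral_pushforward _ _ _ _ R _ mphi mu setT F mF.
by rewrite nuE => <-.
Qed.

Lemma reflect_itv (c x y : R) : (fun z => c - z) @^-1` `[x, y] = `[c - y, c - x]%classic.
Proof. by apply/seteqP; split => z /=; rewrite !in_itv/= => /andP[? ?]; apply/andP; split; lra. Qed.

Lemma itg_reflect (c x y : R) (f : R -> R) : itg `[x, y] f ->
  itg `[c - y, c - x] (fun z => f (c - z)).
Proof.
move=> If; have [] := @reflect_itg_Rint c `[x, y] f => //.
by rewrite reflect_itv.
Qed.

Lemma Rint_reflect (c x y : R) (f : R -> R) : itg `[x, y] f ->
  \int[mu]_(z in `[c - y, c - x]) f (c - z) = \int[mu]_(z in `[x, y]) f z.
Proof.
move=> If; have [] := @reflect_itg_Rint c `[x, y] f => //.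
by rewrite reflect_itv.
Qed.

(** A translation is the composition of two reflections. *)
Lemma itg_shift (c x y : R) (f : R -> R) : itg `[x, y] f ->
  itg `[x - c, y - c] (fun z => f (c + z)).
Proof.
move=> If; have := itg_reflect 0 (itg_reflect c If).
rewrite !sub0r !opprB; apply: eq_itg => // z _.
by rewrite sub0r opprK.
Qed.

Lemma Rint_shift (c x y : R) (f : R -> R) : itg `[x, y] f ->
  \int[mu]_(z in `[x - c, y - c]) f (c + z) = \int[mu]_(z in `[x, y]) f z.
Proof.
move=> If; rewrite -(Rint_reflect c If) -(Rint_reflect 0 (itg_reflect c If)).
rewrite !sub0r !opprB; apply: eq_Rint => z _.
by rewrite sub0r opprK.
Qed.

End reflection.

(** * Joint measurability of continuous functions of two variables *)

Section joint_measurability.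
Context {R : realType}.

Lemma cvg_pairR (T : Type) (F : set_system T) {FF : Filter F} (f g : T -> R) (c x : R) :
  f @ F --> c -> g @ F --> x -> (f z, g z) @[z --> F] --> (c, x).
Proof. by move=> fc gx; exact: (@cvg_pair _ _ _ F (nbhs c) (nbhs x) _ _ _ f g fc gx). Qed.

(* Freezing the first variable at the points of a grid approximates a jointly
   continuous function by functions that are piecewise constant in time. *)
Lemma continuous2_measurable (u : R * R -> R) : continuous u ->
  measurable_fun setT u.
Proof.
move=> cu.
pose g (n : nat) (t : R) : R := (Num.floor (t * n.+1%:R))%:~R / n.+1%:R.
have mg n : measurable_fun setT (fun p : R * R => u (g n p.1, p.2)).
  move=> _ Y mY; rewrite setTI.
  rewrite (_ : _ @^-1` _ = \bigcup_(k in [set: int])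
     ([set t | Num.floor (t * n.+1%:R) = k] `*` ((fun x => u (k%:~R / n.+1%:R, x)) @^-1` Y))).
    set F := fun k : int => _ `*` _.
    have -> : \bigcup_(k in [set: int]) F k =
        \bigcup_(n in [set: nat]) (if (unpickle n : option int) is Some k then F k else set0).
      apply/seteqP; split => [p [k _ Fk]|p [i _]].
        by exists (pickle k); [exact: I|rewrite pickleK; exact: Fk].
      by case: (unpickle i : option int) => [k Fk|//]; exists k.
    apply: bigcup_measurable => i _; case: (unpickle i : option int) => [k|//].
    apply: measurableX.
    - rewrite (_ : [set t | _] = `[k%:~R / n.+1%:R, (k + 1)%:~R / n.+1%:R[%classic); first exact: measurable_itv.
      apply/seteqP; split => t /=; rewrite in_itv/= ler_pdivrMr// ltr_pdivlMr//.
        by move=> <-; exact: floor_itv.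
      by move=> H; apply/floor_def.
    - rewrite -(setTI (_ @^-1` _)).
      have : measurable_fun setT (fun x => u (k%:~R / n.+1%:R, x)); last exact.
      apply: continuous_measurable_fun => x.
      apply: (@cvg_comp _ _ _ (fun z : R => (k%:~R / n.+1%:R : R, z)) u _ _ _ _ (cu (_, x))).
      by apply: cvg_pairR; [exact: cvg_cst|exact: cvg_id].
  apply/seteqP; split => [[t x]/= Y1|[t x]/= [k _ [/= <-]]//].
  by exists (Num.floor (t * n.+1%:R)).
apply: (@measurable_fun_cvg _ _ R setT (fun n (p : R * R) => u (g n p.1, p.2)) u mg).
move=> [t x] _ /=.
apply: (@cvg_comp _ _ _ (fun n => (g n t, x)) u _ _ _ _ (cu (t, x))).
apply: cvg_pairR; last exact: cvg_cst.
apply/cvgrPdist_le => e e0; near=> n.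
have n0 : (0 : R) < n.+1%:R by [].
have /andP[f1 f2] := floor_itv (t * n.+1%:R).
rewrite /g -[X in X - _](mulfK (lt0r_neq0 n0)) -mulrBl ger0_norm; last first.
  by rewrite divr_ge0// subr_ge0.
rewrite intrD in f2.
apply: (@le_trans _ _ (1 / n.+1%:R)).
  by rewrite ler_wpM2r ?invr_ge0//; lra.
rewrite div1r; apply: ltW; near: n.
by have := near_infty_natSinv_lt (PosNum e0).
Unshelve. all: by end_near.
Qed.

End joint_measurability.

(** * Functions of time that behave like a power near 0 *)

Section powers.
Context {R : realType}.
Local Notation mu := (@lebesgue_measure R).

Lemma continuous_powR_gt0 (al x : R) : 0 < x -> {for x, continuous (fun t : R => t `^ al)}.
Proof.
move=> x0; apply: differentiable_continuous; apply/derivable1_diffP.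
by have [] := is_derive1_powR al x0.
Qed.

Lemma within_powR (al p q : R) : 0 < p -> {within `[p, q], continuous (fun t : R => t `^ al)}.
Proof.
move=> p0; apply: continuous_in_subspaceT => x /set_mem /=; rewrite in_itv/= => /andP[px _].
by apply: continuous_powR_gt0; lra.
Qed.

Lemma Rint_powR_gt0 (al p q : R) : al != 0 -> 0 < p -> p <= q ->
  \int[mu]_(t in `[p, q]) (t `^ (al - 1)) = (q `^ al - p `^ al) / al.
Proof.
move=> al1 p0; rewrite le_eqVlt => /predU1P[->|pq].
  by rewrite subrr mul0r set_itv1 Rintegral_set1.
rewrite /Rintegral (@continuous_FTC2 _ _ (fun t => t `^ al / al))//.
- by rewrite -EFinB /= mulrBl.
- exact: within_powR.
- have c x : 0 < x -> {for x, continuous (fun t : R => t `^ al / al)}.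
    by move=> x0; apply: cvgM; [exact: continuous_powR_gt0|exact: cvg_cst].
  split.
  + move=> x; rewrite in_itv/= => /andP[px xq].
    apply: derivableM; last exact: derivable_cst.
    by have [] := @is_derive1_powR R al x ltac:(lra).
  + by apply: cvg_at_right_filter; apply: c.
  + by apply: cvg_at_left_filter; apply: c; lra.
- move=> x; rewrite in_itv/= => /andP[px xq].
  have x0 : 0 < x by lra.
  have d := is_derive1_powR al x0.
  rewrite derive1E (_ : (fun t => t `^ al / al) = (fun t => al^-1 *: (t `^ al))); last first.
    by apply/funext => t; rewrite mulrC.
  by rewrite derive_val /= -[_ *: _]/(_ * _) mulKf.
Qed.

Lemma powR_anti (e x y : R) : e <= 0 -> 0 < x -> x <= y -> y `^ e <= x `^ e.
Proof.
move=> e0 x0 xy; rewrite -(opprK e) !(powRN _ (- e)) lef_pV2 ?posrE ?powR_gt0//; last lra.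
by apply: ge0_ler_powR; [lra|rewrite nnegrE; lra|rewrite nnegrE; lra|].
Qed.

Lemma itg_powR_gt0 (al p q : R) : 0 < p -> itg `[p, q] (fun t => t `^ al).
Proof. by move=> p0; apply: itg_cont; exact: within_powR. Qed.

Lemma cvg_divS_at_right0 (c : R) : 0 < c -> c / n.+1%:R @[n --> \oo] --> 0^'+.
Proof.
move=> c0; have h0 : c / n.+1%:R @[n --> \oo] --> 0.
  rewrite -[X in _ --> X](mulr0 c).
  by apply: cvgM; [exact: cvg_cst|exact: cvg_harmonic].
move=> A [r /= r0 rA].
have : \forall n \near \oo, `|c / n.+1%:R| < r by exact: cvgr0_norm_lt h0 _ r0.
apply: filterS => n hr; apply: rA; last by rewrite divr_gt0.
by rewrite /ball /= sub0r normrN.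
Qed.

(* The integrand takes the value 0 at the origin, where it is singular. *)
Lemma powR_primitive (al x : R) : 0 < al -> 0 <= x ->
  itg `[0, x] (fun t => t `^ (al - 1)) /\
  \int[mu]_(t in `[0, x]) (t `^ (al - 1)) = x `^ al / al.
Proof.
move=> al0; rewrite le_eqVlt => /predU1P[<-|x0].
  rewrite set_itv1 Rintegral_set1 powR0 ?gt_eqF// mul0r; split=> //.
  rewrite -set_itv1; apply: (@bnd_itg _ _ _ `|0 `^ (al - 1)|) => //.
  - exact: (@itv_fin _ _ 0 0).
  - exact: measurable_funTS.
  - by move=> t /=; rewrite in_itv/= => /andP[t0 t0']; rewrite (_ : t = 0) //; lra.
have mf : measurable_fun setT (fun t : R => (t `^ (al - 1))%:E) by exact/measurable_EFinP.
pose F (n : nat) : set R := `[x / n.+1%:R, x]%classic.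
have xn n : 0 < x / n.+1%:R by rewrite divr_gt0.
have FU : \bigcup_n F n = `]0, x]%classic.
  apply/seteqP; split=> [t [n _]|t]; rewrite /F /= !in_itv/=.
    by move=> /andP[t1 ->]; rewrite andbT (lt_le_trans (xn n)).
  move=> /andP[t0 tx].
  have : \forall n \near \oo, x / n.+1%:R < t.
    exact: (cvg_divS_at_right0 x0 (nbhs_right_lt t0)).
  by move=> [n _ /(_ n (leqnn n)) /= /ltW h]; exists n => //; rewrite /F /= in_itv/= h.
have lim1 : (\int[mu]_(t in F n) (t `^ (al - 1))%:E)%E @[n --> \oo] -->
    (\int[mu]_(t in `]0%R, x]) (t `^ (al - 1))%:E)%E.
  rewrite -FU; apply: ge0_nondecreasing_set_cvg_integral => //.
  - move=> n k nk; apply/subsetPset => t; rewrite /F /= !in_itv/= => /andP[t1 ->].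
    rewrite andbT (le_trans _ t1)// ler_wpM2l ?(ltW x0)// lef_pV2 ?posrE//.
    by rewrite ler_nat.
  - by move=> n; exact: measurable_itv.
  - by move=> n; apply: measurable_funTS.
  - by move=> n t _; rewrite lee_fin powR_ge0.
have FE n : (\int[mu]_(t in F n) (t `^ (al - 1))%:E = ((x `^ al - (x / n.+1%:R) `^ al) / al)%:E)%E.
  rewrite /F EFin_Rint//; last exact: itg_powR_gt0.
  rewrite Rint_powR_gt0 ?gt_eqF//.
  by rewrite ler_pdivrMr// ler_peMr ?(ltW x0)// ler1n.
have lim2 : (\int[mu]_(t in F n) (t `^ (al - 1))%:E)%E @[n --> \oo] --> (x `^ al / al)%:E.
  rewrite (eq_cvg _ _ FE); apply: cvg_EFin; first exact: nearW.
  rewrite /comp /= -[X in _ --> X / al]subr0.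
  apply: cvgM; last exact: cvg_cst.
  apply: cvgB; first exact: cvg_cst.
  exact: (cvg_comp _ _ (cvg_divS_at_right0 x0) (powR_cvg0 al0)).
have E : (\int[mu]_(t in `[0%R, x]) (t `^ (al - 1))%:E = (x `^ al / al)%:E)%E.
  rewrite -integral_itv_obnd_cbnd; last exact: measurable_funTS.
  by apply: cvg_unique lim1 lim2.
split; last by rewrite /Rintegral E.
apply/integrableP; split; first exact: measurable_funTS.
rewrite (@eq_integral _ _ _ mu _ (fun t => (t `^ (al - 1))%:E)) ?E ?ltry//.
by move=> t _; rewrite /= ger0_norm// powR_ge0.
Qed.

Lemma itg_powR (al p q : R) : 0 < al -> 0 <= p -> itg `[p, q] (fun t => t `^ (al - 1)).
Proof.
move=> al0 p0; have [pq|qp] := leP p q; last first.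
  by rewrite set_itv_ge -?leNgt ?bnd_simp -?ltNge//; exact: integrable_set0.
have [Iq _] := powR_primitive al0 (le_trans p0 pq).
apply: itgS Iq => // t /=; rewrite !in_itv/= => /andP[pt ->].
by rewrite andbT (le_trans p0).
Qed.

Lemma Rint_powR (al p q : R) : 0 < al -> 0 <= p -> p <= q ->
  \int[mu]_(t in `[p, q]) (t `^ (al - 1)) = (q `^ al - p `^ al) / al.
Proof.
move=> al0; rewrite le_eqVlt => /predU1P[<- q0|p0 pq].
  by have [_ ->] := powR_primitive al0 q0; rewrite powR0 ?gt_eqF// subr0.
by rewrite Rint_powR_gt0// gt_eqF.
Qed.

End powers.

(** * From weak derivatives in time to increments and second differences *)

Section time_regularity.
Context {R : realType} (T al M : R) (G : R -> R).
Local Notation mu := (@lebesgue_measure R).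
Hypotheses (al0 : 0 < al) (al1 : al < 1) (M0 : 0 <= M).
Hypothesis cG : {within `[0, T], continuous G}.
Hypothesis G0 : G 0 = 0.
Hypothesis weak1 : forall z, C1_test 0 T z ->
  `|\int[mu]_(t in `]0, T[) (G t * derive1 z t)| <=
  M * \int[mu]_(t in `]0, T[) (`|z t| * t `^ (al - 1)).
Hypothesis weak2 : forall z, C1_test 0 T z -> C1_test 0 T (derive1 z) ->
  `|\int[mu]_(t in `]0, T[) (G t * derive1 (derive1 z) t)| <=
  M * \int[mu]_(t in `]0, T[) (`|z t| * t `^ (al - 2)).

Lemma C1_test_widen (p q r s : R) z : r <= p -> q <= s -> C1_test p q z -> C1_test r s z.
Proof.
move=> rp qs [zd zc [c [d [pc dq z0]]]]; split=> //; exists c, d; split=> //.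
  exact: le_lt_trans pc.
exact: lt_le_trans qs.
Qed.

Lemma C1_test_supp (p q : R) z x : C1_test p q z -> ~ (p < x < q) -> z x = 0.
Proof.
move=> [_ _ [c [d [pc dq z0]]]] npq; apply: z0; apply/negP => /andP[cx xd].
by apply: npq; apply/andP; split; lra.
Qed.

Lemma C1_test_continuous (p q : R) z : C1_test p q z -> continuous z.
Proof.
by move=> [zd _ _] x; apply: differentiable_continuous; exact/derivable1_diffP.
Qed.

Lemma test_int_le (p r e B : R) z : 0 < p -> p < r -> r <= T -> C1_test p r z ->
  (forall x, `|z x| <= B) ->
  \int[mu]_(t in `]0, T[) (`|z t| * t `^ e) <= B * \int[mu]_(t in `[p, r]) (t `^ e).
Proof.
move=> p0 pr rT zt zB.
rewrite (@Rint_supp _ `]0, T[ `]p, r[)//; last first.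
- by move=> x _ npr; rewrite (C1_test_supp zt) ?normr0 ?mul0r.
- by move=> x /=; rewrite !in_itv/= => /andP[px xr]; apply/andP; split; lra.
have Ie := itg_oo_cc (itg_powR_gt0 e r p0).
rewrite -Rint_oo_cc// -RintZ//; apply: le_Rint => //.
- apply: (@le_itg _ _ _ (fun t => B * t `^ e)) => //.
  + apply: measurable_funM; last exact: itg_meas Ie.
    apply: measurableT_comp => //; apply: measurable_funTS.
    by apply: continuous_measurable_fun; exact: C1_test_continuous zt.
  + move=> x _; rewrite normrM normr_id (ger0_norm (powR_ge0 _ _)).
    by rewrite ler_wpM2r ?powR_ge0.
  + exact: itgZ.
- exact: itgZ.
- by move=> x _; rewrite ler_wpM2r ?powR_ge0.
Qed.

Lemma within_sub (p r : R) (u : R -> R) : 0 <= p -> r <= T ->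
  {within `[0, T], continuous u} -> {within `[p, r], continuous u}.
Proof.
move=> p0 rT; apply: continuous_subspaceW => x /=; rewrite !in_itv/= => /andP[px xr].
by apply/andP; split; lra.
Qed.

Lemma Rint_kmoll2 (I : finType) (m pp qq : I -> R) (p r d : R) u :
  0 <= p -> p < r -> r <= T -> 0 < d < 1 ->
  (forall i, p <= pp i <= r) -> (forall i, p <= qq i <= r) ->
  \int[mu]_(t in `]0, T[) (u t * kmoll p r m pp qq (@moll2 R) d t) =
  \int[mu]_(t in `]p, r[) (u t * kmoll p r m pp qq (@moll2 R) d t).
Proof.
move=> p0 pr rT d01 pI qI; apply: Rint_supp => //.
  by move=> x /=; rewrite !in_itv/= => /andP[px xr]; apply/andP; split; lra.
move=> x _ npr; rewrite kmoll2_out ?mulr0//; apply/negP => /andP[x1 x2]; apply: npr.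
have k0 : 0 < kwidth p r d by apply: kwidth_gt0 => //; case/andP: d01.
by rewrite /= in_itv/=; apply/andP; split; lra.
Qed.

(** The test function is the smoothed indicator of [[p, r]]: its derivative is a bump at [p] minus a
    bump at [r], so that the pairing with [G] tends to [G p - G r], and its absolute value is at
    most 1. *)
Lemma time_D1_pos (p r : R) : 0 < p -> p < r -> r <= T -> `|G p - G r| <= M / al * r `^ al.
Proof.
move=> p0 pr rT.
pose m (i : 'I_1) : R := 1; pose P (i : 'I_1) := p; pose Q (i : 'I_1) := r.
have pI i : p <= P i <= r by rewrite /P lexx ltW.
have qI i : p <= Q i <= r by rewrite /Q lexx ltW.
have cG' := within_sub (ltW p0) rT cG.
have kE : kf m P Q G = G p - G r by rewrite /kf big_ord1 mul1r.
have cv := kmoll2_cvg pr pI qI cG' (m := m); rewrite kE in cv.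
apply: (cvg_bound_lim cv (lexx 0)) => d d01.
rewrite mul0r addr0 -Rint_kmoll2 ?(ltW p0)//.
have [t1 d1E] := kmoll1_test m pr pI qI d01.
rewrite -d1E; have t1' := C1_test_widen (ltW p0) rT t1.
apply: le_trans (weak1 t1') _; rewrite -mulrA ler_wpM2l//.
apply: le_trans (test_int_le _ p0 pr rT t1 (fun x => @kmoll1_bound R p r _ m P Q pr d x d01)) _.
rewrite big_ord1 normr1 mul1r Rint_powR_gt0 ?gt_eqF ?(ltW pr)// mulrC ler_wpM2l ?invr_ge0 ?(ltW al0)//.
by rewrite gerBl powR_ge0.
Qed.

(** Test functions vanish near 0, hence reach positive times only; continuity of [G] and [G 0 = 0]
    provide the start. *)
Lemma time_D1 (t : R) : 0 <= t <= T -> `|G t| <= M / al * t `^ al.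
Proof.
move=> /andP[]; rewrite le_eqVlt => /predU1P[<- _|t0 tT].
  by rewrite G0 normr0 mulr_ge0 ?powR_ge0// divr_ge0// ltW.
apply/ler_addgt0Pr => e e0.
have T0 : 0 <= (0 : R) <= T by rewrite lexx; lra.
have [d d0 dP] := within_cont_eps cG T0 e0.
pose p := Num.min (d / 2) (t / 2).
have p0 : 0 < p by rewrite lt_min; apply/andP; split; lra.
have pt : p < t by rewrite gt_min; apply/orP; right; lra.
have pd : p < d by rewrite gt_min; apply/orP; left; lra.
have /ltW := dP p ltac:(lra) ltac:(by rewrite subr0 gtr0_norm).
rewrite G0 subr0 => Gp.
rewrite -(subrK (G p) (G t)) (le_trans (ler_normD _ _))// lerD//.
by rewrite distrC; exact: time_D1_pos.
Qed.

(** The test function is the smoothed tent over [[p, r]] with apex at [z]: its second derivative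
    carries the weights of linear interpolation at [p] and [r], and -1 at [z]. It is bounded by
    [r - p], on an interval of length [r - p] where the power is at most [p^(al-2)]. *)
Lemma time_D2 (p z r : R) : 0 < p -> p < z -> z < r -> r <= T ->
  `|((r - z) * G p + (z - p) * G r) / (r - p) - G z| <= M * p `^ (al - 2) * (r - p) ^+ 2.
Proof.
move=> p0 pz zr rT; have al2 : al - 2 <= 0 by move: al1; lra.
have pr : p < r by lra.
have rp0 : 0 < r - p by lra.
pose m (i : bool) : R := if i then (r - z) / (r - p) else - (z - p) / (r - p).
pose P (i : bool) := if i then p else z; pose Q (i : bool) := if i then z else r.
have pI i : p <= P i <= r by rewrite /P; case: i; lra.
have qI i : p <= Q i <= r by rewrite /Q; case: i; lra.
have mpq : \sum_i m i * (Q i - P i) = 0 by rewrite big_bool /m /P /Q /=; ring.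
have cG' := within_sub (ltW p0) rT cG.
have kE : kf m P Q G = ((r - z) * G p + (z - p) * G r) / (r - p) - G z.
  by rewrite /kf big_bool /m /P /Q /=; field; rewrite gt_eqF.
have cv := kmoll2_cvg pr pI qI cG' (m := m); rewrite kE in cv.
apply: (cvg_bound_lim cv (lexx 0)) => d d01.
rewrite mul0r addr0 -Rint_kmoll2 ?(ltW p0)//.
have [t1 d1E] := kmoll1_test m pr pI qI d01.
have [t0 d0E] := kmoll_test pr pI qI mpq d01.
rewrite -d1E -d0E; have t0' := C1_test_widen (ltW p0) rT t0.
have t1' := C1_test_widen (ltW p0) rT t1.
apply: le_trans (weak2 t0' _) _; first by rewrite d0E.
rewrite -mulrA ler_wpM2l//.
apply: le_trans (test_int_le _ p0 pr rT t0 (fun x => @kmoll_lip R p r _ m P Q pr d x d01)) _.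
have hB : \sum_i `|m i| * `|Q i - P i| <= r - p.
  rewrite big_bool /m /P /Q /= mulNr normrN !ger0_norm ?divr_ge0//; try lra.
  rewrite -[leRHS]mulr1.
  rewrite (_ : _ + _ = 2 * (r - z) * (z - p) / (r - p)); last by field; rewrite gt_eqF.
  by rewrite ler_pdivrMr//; nra.
rewrite expr2 mulrA (mulrC _ (r - p)).
have Iz := itg_powR_gt0 (al - 2) r p0.
have I0 : 0 <= \int[mu]_(t in `[p, r]) (t `^ (al - 2)).
  by apply: Rintegral_ge0 => x _; exact: powR_ge0.
apply: le_trans (ler_wpM2r I0 hB) _; rewrite ler_wpM2l// ?(ltW rp0)//.
rewrite -Rint_oo_cc -?(Rint_cst_itv _ (ltW pr)); last exact: itg_oo_cc.
apply: le_Rint => //; first exact: itg_oo_cc.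
  apply: (@bnd_itg _ _ _ `|p `^ (al - 2)|) => //.
  by apply: (@itv_fin _ _ p r); exact: subset_itv_oo_cc.
move=> x /=; rewrite in_itv/= => /andP[px xr].
by apply: powR_anti; [exact: al2|exact: p0|exact: ltW px].
Qed.

End time_regularity.

(** * Fubini's theorem for pairings with a fixed function of space *)

Section duality.
Context {R : realType} (T a b : R).
Local Notation mu := (@lebesgue_measure R).
Let DT : set R := `]0, T[.
Let DX : set R := `]a, b[.
Let mDT : measurable DT. Proof. exact: measurable_itv. Qed.
Let mDX : measurable DX. Proof. exact: measurable_itv. Qed.

Lemma measurable_rect (h : R -> R -> R) (f g : R -> R) (A B : set R) :
  measurable A -> measurable B ->
  measurable_fun (A `*` B) (fun p : R * R => h p.1 p.2) ->
  measurable_fun A f -> measurable_fun B g ->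
  measurable_fun (A `*` B) (fun p : R * R => h p.1 p.2 * g p.2 * f p.1).
Proof.
move=> mA mB mh mf mg.
apply: measurable_funM; first apply: measurable_funM => //.
- apply: (@measurable_comp _ _ _ _ _ _ B g) => //.
    by move=> x [p [_ pB] <-].
  exact: measurable_funTS.
- apply: (@measurable_comp _ _ _ _ _ _ A f) => //.
    by move=> x [p [pA _] <-].
  exact: measurable_funTS.
Qed.

(** If [c = 0], nothing is known about the integrability of [f], but both sides vanish whatever
    value its integral takes; otherwise [f] is a multiple of [g]. *)
Lemma Rint_mulr (A : set R) (f g : R -> R) (c : R) : measurable A ->
  (forall t, A t -> g t = f t * c) -> itg A g ->
  \int[mu]_(t in A) g t = (\int[mu]_(t in A) f t) * c.
Proof.
move=> mA gE Ig; have [c0|c0] := eqVneq c 0.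
  rewrite (@eq_Rint _ _ (cst 0)); last by move=> t /gE ->; rewrite c0 mulr0.
  by rewrite Rintegral_cst// mul0r c0 mulr0.
have If : itg A f.
  by apply: eq_itg (itgZ c^-1 mA Ig) => // t /gE ->; rewrite mulrC mulfK.
by rewrite (@eq_Rint _ _ (fun t => c * f t)) ?RintZ// 1?mulrC// => t /gE ->; rewrite mulrC.
Qed.

(** Cauchy-Schwarz in space bounds the slice integral at time [t] by the norm of [psi] times [k t],
    which is the majorant for Fubini's theorem. The factorization of [psi x] holds at the points [x]
    whose slice in time is integrable. *)
Lemma dual_swap (V : R -> R -> R) (psi z k : R -> R) (C : R) :
  measurable_fun (DT `*` DX) (fun p : R * R => V p.1 p.2) ->
  measurable_fun DX psi -> (forall x, DX x -> `|psi x| <= C) ->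
  measurable_fun DT z -> itg DT k ->
  {ae mu, forall t, DT t -> is_L2 a b (V t) /\ L2norm a b (V t) * `|z t| <= k t} ->
  [/\ itg DT (fun t => \int[mu]_(x in DX) (V t x * psi x * z t)),
      itg DX (fun x => \int[mu]_(t in DT) (V t x * psi x * z t)),
      {ae mu, forall x, DX x ->
        \int[mu]_(t in DT) (V t x * psi x * z t) =
        (\int[mu]_(t in DT) (V t x * z t)) * psi x} &
      \int[mu]_(t in DT) \int[mu]_(x in DX) (V t x * psi x * z t) =
      \int[mu]_(x in DX) \int[mu]_(t in DT) (V t x * psi x * z t)].
Proof.
move=> mV mpsi psiC mz Ik Vk.
have psiL : is_L2 a b psi by apply: (bnd_L2 mpsi psiC).
have [||I1 I2 I3 F1] := @Rfubini R DT DX (fun t x => V t x * psi x * z t)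
  (fun t => L2norm a b psi * k t) mDT mDX (measurable_rect mDT mDX mV mz mpsi).
- exact: itgZ.
- apply: filterS Vk => t Vk Dt; have [VL Vkt] := Vk Dt.
  apply: (@le_trans _ _ ((L2norm a b (V t) * L2norm a b (fun x => z t * psi x))%:E)).
    have -> : (\int[mu]_(x in DX) `|V t x * psi x * z t|%:E =
        \int[mu]_(x in DX) `|V t x * (z t * psi x)|%:E)%E.
      by apply: eq_integral => x _; congr (`|_|%:E); ring.
    by apply: L2_int_abs_le => //; exact: L2Z.
  rewrite lee_fin.
  have -> : L2norm a b (fun x => z t * psi x) = `|z t| * L2norm a b psi.
    apply/eqP; rewrite -(eqrXn2 (ltn0Sn 1)) ?mulr_ge0 ?L2norm_ge0// exprMn.
    have /is_L2P[_ Ip] := psiL.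
    rewrite !L2norm_sqE//; last exact: L2Z.
    rewrite -normrX ger0_norm ?sqr_ge0// -RintZ//.
    by apply/eqP; apply: eq_Rint => x _; rewrite exprMn.
  by rewrite mulrA mulrC ler_wpM2l ?L2norm_ge0.
split=> //; apply: filterS I3 => x I3 Dx.
by apply: Rint_mulr (I3 Dx) => // t _; ring.
Qed.

(* One integration by parts in time, carried out for almost every x and then
   integrated against psi. *)
Lemma weak_time_step (U V : R -> R -> R) (psi z0 z1 k0 k kk : R -> R) (s C : R) :
  `|s| <= 1 ->
  measurable_fun (DT `*` DX) (fun p : R * R => U p.1 p.2) ->
  measurable_fun (DT `*` DX) (fun p : R * R => V p.1 p.2) ->
  measurable_fun DX psi -> (forall x, DX x -> `|psi x| <= C) ->
  measurable_fun DT z0 -> measurable_fun DT z1 ->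
  {ae mu, forall x, DX x ->
     \int[mu]_(t in DT) (U t x * z0 t) = s * \int[mu]_(t in DT) (V t x * z1 t)} ->
  itg DT k0 -> itg DT k -> itg DT kk ->
  (forall t, DT t -> is_L2 a b (U t) /\ L2norm a b (U t) * `|z0 t| <= k0 t) ->
  {ae mu, forall t, DT t -> is_L2 a b (V t) /\ L2norm a b (V t) * `|z1 t| <= k t} ->
  {ae mu, forall t, DT t -> `|\int[mu]_(x in DX) (V t x * psi x)| * `|z1 t| <= kk t} ->
  `|\int[mu]_(t in DT) ((\int[mu]_(x in DX) (U t x * psi x)) * z0 t)| <=
  \int[mu]_(t in DT) kk t.
Proof.
move=> s1 mU mV mpsi psiC mz0 mz1 UV Ik0 Ik Ikk Uk Vk Vkk.
have psiL : is_L2 a b psi by apply: (bnd_L2 mpsi psiC).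
have Uk' : {ae mu, forall t, DT t -> is_L2 a b (U t) /\ L2norm a b (U t) * `|z0 t| <= k0 t}.
  by apply: aeW.
have [IU1 IU2 IU3 FU] := dual_swap mU mpsi psiC mz0 Ik0 Uk'.
have [IV1 IV2 IV3 FV] := dual_swap mV mpsi psiC mz1 Ik Vk.
have -> : \int[mu]_(t in DT) ((\int[mu]_(x in DX) (U t x * psi x)) * z0 t) =
    \int[mu]_(t in DT) \int[mu]_(x in DX) (U t x * psi x * z0 t).
  apply: eq_Rint => t Dt; have [UL _] := Uk t Dt.
  rewrite mulrC -(RintZ _ mDX (L2_itgM UL psiL)).
  by apply: eq_Rint => x _; rewrite mulrC.
rewrite FU (@ae_eq_Rint _ DX _ (fun x => s * \int[mu]_(t in DT) (V t x * psi x * z1 t)) mDX).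
- rewrite (RintZ _ mDX IV2) -FV normrM.
  apply: (@le_trans _ _ (1 * \int[mu]_(t in DT) kk t)); last by rewrite mul1r.
  apply: ler_pM => //; apply: norm_Rint_le => //.
  apply: filterS2 Vk Vkk => t Vk Vkk Dt; have [VL _] := Vk Dt.
  apply: le_trans (Vkk Dt); rewrite -normrM.
  rewrite (_ : \int[mu]_(x in DX) (V t x * psi x * z1 t) =
    (\int[mu]_(x in DX) (V t x * psi x)) * z1 t); first exact: lexx.
  rewrite mulrC -(RintZ _ mDX (L2_itgM VL psiL)).
  by apply: eq_Rint => x _; rewrite mulrC.
- exact: itg_meas IU2.
- exact: itg_meas (itgZ s mDX IV2).
apply: filterS3 IU3 IV3 UV => x IU3 IV3 UV Dx.
by rewrite (IU3 Dx) (IV3 Dx) (UV Dx) mulrA.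
Qed.

End duality.

Lemma continuous_pair_l (R : realType) (u : R * R -> R) (t : R) :
  continuous u -> continuous (fun x : R => u (t, x)).
Proof.
move=> cu x; apply: (@cvg_comp _ _ _ (fun z : R => (t, z)) u _ _ _ _ (cu (t, x))).
by apply: cvg_pairR; [exact: cvg_cst|exact: cvg_id].
Qed.

Lemma continuous_pair_r (R : realType) (u : R * R -> R) (x : R) :
  continuous u -> continuous (fun t : R => u (t, x)).
Proof.
move=> cu t; apply: (@cvg_comp _ _ _ (fun z : R => (z, x)) u _ _ _ _ (cu (t, x))).
by apply: cvg_pairR; [exact: cvg_id|exact: cvg_cst].
Qed.

(* What |G'| <= M t^(al-1) and |G''| <= M t^(al-2) give, up to constants,
   without any differentiability of G. *)
Definition cusp_bound (R : realType) (T al M : R) (G : R -> R) : Prop :=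
  (forall t, 0 <= t <= T -> `|G t| <= M / al * t `^ al) /\
  (forall p z r : R, 0 < p -> p < z -> z < r -> r <= T ->
    `|((r - z) * G p + (z - p) * G r) / (r - p) - G z| <=
    M * p `^ (al - 2) * (r - p) ^+ 2).

(** * Pairings of the solution with functions of space *)

Section regularity.
Context {R : realType} (T a b al C0 B : R) (om wt wtt : R -> R -> R).
Local Notation mu := (@lebesgue_measure R).
Let DT : set R := `]0, T[.
Let DX : set R := `]a, b[.
Let mDT : measurable DT. Proof. exact: measurable_itv. Qed.
Let mDX : measurable DX. Proof. exact: measurable_itv. Qed.

(** All that is kept of a bound on the H^2 norm: the second derivative enters through a double
    integration by parts, so the first one disappears. *)
Definition H2_bounded (v : R -> R) (X : R) : Prop :=
  [/\ is_L2 a b v, L2norm a b v <= X &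
   exists v2, [/\ is_L2 a b v2, L2norm a b v2 <= X &
     forall phi, C1_test a b phi -> C1_test a b (derive1 phi) ->
       \int[mu]_(x in DX) (v x * derive1 (derive1 phi) x) =
       \int[mu]_(x in DX) (v2 x * phi x)]].

Hypotheses (T0 : 0 < T) (ab : a < b) (al0 : 0 < al) (al1 : al < 1) (C00 : 0 <= C0).
Hypothesis c_om : continuous (fun p : R * R => om p.1 p.2).
Hypothesis om_bnd : forall t x, `|om t x| <= B.
Hypothesis om0 : forall x, a <= x <= b -> om 0 x = 0.
Hypothesis mwt : measurable_fun (DT `*` DX) (fun p : R * R => wt p.1 p.2).
Hypothesis mwtt : measurable_fun (DT `*` DX) (fun p : R * R => wtt p.1 p.2).
Hypothesis wd1 : {ae mu, forall x, a < x < b -> weak_deriv 0 T (om ^~ x) (wt ^~ x)}.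
Hypothesis wd2 : {ae mu, forall x, a < x < b -> weak_deriv 0 T (wt ^~ x) (wtt ^~ x)}.
Hypothesis reg1 : {ae mu, forall t, 0 < t < T -> H2_bounded (wt t) (C0 * t `^ (al - 1))}.
Hypothesis reg2 : {ae mu, forall t, 0 < t < T -> H2_bounded (wtt t) (C0 * t `^ (al - 2))}.

Lemma continuous_om_x t : continuous (om t).
Proof. by move=> x; have := @continuous_pair_l R (fun p => om p.1 p.2) t c_om x. Qed.

Lemma continuous_om_t x : continuous (om ^~ x).
Proof. by move=> t; have := @continuous_pair_r R (fun p => om p.1 p.2) x c_om t. Qed.

Lemma measurable_om : measurable_fun (DT `*` DX) (fun p : R * R => om p.1 p.2).
Proof. by apply: measurable_funTS; exact: continuous2_measurable. Qed.

(** A test function vanishes near 0, which makes every exponent [e] admissible. *)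
Lemma test_itg z e : C1_test 0 T z -> itg DT (fun t => `|z t| * t `^ e).
Proof.
move=> zt; have cz := C1_test_continuous zt.
have [Bz Bz0 zB] := cont_bounded (@continuous_subspaceT _ _ `[0, T] _ cz).
have [_ _ [c [d [c0 dT z0]]]] := zt.
have [Bp Bp0 pB] := cont_bounded (@within_powR R e c T c0).
apply: (@bnd_itg _ _ _ (Bz * Bp)) => //.
- by apply: (@itv_fin _ _ 0 T); exact: subset_itv_oo_cc.
- apply: measurable_funM; last by apply: measurable_funTS; exact: measurable_powR.
  by apply: measurableT_comp => //; apply: measurable_funTS; exact: continuous_measurable_fun.
move=> t; rewrite /DT /= in_itv/= => /andP[t0 tT].
rewrite normrM normr_id; case: (leP c t) => ct.
  have h1 : 0 <= t <= T by rewrite !ltW.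
  have h2 : c <= t <= T by rewrite ct ltW.
  by apply: ler_pM => //; [exact: zB|exact: pB].
by rewrite z0 ?normr0 ?mul0r ?mulr_ge0// negb_and -ltNge ct.
Qed.

Lemma derive1_bounded z : C1_test 0 T z -> exists2 Bz, 0 <= Bz & forall t, 0 < t < T -> `|derive1 z t| <= Bz.
Proof.
move=> [_ cz _].
have [Bz Bz0 zB] := cont_bounded (@continuous_subspaceT _ _ `[0, T] _ cz).
by exists Bz => // t /andP[t0 tT]; apply: zB; rewrite !ltW.
Qed.

Lemma B_ge0 : 0 <= B. Proof. exact: le_trans (om_bnd 0 0). Qed.

Lemma om_L2 t : is_L2 a b (om t).
Proof. by apply: cont_L2; apply: continuous_subspaceT; exact: continuous_om_x. Qed.

Lemma om_L2norm t : L2norm a b (om t) <= B * Num.sqrt (b - a).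
Proof.
have ba : 0 <= b - a by rewrite subr_ge0 ltW.
rewrite -ler_sqr ?nnegrE ?L2norm_ge0 ?mulr_ge0 ?B_ge0 ?sqrtr_ge0// exprMn sqr_sqrtr//.
have /is_L2P[mo _] := om_L2 t.
by apply: L2norm_bound => //; exact: ltW.
Qed.

Section pairing.
Variables (psi : R -> R) (C M : R).
Hypotheses (mpsi : measurable_fun DX psi) (psiC : forall x, DX x -> `|psi x| <= C).
Hypothesis M0 : 0 <= M.
Hypothesis dual1 : {ae mu, forall t, 0 < t < T ->
  `|\int[mu]_(x in DX) (wt t x * psi x)| <= M * t `^ (al - 1)}.
Hypothesis dual2 : {ae mu, forall t, 0 < t < T ->
  `|\int[mu]_(x in DX) (wtt t x * psi x)| <= M * t `^ (al - 2)}.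

Let G t := \int[mu]_(x in DX) (om t x * psi x).

(** Dominated convergence with a constant majorant. As [om] is continuous on the whole plane, the
    open interval of times [(-1, T + 1)] is available and covers the end points of [[0, T]]. *)
Lemma pairing_continuous : {within `[0, T], continuous G}.
Proof.
apply: continuous_in_subspaceT => t /set_mem /=; rewrite in_itv/= => /andP[t0 tT].
have Iop s : itg DX (fun x => om s x * psi x).
  by apply: L2_itgM; [exact: om_L2|exact: bnd_L2 mpsi psiC].
have psi_bnd s : {ae mu, forall x, DX x -> `|om s x * psi x| <= B * `|C|}.
  apply: aeW => x Dx; rewrite normrM ler_pM//.
  by rewrite (le_trans (psiC Dx))// ler_norm.
have cont : {ae mu, forall x, DX x -> {in (`](-1), (T + 1)[%classic : set R), continuous (fun t => om t x * psi x)}}.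
  apply: aeW => x _ s _; apply: cvgM; last exact: cvg_cst.
  exact: continuous_om_t.
have Ic : itg DX (fun x => B * `|C|).
  apply: (@bnd_itg _ _ _ `|B * `|C| |) => //.
  by apply: (@itv_fin _ _ a b); exact: subset_itv_oo_cc.
have H := (@continuity_under_integral R _ (measurableTypeR R) mu (fun t x => om t x * psi x) DX mDX
  (-1) (T + 1) (fun s _ => Iop s) cont _ Ic (fun s _ => psi_bnd s) t).
apply: H.
by rewrite inE /= in_itv/=; apply/andP; split; lra.
Qed.

Lemma pairing0 : G 0 = 0.
Proof.
rewrite /G (@eq_Rint _ _ (cst 0)) ?Rintegral_cst ?mul0r//.
by move=> x; rewrite /DX /= in_itv/= => /andP[ax xb]; rewrite om0 ?mul0r// !ltW.
Qed.

(** Common to one and two integrations by parts in time: [z0] is the first or second derivative of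
    [z], [V] that of [om], and [s] the resulting sign, -1 or 1. *)
Lemma pairing_step (z z0 : R -> R) (V : R -> R -> R) (e s : R) :
  `|s| <= 1 -> C1_test 0 T z -> measurable_fun DT z0 ->
  (exists2 Bz, 0 <= Bz & forall t, 0 < t < T -> `|z0 t| <= Bz) ->
  measurable_fun (DT `*` DX) (fun p : R * R => V p.1 p.2) ->
  {ae mu, forall t, 0 < t < T -> H2_bounded (V t) (C0 * t `^ e)} ->
  {ae mu, forall t, 0 < t < T -> `|\int[mu]_(x in DX) (V t x * psi x)| <= M * t `^ e} ->
  {ae mu, forall x, DX x ->
     \int[mu]_(t in DT) (om t x * z0 t) = s * \int[mu]_(t in DT) (V t x * z t)} ->
  `|\int[mu]_(t in DT) (G t * z0 t)| <= M * \int[mu]_(t in DT) (`|z t| * t `^ e).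
Proof.
move=> s1 zt mz0 [Bz Bz0 z0B] mV regV dualV omV.
have Iz := test_itg e zt.
rewrite -(RintZ _ mDT Iz).
apply: (@weak_time_step R T a b om V psi z0 z (cst (B * Num.sqrt (b - a) * Bz))
  (fun t => C0 * (`|z t| * t `^ e)) _ s C s1 measurable_om mV mpsi psiC mz0 _ omV).
- by apply: measurable_funTS; apply: continuous_measurable_fun; exact: C1_test_continuous zt.
- apply: (@bnd_itg _ _ _ `|B * Num.sqrt (b - a) * Bz|) => //.
  by apply: (@itv_fin _ _ 0 T); exact: subset_itv_oo_cc.
- exact: itgZ.
- exact: itgZ.
- move=> t; rewrite /DT /= in_itv/= => t0T; split; first exact: om_L2.
  by apply: ler_pM => //; [exact: L2norm_ge0|exact: om_L2norm|exact: z0B].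
- apply: filterS regV => t regV; rewrite /DT /= in_itv/= => t0T.
  have [VL VX _] := regV t0T; split=> //.
  by rewrite (mulrC `|z t|) mulrA ler_wpM2r.
- apply: filterS dualV => t dV; rewrite /DT /= in_itv/= => t0T.
  by rewrite (mulrC `|z t|) mulrA ler_wpM2r// dV.
Qed.

Lemma pairing_weak1 z : C1_test 0 T z ->
  `|\int[mu]_(t in `]0, T[) (G t * derive1 z t)| <=
  M * \int[mu]_(t in `]0, T[) (`|z t| * t `^ (al - 1)).
Proof.
move=> zt; apply: (@pairing_step z _ wt _ (-1)) => //.
- by rewrite normrN1.
- by case: zt => _ cz _; apply: measurable_funTS; exact: continuous_measurable_fun.
- exact: derive1_bounded.
apply: filterS wd1 => x w1; rewrite /DX /= in_itv/= => axb.
by have [_ _ /(_ z zt) ->] := w1 axb; rewrite mulN1r.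
Qed.

Lemma pairing_weak2 z : C1_test 0 T z -> C1_test 0 T (derive1 z) ->
  `|\int[mu]_(t in `]0, T[) (G t * derive1 (derive1 z) t)| <=
  M * \int[mu]_(t in `]0, T[) (`|z t| * t `^ (al - 2)).
Proof.
move=> zt zt'; apply: (@pairing_step z _ wtt _ 1) => //.
- by rewrite normr1.
- by case: zt' => _ cz _; apply: measurable_funTS; exact: continuous_measurable_fun.
- exact: derive1_bounded.
apply: filterS2 wd1 wd2 => x w1 w2; rewrite /DX /= in_itv/= => axb.
have [_ _ /(_ _ zt') ->] := w1 axb; have [_ _ /(_ _ zt) ->] := w2 axb.
by rewrite opprK mul1r.
Qed.

Lemma pairing_D1 t : 0 <= t <= T -> `|G t| <= M / al * t `^ al.
Proof.
exact: time_D1 al0 M0 pairing_continuous pairing0 pairing_weak1 t.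
Qed.

Lemma pairing_D2 (p z r : R) : 0 < p -> p < z -> z < r -> r <= T ->
  `|((r - z) * G p + (z - p) * G r) / (r - p) - G z| <= M * p `^ (al - 2) * (r - p) ^+ 2.
Proof.
exact: time_D2 al1 M0 pairing_continuous pairing_weak2 p z r.
Qed.

End pairing.

Section mass_and_stiffness.

Lemma mass_cusp (psi : R -> R) : measurable_fun DX psi ->
  (exists C, forall x, DX x -> `|psi x| <= C) ->
  cusp_bound T al (C0 * L2norm a b psi) (fun t => \int[mu]_(x in DX) (om t x * psi x)).
Proof.
move=> mpsi [C psiC]; have psiL := bnd_L2 mpsi psiC.
have M0 : 0 <= C0 * L2norm a b psi by rewrite mulr_ge0 ?L2norm_ge0.
split=> [t t0T|p z r p0 pz zr rT].
- apply: (pairing_D1 mpsi psiC M0 _ t0T).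
  apply: filterS reg1 => s rs s0T; have [VL VX _] := rs s0T.
  rewrite mulrAC; apply: le_trans (CauchySchwarz VL psiL) _.
  by rewrite ler_wpM2r ?L2norm_ge0.
- apply: (pairing_D2 mpsi psiC M0 _ p0 pz zr rT).
  apply: filterS reg2 => s rs s0T; have [VL VX _] := rs s0T.
  rewrite mulrAC; apply: le_trans (CauchySchwarz VL psiL) _.
  by rewrite ler_wpM2r ?L2norm_ge0.
Qed.

Variables (I : finType) (m P Q : I -> R).
Hypotheses (pI : forall i, a <= P i <= b) (qI : forall i, a <= Q i <= b).
Hypothesis mpq : \sum_i m i * (Q i - P i) = 0.

Let Lam := kL m P Q.
Let N := C0 * L2norm a b Lam.

Let om_within t : {within `[a, b], continuous (om t)}.
Proof. by apply: continuous_subspaceT; exact: continuous_om_x. Qed.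

(** Makes the constants of the smoothed estimates tend to the one wanted for [Lam]. *)
Lemma kmoll_norm : exists2 K, 0 <= K & forall d, 0 < d < 1 ->
  L2norm a b (kmoll a b m P Q (@moll R) d) <= L2norm a b Lam + K * d.
Proof.
have [K K0 KP] := kmoll_kL m ab pI qI.
have ba : 0 <= b - a by rewrite subr_ge0 ltW.
exists (K * Num.sqrt (b - a)); first by rewrite mulr_ge0 ?sqrtr_ge0.
move=> d d01; have /andP[d0 _] := d01.
have cm : continuous (kmoll a b m P Q (@moll R) d).
  by apply: quad_continuous; exact: (quad_kmoll m P Q ab (@quad_moll R) d0).
have cl := @kL_continuous _ _ m P Q.
have kL2 : is_L2 a b (kmoll a b m P Q (@moll R) d) by exact/cont_L2/continuous_subspaceT.
have lL2 : is_L2 a b Lam by exact/cont_L2/continuous_subspaceT.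
have dL2 : is_L2 a b (fun x => kmoll a b m P Q (@moll R) d x - Lam x).
  apply/cont_L2/continuous_subspaceT => x.
  by apply: cvgB; [exact: cm|exact: cl].
have -> : kmoll a b m P Q (@moll R) d = (fun x => Lam x + (kmoll a b m P Q (@moll R) d x - Lam x)).
  by apply/funext => x; rewrite addrCA subrr addr0.
apply: le_trans (L2norm_triangle lL2 dL2) _; rewrite lerD2l.
rewrite -ler_sqr ?nnegrE ?L2norm_ge0 ?mulr_ge0 ?sqrtr_ge0 ?(ltW d0)//.
rewrite mulrAC exprMn sqr_sqrtr//.
have /is_L2P[md _] := dL2.
by apply: L2norm_bound (ltW ab) => // x _; exact: KP.
Qed.

Let psi d := kmoll a b m P Q (@moll2 R) d.

Let mpsi d : measurable_fun DX (psi d).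
Proof.
apply: measurable_funTS; apply: continuous_measurable_fun.
exact: continuous_kmoll2.
Qed.

Let psi_bnd d : exists C, forall x, DX x -> `|psi d x| <= C.
Proof.
have c : {within `[a, b], continuous (psi d)}.
  by apply: continuous_subspaceT; exact: continuous_kmoll2.
have [C _ CP] := cont_bounded c; exists C => x.
by rewrite /DX /= in_itv/= => /andP[ax xb]; rewrite CP// !ltW.
Qed.

(** [psi d] is the second derivative of the smoothed kinks. Moving both derivatives onto [V] leaves
    the norm of the smoothed kinks themselves, which stays bounded as [d] tends to 0, whereas a
    bound through the norm of the bumps [psi d] would not be uniform in [d]. *)
Let dual V e d : 0 < d < 1 ->
  {ae mu, forall t, 0 < t < T -> H2_bounded (V t) (C0 * t `^ e)} ->
  {ae mu, forall t, 0 < t < T ->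
    `|\int[mu]_(x in DX) (V t x * psi d x)| <= C0 * L2norm a b (kmoll a b m P Q (@moll R) d) * t `^ e}.
Proof.
move=> d01; have /andP[d0 _] := d01; apply: filterS => t VH t0T.
have [t1 e1] := kmoll1_test m ab pI qI d01.
have [t0 e0] := kmoll_test ab pI qI mpq d01.
have [VL _ [v2 [v2L v2X v2E]]] := VH t0T.
rewrite /psi -e1 -e0 v2E//; last by rewrite e0.
have kL2 : is_L2 a b (kmoll a b m P Q (@moll R) d).
  by apply/cont_L2/continuous_subspaceT; exact: C1_test_continuous t0.
apply: le_trans (CauchySchwarz v2L kL2) _.
by rewrite mulrAC ler_wpM2r ?L2norm_ge0.
Qed.

(** The limit, as the smoothing parameter [d] tends to 0, of the estimates for the pairings of [om]
    with [psi d]. *)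
Lemma stiff_cusp : cusp_bound T al N (fun t => kf m P Q (om t)).
Proof.
have [K K0 KP] := kmoll_norm.
have cv t := @kmoll2_cvg R a b I m P Q ab pI qI (om t) (@om_within t).
have M0 d : 0 <= C0 * L2norm a b (kmoll a b m P Q (@moll R) d) by rewrite mulr_ge0 ?L2norm_ge0.
split=> [t t0T|p z r p0 pz zr rT].
- apply: (@cvg_bound_lim _ _ _ _ (C0 * K / al * t `^ al) (cv t)).
    by rewrite !mulr_ge0 ?powR_ge0 ?invr_ge0// ltW.
  move=> d d01; have [C CP] := psi_bnd d.
  apply: le_trans (pairing_D1 (mpsi d) CP (M0 d) (dual d01 reg1) t0T) _.
  rewrite (_ : _ + _ = (C0 * (L2norm a b Lam + K * d)) / al * t `^ al); last by rewrite /N; ring.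
  by rewrite ler_wpM2r ?powR_ge0// ler_wpM2r ?invr_ge0 ?(ltW al0)// ler_wpM2l ?KP.
pose H d t := \int[mu]_(x in DX) (om t x * psi d x).
pose G t := kf m P Q (om t).
have cv2 : ((r - z) * H d p + (z - p) * H d r) / (r - p) - H d z @[d --> 0^'+] -->
    ((r - z) * G p + (z - p) * G r) / (r - p) - G z.
  apply: cvgB; last exact: cv.
  apply: cvgM; last exact: cvg_cst.
  by apply: cvgD; (apply: cvgM; [exact: cvg_cst|exact: cv]).
apply: (@cvg_bound_lim _ _ _ _ (C0 * K * p `^ (al - 2) * (r - p) ^+ 2) cv2).
  by rewrite mulr_ge0 ?sqr_ge0// mulr_ge0 ?powR_ge0// mulr_ge0.
move=> d d01; have [C CP] := psi_bnd d.
apply: le_trans (pairing_D2 (mpsi d) CP (M0 d) (dual d01 reg2) p0 pz zr rT) _.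
rewrite [leRHS](_ : _ = (C0 * (L2norm a b Lam + K * d)) * p `^ (al - 2) * (r - p) ^+ 2); last by rewrite /N; ring.
by rewrite ler_wpM2r ?sqr_ge0// ler_wpM2r ?powR_ge0// ler_wpM2l ?KP.
Qed.

End mass_and_stiffness.

End regularity.

(** * Second derivatives tested with kinks *)

Section grid.
Context {R : realType} (n : nat) (x : nat -> R).
Local Notation mu := (@lebesgue_measure R).
Hypothesis gx : forall i, (i < n)%N -> x i < x i.+1.

Lemma grid_le i j : (i <= j)%N -> (j <= n)%N -> x i <= x j.
Proof.
elim: j => [|j IH]; first by rewrite leqn0 => /eqP ->.
rewrite leq_eqVlt => /predU1P[->//|]; rewrite ltnS => ij jn.
by rewrite (le_trans (IH ij (ltnW jn)))// ltW// gx.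
Qed.

Lemma grid_cell_co k y : x 0 <= y < x k ->
  exists2 i, (i < k)%N & x i <= y < x i.+1.
Proof.
elim: k => [|k IH] /andP[y0 yk]; first by move: yk; rewrite ltNge y0.
have [yk'|yk'] := ltP y (x k); last by exists k => //; rewrite yk' yk.
by have [|i ik yi] := IH; [rewrite y0|exists i => //; exact: ltnW].
Qed.

Lemma grid_cell y : x 0 <= y <= x n -> (0 < n)%N ->
  exists2 i, (i < n)%N & x i <= y <= x i.+1.
Proof.
move=> /andP[y0 yn] n0; have [yn'|yn'] := ltP y (x n).
  have [|i iN /andP[y1 y2]] := @grid_cell_co n y; first by rewrite y0.
  by exists i => //; rewrite y1 ltW.
have := @gx n.-1; rewrite prednK// leqnn => /(_ isT) xn.
exists n.-1; rewrite ?prednK// ?yn ?andbT//.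
by rewrite (le_trans _ yn')// ltW.
Qed.

Lemma Rint_grid f : itg `]x 0, x n[ f ->
  \int[mu]_(y in `]x 0, x n[) f y = \sum_(i < n) \int[mu]_(y in `]x i, x i.+1[) f y.
Proof.
suff H k : (k <= n)%N -> itg `]x 0, x k[ f ->
    \int[mu]_(y in `]x 0, x k[) f y = \sum_(i < k) \int[mu]_(y in `]x i, x i.+1[) f y.
  exact: H.
elim: k => [_ _|k IH kn If].
  by rewrite big_ord0 set_itvoo0 Rintegral_set0.
have x0k := grid_le (leq0n k) (ltnW kn); have xk := gx kn.
have If' : itg `]x 0, x k[ f.
  by apply: itgS If => // y /=; rewrite !in_itv/= => /andP[-> /lt_trans]; apply.
rewrite big_ord_recr /= -IH ?(ltnW kn)//.
have := @Rintegral_itvB R f (BRight (x 0%N)) (BLeft (x k.+1)) (x k) If.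
rewrite !bnd_simp => /(_ x0k xk) <-.
rewrite -[X in _ - X]Rintegral_itv_bndo_bndc//; ring.
Qed.

Lemma Rint_step (f : R -> R) (c : nat -> R) : itg `]x 0, x n[ f ->
  (forall i y, (i < n)%N -> x i < y < x i.+1 -> f y = c i) ->
  \int[mu]_(y in `]x 0, x n[) f y = \sum_(i < n) c i * (x i.+1 - x i).
Proof.
move=> If fc; rewrite Rint_grid//; apply: eq_bigr => i _.
rewrite -Rint_cst_itv ?(ltW (gx _))//; apply: eq_Rint => y /=.
by rewrite in_itv/= => yi; rewrite (fc i).
Qed.

End grid.

(** * Kink combinations as pairings with the second derivative *)

Section kink_formula.
Context {R : realType} (a b : R) (ab : a < b).
Local Notation mu := (@lebesgue_measure R).
Let DX : set R := `]a, b[.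
Let mDX : measurable DX. Proof. exact: measurable_itv. Qed.

Lemma kL_L2 (I : finType) (m P Q : I -> R) : is_L2 a b (kL m P Q).
Proof. by apply/cont_L2/continuous_subspaceT; exact: kL_continuous. Qed.

(** The double integration by parts is legitimate for the smoothed kinks. The left side then
    converges by continuity of [u], and the right side because the smoothed kinks converge uniformly
    at the rate [K * d]. *)
Lemma kink_formula (u v : R -> R) (I : finType) (m P Q : I -> R) :
  {within `[a, b], continuous u} -> is_L2 a b v ->
  (forall phi, C1_test a b phi -> C1_test a b (derive1 phi) ->
       \int[mu]_(x in DX) (u x * derive1 (derive1 phi) x) =
       \int[mu]_(x in DX) (v x * phi x)) ->
  (forall i, a <= P i <= b) -> (forall i, a <= Q i <= b) ->
  \sum_i m i * (Q i - P i) = 0 ->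
  kf m P Q u = \int[mu]_(x in DX) (v x * kL m P Q x).
Proof.
move=> cu vL uv pI qI mpq.
have [K K0 KP] := kmoll_kL m ab pI qI.
have cv := @kmoll2_cvg R a b I m P Q ab pI qI u cu.
have lL2 := kL_L2 m P Q.
apply/eqP; rewrite -subr_eq0 -normr_le0.
have cv' : \int[mu]_(y in `]a, b[) (u y * kmoll a b m P Q (@moll2 R) d y) -
    \int[mu]_(x in DX) (v x * kL m P Q x) @[d --> 0^'+] -->
    kf m P Q u - \int[mu]_(x in DX) (v x * kL m P Q x).
  by apply: cvgB; [exact: cv|exact: cvg_cst].
have ba : 0 <= b - a by rewrite subr_ge0 ltW.
apply: (cvg_bound_lim cv' (K := L2norm a b v * (K * Num.sqrt (b - a)))).
  by rewrite !mulr_ge0 ?L2norm_ge0 ?sqrtr_ge0.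
move=> d d01; have /andP[d0 _] := d01.
have [t1 e1] := kmoll1_test m ab pI qI d01.
have [t0 e0] := kmoll_test ab pI qI mpq d01.
rewrite /= -e1 -e0 uv//; last by rewrite e0.
have kL2 : is_L2 a b (kmoll a b m P Q (@moll R) d).
  by apply/cont_L2/continuous_subspaceT; exact: C1_test_continuous t0.
have dL2 : is_L2 a b (fun x => kmoll a b m P Q (@moll R) d x - kL m P Q x).
  apply/cont_L2/continuous_subspaceT => x.
  by apply: cvgB; [exact: (C1_test_continuous t0)|exact: kL_continuous].
rewrite add0r -RintB//; [|exact: L2_itgM|exact: L2_itgM].
rewrite (@eq_Rint _ _ (fun x => v x * (kmoll a b m P Q (@moll R) d x - kL m P Q x))); last first.
  by move=> x _; rewrite mulrBr.
apply: le_trans (CauchySchwarz vL dL2) _; rewrite -mulrA ler_wpM2l ?L2norm_ge0//.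
rewrite -ler_sqr ?nnegrE ?L2norm_ge0 ?mulr_ge0 ?sqrtr_ge0 ?(ltW d0)//.
rewrite mulrAC exprMn sqr_sqrtr//.
have /is_L2P[md _] := dL2.
by apply: L2norm_bound (ltW ab) => // x _; exact: KP.
Qed.

(* By testing with combinations of kinks, u behaves as if it had a second
   derivative of L^2 norm at most C. *)
Definition kink_bounded (C : R) (u : R -> R) : Prop :=
  forall (I : finType) (m P Q : I -> R),
    (forall i, a <= P i <= b) -> (forall i, a <= Q i <= b) ->
    \sum_i m i * (Q i - P i) = 0 -> `|kf m P Q u| <= C * L2norm a b (kL m P Q).

(* Testing with the sum of the hats of apex z i on the cells, each weighted by
   the interpolation defect of u at z i. *)
Lemma defect_bound (C h : R) (u : R -> R) (n : nat) (x z : nat -> R) :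
  0 <= C -> kink_bounded C u -> x 0 = a -> x n = b ->
  (forall i, (i < n)%N -> x i < x i.+1) ->
  (forall i, (i < n)%N -> x i <= z i <= x i.+1) ->
  (forall i, (i < n)%N -> x i.+1 - x i <= h) ->
  \sum_(i < n) (x i.+1 - x i) * (u (z i) -
    ((x i.+1 - z i) * u (x i) + (z i - x i) * u (x i.+1)) / (x i.+1 - x i)) ^+ 2 <=
  (C * h ^+ 2) ^+ 2.
Proof.
move=> C0 uC x0 xn gx zx hx.
pose e i := u (z i) -
    ((x i.+1 - z i) * u (x i) + (z i - x i) * u (x i.+1)) / (x i.+1 - x i).
pose hh i := x i.+1 - x i.
have hh0 i : (i < n)%N -> 0 < hh i by move=> /gx; rewrite subr_gt0.
(* The slopes [(x_(i+1) - z_i) e_i] and [- (z_i - x_i) e_i] form a tent vanishing at both ends of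
   the cell. The cell contributes [- h_i e_i^2] to the pairing with [u], [h_i] being its length. *)
pose m (j : 'I_n * bool) : R := if j.2 then (x j.1.+1 - z j.1) * e j.1
  else - ((z j.1 - x j.1) * e j.1).
pose P (j : 'I_n * bool) : R := if j.2 then x j.1 else z j.1.
pose Q (j : 'I_n * bool) : R := if j.2 then z j.1 else x j.1.+1.
have gl := grid_le gx.
have xI i : (i <= n)%N -> a <= x i <= b.
  by move=> iN; rewrite -x0 -xn !gl.
have zI i : (i < n)%N -> a <= z i <= b.
  move=> iN; have /andP[z1 z2] := zx i iN.
  have /andP[? ?] := xI i (ltnW iN); have /andP[? ?] := xI i.+1 iN.
  by apply/andP; split; lra.
have PI j : a <= P j <= b by rewrite /P; case: ifP => _; [exact/xI/ltnW/ltn_ord|exact/zI/ltn_ord].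
have QI j : a <= Q j <= b by rewrite /Q; case: ifP => _; [exact/zI/ltn_ord|exact/xI/ltn_ord].
have sumE F : \sum_j F j = \sum_(i < n) (F (i, true) + F (i, false)) :> R.
  transitivity (\sum_(j : 'I_n * bool) F (j.1, j.2)); first by apply: eq_bigr => -[].
  rewrite -(pair_bigA _ (fun i j => F (i, j))) /=.
  by apply: eq_bigr => i _; rewrite big_bool.
have mpq : \sum_j m j * (Q j - P j) = 0.
  by rewrite sumE big1// => i _; rewrite /m /P /Q /=; ring.
pose S := \sum_(i < n) hh i * e i ^+ 2.
have S0 : 0 <= S by apply: sumr_ge0 => i _; rewrite mulr_ge0 ?sqr_ge0// ltW// hh0.
have kfE : kf m P Q u = - S.
  rewrite /kf sumE -sumrN; apply: eq_bigr => i _; rewrite /m /P /Q /=.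
  have hi := hh0 i (ltn_ord i).
  have ue : u (z i) * hh i = e i * hh i + ((x i.+1 - z i) * u (x i) + (z i - x i) * u (x i.+1)).
    by rewrite /e /hh; field; rewrite gt_eqF.
  have -> : (x i.+1 - z i) * e i * (u (x i) - u (z i)) + - ((z i - x i) * e i) * (u (z i) - u (x i.+1)) =
    e i * ((x i.+1 - z i) * u (x i) + (z i - x i) * u (x i.+1) - u (z i) * hh i).
    by rewrite /hh; ring.
  by rewrite ue; ring.
have kLb i y : (i < n)%N -> x i < y < x i.+1 -> `|kL m P Q y| <= hh i * `|hh i * e i|.
  move=> iN /andP[y1 y2]; rewrite /kL sumE (bigD1 (Ordinal iN))//= big1 ?addr0; last first.
    move=> j ji; rewrite /m /P /Q /=.
    have /andP[z1 z2] := zx j (ltn_ord j).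
    have [ij|ij|ij] := ltngtP (nat_of_ord j) i.
    - have xji : x j.+1 <= x i by apply: gl => //; exact: ltnW.
      by rewrite /pp !max_l; try lra; ring.
    - have xij : x i.+1 <= x j by apply: gl => //; exact/ltnW.
      by rewrite /pp !max_r; try lra; ring.
    - by exfalso; move/eqP: ji; apply; apply: val_inj.
  rewrite /m /P /Q /=; have /andP[z1 z2] := zx i iN; have hi := hh0 i iN.
  rewrite normrM (gtr0_norm hi) /pp [Num.max (y - x i) 0]max_l ?[Num.max (y - x i.+1) 0]max_r; try lra.
  rewrite (_ : _ + _ = e i * ((x i.+1 - z i) * (y - x i) - hh i * Num.max (y - z i) 0)); last first.
    by rewrite /hh; ring.
  rewrite normrM (_ : hh i * (hh i * `|e i|) = `|e i| * (hh i * hh i)); last by ring.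
  rewrite ler_wpM2l//.
  rewrite ler_norml; case: (leP (y - z i) 0) => yz.
    by rewrite mulr0 subr0 /hh; apply/andP; split; nra.
  by rewrite /hh; apply/andP; split; nra.
have kLn : L2norm a b (kL m P Q) ^+ 2 <= h ^+ 4 * S.
  have kl := kL_L2 m P Q; have /is_L2P[mk Ik] := kl.
  rewrite L2norm_sqE//; move: Ik; rewrite -x0 -xn => Ik.
  rewrite (Rint_grid gx Ik) mulr_sumr; apply: ler_sum => i _.
  have hi := hh0 i (ltn_ord i); have hih := hx i (ltn_ord i).
  apply: (@le_trans _ _ ((hh i * `|hh i * e i|) ^+ 2 * hh i)).
    rewrite -Rint_cst_itv; last by rewrite ltW// gx.
    apply: le_Rint => //.
    - apply: itgS Ik => // y /=; rewrite !in_itv/= => /andP[y1 y2].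
      have := gl 0 i (leq0n _) (ltnW (ltn_ord i)); have := gl i.+1 n (ltn_ord i) (leqnn _).
      by move=> *; apply/andP; split; lra.
    - apply: (@bnd_itg _ _ _ `|(hh i * `|hh i * e i|) ^+ 2|) => //.
      by apply: (@itv_fin _ _ (x i) (x i.+1)); exact: subset_itv_oo_cc.
    - move=> y /=; rewrite in_itv/= => yi.
      by rewrite -(real_normK (num_real (kL m P Q y))) ler_sqr ?nnegrE ?kLb// mulr_ge0// ltW.
  have -> : (hh i * `|hh i * e i|) ^+ 2 * hh i = hh i ^+ 4 * (hh i * e i ^+ 2).
    by rewrite normrM (gtr0_norm hi) !exprMn -normrX (ger0_norm (sqr_ge0 _)); ring.
  have he : 0 <= hh i * e i ^+ 2 by rewrite mulr_ge0 ?sqr_ge0// ltW.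
  by apply: ler_wpM2r => //; rewrite lerXn2r ?nnegrE ?(ltW hi)// (le_trans _ hih)// ltW.
have := uC _ m P Q PI QI mpq; rewrite kfE normrN (ger0_norm S0) => SC.
(* The sum [S] is at most [C] times the norm of the tents, whose square is at most [h^4 S]; squaring
   and dividing by [S] closes the estimate. *)
have h2 : S ^+ 2 <= (C * h ^+ 2) ^+ 2 * S.
  apply: (@le_trans _ _ ((C * L2norm a b (kL m P Q)) ^+ 2)).
    by rewrite ler_sqr ?nnegrE// mulr_ge0 ?L2norm_ge0.
  rewrite [leLHS]exprMn (_ : _ * S = C ^+ 2 * (h ^+ 4 * S)); last by ring.
  by apply: ler_wpM2l => //; exact: sqr_ge0.
change (S <= (C * h ^+ 2) ^+ 2).
have [S00|S00] := eqVneq S 0; first by rewrite S00 sqr_ge0.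
have Sp : 0 < S by rewrite lt_neqAle eq_sym S00.
by move: h2; rewrite expr2 ler_pM2r.
Qed.

Lemma Rint_pp (c : R) : a <= c <= b ->
  \int[mu]_(y in DX) pp (y - c) = (b - c) ^+ 2 / 2.
Proof.
move=> /andP[ac cb].
have q y : quad (fun y => 2^-1 * pp (y - c) ^+ 2) y (pp (y - c)).
  apply: (quad_ext _ _ (quadZ 2^-1 (quad_shift (quad_pp2 (y - c))))) => //.
  by rewrite mulKf.
have cpp := @pp_continuous_shift R c.
have c2 := quad_continuous q.
rewrite Rint_oo_cc; last by apply/itg_oo_cc/itg_cont/continuous_subspaceT.
rewrite /Rintegral (@continuous_FTC2 _ _ (fun y => 2^-1 * pp (y - c) ^+ 2))//.
- by rewrite /= /pp max_l ?max_r; try lra; rewrite -EFinB /=; field.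
- exact: continuous_subspaceT.
- split; [|apply: cvg_at_right_filter; exact: c2|apply: cvg_at_left_filter; exact: c2].
  by move=> x _; have [] := quad_derive (q x).
- by move=> x _; rewrite derive1E; have [_ ->] := quad_derive (q x).
Qed.

(** * An L^2 bound on the second derivative from bounds on kinks *)

Section density.
Variables (u v : R -> R) (C : R).
Hypotheses (C0 : 0 <= C) (vL : is_L2 a b v) (uC : kink_bounded C u).
Hypothesis uv : forall (I : finType) (m P Q : I -> R),
  (forall i, a <= P i <= b) -> (forall i, a <= Q i <= b) ->
  \sum_i m i * (Q i - P i) = 0 ->
  kf m P Q u = \int[mu]_(x in DX) (v x * kL m P Q x).

Let h (n : nat) : R := (b - a) / n.+1%:R.
Let x (n i : nat) : R := a + i%:R * h n.
Let z (n i : nat) : R := x n i + h n / 2.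
Let e (n i : nat) : R := u (z n i) - (u (x n i) + u (x n i.+1)) / 2.
(** On each cell, the second difference quotient of [u] at the two ends and the midpoint. As the
    tent over the cell with unit-weight normalization has integral [h^2 / 8], it is also the average
    of [v] against that tent. *)
Let w (n : nat) (y : R) : R :=
  \sum_(i < n.+1) (- 8 * e n i / h n ^+ 2) * \1_(`[x n i, x n i.+1[%classic) y.

Let h_gt0 n : 0 < h n. Proof. by rewrite divr_gt0// subr_gt0. Qed.

Let xS n i : x n i.+1 = x n i + h n.
Proof. by rewrite /x -natr1; ring. Qed.

Let x0 n : x n 0 = a. Proof. by rewrite /x mul0r addr0. Qed.

Let xn n : x n n.+1 = b.
Proof. by rewrite /x /h mulrC divfK ?pnatr_eq0//; ring. Qed.

Let gx n i : (i < n.+1)%N -> x n i < x n i.+1.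
Proof. by move=> _; rewrite xS ltrDl. Qed.

Let xI n i : (i <= n.+1)%N -> a <= x n i <= b.
Proof. by move=> iN; rewrite -{1}(x0 n) -(xn n) !(grid_le (@gx n)). Qed.

Let w_cell n i y : (i < n.+1)%N -> x n i <= y < x n i.+1 -> w n y = - 8 * e n i / h n ^+ 2.
Proof.
move=> iN yi; rewrite /w (bigD1 (Ordinal iN))//= big1 ?addr0.
  by rewrite indicE mem_set ?mulr1//= in_itv.
move=> j ji; rewrite indicE memNset ?mulr0//= in_itv/= => /andP[y1 y2].
have /andP[y3 y4] := yi.
have [ij|ij|ij] := ltngtP (nat_of_ord j) i.
- by have : x n j.+1 <= x n i by [apply: (grid_le (@gx n)) => //; exact: ltnW]; lra.
- by have : x n i.+1 <= x n j by [apply: (grid_le (@gx n)) => //; exact: ltnW]; lra.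
- by move/eqP: ji; apply; apply: val_inj.
Qed.

Let mw n : measurable_fun DX (w n).
Proof.
apply: measurable_sum => i; apply: measurable_funM; first exact: measurable_cst.
by apply: measurable_indic; exact: measurable_itv.
Qed.

Let w_bnd n : exists B, forall y, `|w n y| <= B.
Proof.
exists (\sum_(i < n.+1) `|- 8 * e n i / h n ^+ 2|) => y.
rewrite (le_trans (ler_norm_sum _ _ _))//; apply: ler_sum => i _.
by rewrite normrM indicE ler_piMr//; case: (_ \in _); rewrite ?normr1 ?normr0.
Qed.

Let w_L2 n : is_L2 a b (w n).
Proof. by have [B BP] := w_bnd n; apply: (@bnd_L2 _ _ _ _ B) => // y _. Qed.

(** The bound [(C h^2)^2] on the midpoint defects compensates the factor [64 / h^4] of the squared
    difference quotients. *)
Let w_int n : \int[mu]_(y in DX) (w n y ^+ 2) <= 64 * C ^+ 2.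
Proof.
have /is_L2P[_ Iw] := w_L2 n; have hn := h_gt0 n.
have Iw' : itg `]x n 0%N, x n n.+1[ (fun y => w n y ^+ 2) by rewrite x0 xn.
rewrite /DX -(x0 n) -(xn n) (Rint_step (@gx n) (c := fun i => (- 8 * e n i / h n ^+ 2) ^+ 2) Iw').
  have zx i : (i < n.+1)%N -> x n i <= z n i <= x n i.+1.
    by move=> _; rewrite xS /z; apply/andP; split; lra.
  have hx i : (i < n.+1)%N -> x n i.+1 - x n i <= h n by move=> _; rewrite xS; lra.
  have := defect_bound C0 uC (x0 n) (xn n) (@gx n) zx hx.
  set S := \sum_(i < _) _ => SC.
  have -> : \sum_(i < n.+1) (- 8 * e n i / h n ^+ 2) ^+ 2 * (x n i.+1 - x n i) = 64 / h n ^+ 4 * S.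
    rewrite /S mulr_sumr; apply: eq_bigr => i _.
    have -> : u (z n i) - ((x n i.+1 - z n i) * u (x n i) + (z n i - x n i) * u (x n i.+1)) /
      (x n i.+1 - x n i) = e n i.
      by rewrite /e xS /z; field; lra.
    by rewrite xS; field; rewrite gt_eqF.
  apply: (@le_trans _ _ (64 / h n ^+ 4 * (C * h n ^+ 2) ^+ 2)).
    by rewrite ler_wpM2l// divr_ge0// exprn_ge0// ltW.
  by rewrite le_eqVlt; apply/orP; left; apply/eqP; field; rewrite gt_eqF.
by move=> i y iN /andP[y1 y2]; rewrite (@w_cell n i)// ltW.
Qed.

Let vt := v \_ DX.

(** The tent is at most [h / 2], so the deviation is at most [8 / h^2 * h / 2 = 4 / h] times the
    integral of [|v - v y|] over the cell. The cell lies in the ball of radius [2 h] around [y], of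
    measure [4 h]: this gives the factor 16. *)
Let w_davg n y : a < y < b -> (`|w n y - v y|%:E <= 16%:E * davg vt y (2 * h n))%E.
Proof.
move=> /andP[ay yb]; have hn := h_gt0 n.
have Dy : DX y by rewrite /DX /= in_itv/= ay.
have [i iN /andP[y1 y2]] : exists2 i, (i < n.+1)%N & x n i <= y < x n i.+1.
  by apply: grid_cell_co; rewrite x0 xn ltW.
rewrite (w_cell iN) ?y1//.
pose m (i : bool) : R := if i then 2^-1 else - 2^-1.
pose P (j : bool) : R := if j then x n i else z n i.
pose Q (j : bool) : R := if j then z n i else x n i.+1.
have zI : a <= z n i <= b.
  have /andP[? ?] := xI (ltnW iN); have /andP[? ?] := xI iN.
  by have := xS n i; rewrite /z => ?; apply/andP; split; lra.
have PI j : a <= P j <= b by rewrite /P; case: j => //; exact/xI/ltnW.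
have QI j : a <= Q j <= b by rewrite /Q; case: j => //; exact/xI.
have mpq : \sum_j m j * (Q j - P j) = 0.
  by rewrite big_bool /m /P /Q /= xS /z; field.
have kfE : kf m P Q u = - e n i.
  by rewrite /kf big_bool /m /P /Q /= /e; field.
have Ipp c : itg DX (fun y => pp (y - c)).
  by apply/itg_oo_cc/itg_cont/continuous_subspaceT; exact: pp_continuous_shift.
have kLint : \int[mu]_(t in DX) kL m P Q t = h n ^+ 2 / 8.
  rewrite (@eq_Rint _ _ (fun t => 2^-1 * (pp (t - x n i) - pp (t - z n i)) +
     - 2^-1 * (pp (t - z n i) - pp (t - x n i.+1)))); last first.
    by move=> t _; rewrite /kL big_bool.
  rewrite RintD//; [|apply: itgZ => //; exact: itgB|apply: itgZ => //; exact: itgB].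
  rewrite !RintZ ?RintB//; try exact: itgB.
  rewrite !Rint_pp ?xI//; last exact: ltnW.
  by rewrite xS /z; field.
have Iv : itg DX v.
  have c1 : is_L2 a b (cst 1) by apply: (@bnd_L2 _ _ _ _ 1) => // t _; rewrite normr1.
  by apply: eq_itg (L2_itgM vL c1) => // t _; rewrite mulr1.
have kl := kL_L2 m P Q.
have Ivk := L2_itgM vL kl.
have Ik : itg DX (kL m P Q).
  by apply/itg_oo_cc/itg_cont/continuous_subspaceT; exact: kL_continuous.
have -> : - 8 * e n i / h n ^+ 2 - v y =
    8 / h n ^+ 2 * \int[mu]_(t in DX) ((v t - v y) * kL m P Q t).
  rewrite (@eq_Rint _ _ (fun t => v t * kL m P Q t - v y * kL m P Q t)); last first.
    by move=> t _; rewrite mulrBl.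
  rewrite RintB//; last exact: itgZ.
  rewrite RintZ// kLint -uv// kfE; field; by rewrite gt_eqF.
have kLE t : kL m P Q t = 2^-1 * (pp (t - x n i) - pp (t - z n i)) +
     - 2^-1 * (pp (t - z n i) - pp (t - x n i.+1)) by rewrite /kL big_bool.
have xSi := xS n i.
have kLb t : `|kL m P Q t| <= h n / 2.
  have a1 := pp_lip (t - z n i) (t - x n i).
  have a2 := pp_lip (t - x n i.+1) (t - z n i).
  have h2 : 0 < h n / 2 by rewrite divr_gt0.
  have b1 : `|t - x n i - (t - z n i)| = h n / 2.
    have -> : t - x n i - (t - z n i) = h n / 2 by rewrite /z; ring.
    by rewrite gtr0_norm.
  have b2 : `|t - z n i - (t - x n i.+1)| = h n / 2.
    have -> : t - z n i - (t - x n i.+1) = h n / 2 by rewrite xS /z; field.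
    by rewrite gtr0_norm.
  rewrite kLE (le_trans (ler_normD _ _))// !normrM normrN gtr0_norm//; lra.
have kL0 t : ~ (x n i < t < x n i.+1) -> kL m P Q t = 0.
  move=> /negP; rewrite negb_and -!leNgt kLE /z => /orP[ti|ti].
    by rewrite /pp !max_r; try lra.
  by rewrite /pp !max_l; try lra.
pose cell := `]x n i, x n i.+1[%classic.
have cD : cell `<=` DX.
  move=> t; rewrite /cell /DX /= !in_itv/= => /andP[t1 t2].
  have /andP[? ?] := xI (ltnW iN); have /andP[? ?] := xI iN.
  by apply/andP; split; lra.
have cy : itg DX (cst (v y)).
  apply: (@bnd_itg _ _ _ `|v y|) => //.
  by apply: (@itv_fin _ _ a b); exact: subset_itv_oo_cc.
have Id : itg cell (fun t => `|v t - v y|).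
  by apply/itg_norm/(itgS _ _ cD) => //; [exact: measurable_itv|exact: itgB].
have le1 : `|\int[mu]_(t in DX) ((v t - v y) * kL m P Q t)| <=
    h n / 2 * \int[mu]_(t in cell) `|v t - v y|.
  rewrite (@Rint_supp _ _ cell) //; last first.
  - by move=> t _ nt; rewrite kL0 ?mulr0// => tt; apply: nt; rewrite /cell /= in_itv.
  - exact: measurable_itv.
  rewrite -RintZ//; last exact: measurable_itv.
  apply: norm_Rint_le.
  - exact: measurable_itv.
  - apply: (itgS _ _ cD) => //; first exact: measurable_itv.
    by apply: (eq_itg _ _ (itgB mDX Ivk (itgZ (v y) mDX Ik))) => // t _; rewrite mulrBl.
  - by apply: itgZ => //; exact: measurable_itv.
  - by apply: aeW => t _; rewrite normrM mulrC ler_wpM2r.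
rewrite normrM gtr0_norm ?divr_gt0 ?exprn_gt0//.
apply: (@le_trans _ _ (4 / h n * \int[mu]_(t in cell) `|v t - v y|)%:E).
  rewrite lee_fin; apply: le_trans (ler_wpM2l _ le1) _.
    by rewrite divr_ge0// exprn_ge0// ltW.
  by rewrite mulrA ler_wpM2r ?Rintegral_ge0// le_eqVlt; apply/orP; left; apply/eqP; field; lra.
rewrite /davg /iavg lebesgue_measure_ball; last lra.
have h40 : 2 * h n *+ 2 != 0 by rewrite gt_eqF// mulrn_wgt0// mulr_gt0.
rewrite inver (negbTE h40).
have e16 : (16%:E * ((2 * h n *+ 2)^-1)%:E = (4 / h n)%:E)%E.
  by rewrite -EFinM; congr EFin; field; rewrite gt_eqF.
rewrite muleA e16 EFinM.
apply: lee_wpmul2l; first by rewrite lee_fin divr_ge0// ltW.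
rewrite -EFin_Rint//; last exact: measurable_itv.
have mvt : measurable_fun setT vt.
  by have /is_L2P[mv _] := vL; apply/(measurable_restrictT _ _).1.
rewrite (@eq_integral _ _ _ mu cell (fun t => `|(center (vt y) \o vt) t|%:E)); last first.
  move=> t /set_mem ct; rewrite /= /vt !patchE !mem_set//; exact: cD.
apply: ge0_subset_integral => //.
- exact: measurable_itv.
- exact: measurable_ball.
- apply/measurable_EFinP/measurableT_comp => //; apply: measurable_funB => //.
  exact: (measurable_funTS mvt).
- move=> t; rewrite /cell /= in_itv/= => /andP[t1 t2]; rewrite ball_itv /= in_itv/=.
  by apply/andP; split; lra.
Qed.

Let h_cvg : 2 * h n @[n --> \oo] --> 0^'+.
Proof.
rewrite (_ : (fun _ => _) = (fun n => 2 * (b - a) / n.+1%:R)); last first.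
  by apply/funext => n; rewrite /h mulrA.
by apply: cvg_divS_at_right0; rewrite mulr_gt0// subr_gt0.
Qed.

(** By Lebesgue differentiation the step functions [w n] converge to [v] almost everywhere, and
    Fatou's lemma transfers their bound [64 C^2]. The constant depends on [C] alone, which later
    makes the norms of second space derivatives uniform in time. *)
Lemma kink_bounded_L2norm : L2norm a b v <= 8 * C.
Proof.
have /is_L2P[mv Iv] := vL.
have C80 : 0 <= 8 * C by rewrite mulr_ge0.
rewrite -ler_sqr ?nnegrE ?L2norm_ge0// L2norm_sqE// -lee_fin -EFin_Rint//.
have Iv1 : itg DX v.
  have c1 : is_L2 a b (cst 1) by apply: (@bnd_L2 _ _ _ _ 1) => // t _; rewrite normr1.
  by apply: eq_itg (L2_itgM vL c1) => // t _; rewrite mulr1.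
have locv : locally_integrable [set: R] vt by exact: integrable_locally_restrict.
have ae_cvg : {ae mu, forall y, DX y -> w n y @[n --> \oo] --> v y}.
  apply: filterS (lebesgue_differentiation locv) => y ly; rewrite /DX /= in_itv/= => Dy.
  have c1 : (16%:E * davg vt y (2 * h n))%E @[n --> \oo] --> (16%:E * 0)%E.
    by apply: cvgeZl => //; exact: (cvg_comp _ _ h_cvg ly).
  rewrite mule0 in c1.
  have c2 : `|w n y - v y|%:E @[n --> \oo] --> (0:R)%:E.
    apply: (squeeze_cvge _ (cvg_cst 0%E) c1).
    by apply: nearW => n; rewrite lee_fin normr_ge0 w_davg.
  have c3 : (w n y - v y) @[n --> \oo] --> 0 by apply/norm_cvg0P; exact: (fine_cvg c2).
  by apply/subr_cvg0.
pose f n y := (w n y ^+ 2)%:E.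
have mf n : measurable_fun DX (f n) by apply/measurable_EFinP/measurable_funX.
have ae_lim : {ae mu, forall y, DX y -> ((v y ^+ 2)%:E <= limn_einf (f ^~ y))%E}.
  apply: filterS ae_cvg => y yw Dy.
  have c1 : f n y @[n --> \oo] --> (v y ^+ 2)%:E.
    by apply: cvg_EFin; [exact: nearW|apply: cvgM; exact: yw].
  rewrite is_cvg_limn_einfE; last by apply/cvg_ex; exists (v y ^+ 2)%:E.
  by rewrite (cvg_lim _ c1).
have f0 n y : DX y -> (0 <= f n y)%E by rewrite lee_fin sqr_ge0.
have einf0 (g : nat -> \bar R) : (forall n, 0 <= g n)%E -> (0 <= limn_einf g)%E.
  move=> g0; rewrite limn_einf_lim; apply: lime_ge; first exact: is_cvg_einfs.
  by apply: nearW => n; apply: le_ereal_inf_tmp => _ [k _ <-].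
have mlim : measurable_fun DX (fun y => limn_einf (f ^~ y)).
  rewrite /limn_einf; apply: measurableT_comp => //.
  apply: measurable_fun_limn_esup => n.
  by apply: measurableT_comp.
apply: (@le_trans _ _ (\int[mu]_(y in DX) limn_einf (f ^~ y))%E).
  apply: ae_ge0_le_integral => //.
  - by move=> y _; rewrite lee_fin sqr_ge0.
  - exact/measurable_EFinP/measurable_funX.
  - by move=> y Dy; apply: einf0 => n; exact: f0.
apply: (le_trans (@fatou _ _ R mu DX mDX f mf f0)).
rewrite limn_einf_lim; apply: lime_le; first exact: is_cvg_einfs.
apply: nearW => n; apply: (@le_trans _ _ (\int[mu]_(y in DX) f n y)%E).
  by apply: ereal_inf_lbound; exists n => /=.
have /is_L2P[_ Iw] := w_L2 n.
by rewrite /f EFin_Rint// lee_fin exprMn (_ : 8 ^+ 2 = 64); [exact: w_int|ring].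
Qed.

End density.

End kink_formula.

(** * Piecewise linear interpolation *)

Section partition.
Context {R : realType} (a b : R) (ab : a < b) (n : nat) (x : nat -> R).
Local Notation mu := (@lebesgue_measure R).
Let DX : set R := `]a, b[.
Hypotheses (x0 : x 0 = a) (xn : x n = b).
Hypothesis gx : forall i, (i < n)%N -> x i < x i.+1.
Implicit Types (U V : nat -> R) (u : R -> R).

Let mDX : measurable DX. Proof. exact: measurable_itv. Qed.
Let gl := grid_le gx.

Definition slope U i : R := (U i.+1 - U i) / (x i.+1 - x i).

(** Written as a [kL], with one pair of kinks per cell, so that the estimates on kinks apply to it
    directly. Since it vanishes at [a], it interpolates [U - U 0], that is [U] for functions
    satisfying the boundary condition. *)
Definition interpolant U : R -> R :=
  kL (fun i : 'I_n => slope U i) (fun i : 'I_n => x i) (fun i : 'I_n => x i.+1).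

Definition stiffness U V : R := \sum_(i < n) slope U i * (V i.+1 - V i).

Lemma slopeK U i : (i < n)%N -> slope U i * (x i.+1 - x i) = U i.+1 - U i.
Proof. by move=> iN; rewrite /slope divfK// subr_eq0 gt_eqF// gx. Qed.

Lemma node_itv i : (i <= n)%N -> a <= x i <= b.
Proof. by move=> iN; rewrite -x0 -xn !gl. Qed.

Lemma partition_gt0 : (0 < n)%N.
Proof. by case: n xn => // x0n; move: ab; rewrite -x0 -x0n ltxx. Qed.

(** Cells to the left of [y] contribute their full increments, which telescope; cells to the right
    contribute nothing. *)
Lemma interpolant_cell U i y : (i < n)%N -> x i <= y <= x i.+1 ->
  interpolant U y = U i - U 0 + slope U i * (y - x i).
Proof.
move=> iN /andP[y1 y2]; rewrite /interpolant /kL.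
rewrite -(big_mkord predT (fun j => slope U j * (pp (y - x j) - pp (y - x j.+1)))).
rewrite (@big_cat_nat _ _ _ i)//=; last exact: ltnW.
rewrite (@eq_big_nat _ _ _ 0%N i _ (fun j => U j.+1 - U j)); last first.
  move=> j /andP[_ ji]; have jn := ltn_trans ji iN.
  have xj := gl ji (ltnW iN); have := gx jn => ?.
  by rewrite /pp !max_l; try lra; rewrite -slopeK//; ring.
rewrite telescope_sumr// (big_ltn iN) big_nat big1 ?addr0.
  by rewrite /pp [Num.max (y - x i) 0]max_l ?[Num.max (y - _) 0]max_r; try lra; ring.
move=> j /andP[ij jn]; have := gl ij (ltnW jn); have := gx jn => ? ?.
by rewrite /pp !max_r; try lra; ring.
Qed.

Lemma interpolant_node U i : (i <= n)%N -> interpolant U (x i) = U i - U 0.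
Proof.
case: i => [_|i iN].
  by rewrite (@interpolant_cell _ 0) ?partition_gt0 ?lexx ?subrr ?mulr0 ?addr0// ltW// gx// partition_gt0.
by rewrite (@interpolant_cell _ i)// ?slopeK ?lexx ?andbT 1?ltW ?gx//; ring.
Qed.

Lemma interpolant_moment U : U 0 = 0 -> U n = 0 ->
  \sum_(i < n) slope U i * (x i.+1 - x i) = 0.
Proof.
move=> U0 Un; rewrite (eq_bigr (fun i : 'I_n => U i.+1 - U i)); last first.
  by move=> i _; rewrite slopeK.
rewrite -(big_mkord predT (fun i => U i.+1 - U i)) telescope_sumr//.
by rewrite U0 Un subrr.
Qed.

Lemma stiffness_kf U u :
  stiffness U (fun i => u (x i)) =
  - kf (fun i : 'I_n => slope U i) (fun i : 'I_n => x i) (fun i : 'I_n => x i.+1) u.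
Proof. by rewrite /kf -sumrN; apply: eq_bigr => i _; ring. Qed.

Lemma continuous_interpolant U : continuous (interpolant U).
Proof. exact: kL_continuous. Qed.

(** On each cell [z] is taken where the error is largest in absolute value. The square of the L^2
    norm is then at most the weighted sum of squared defects at these points, which [defect_bound]
    controls. *)
Lemma interpolation_error (C h : R) u : 0 <= C -> kink_bounded a b C u ->
  {within `[a, b], continuous u} -> u a = 0 ->
  (forall i, (i < n)%N -> x i.+1 - x i <= h) ->
  L2norm a b (fun y => u y - interpolant (fun i => u (x i)) y) <= C * h ^+ 2.
Proof.
move=> C0 uC cu ua hx; set I := interpolant _.
have cd : {within `[a, b], continuous (fun y => u y - I y)}.
  move=> y; apply: continuousB; first exact: cu.
  by apply: continuous_subspaceT; exact: continuous_interpolant.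
have dL := cont_L2 cd; have /is_L2P[_ Id] := dL.
have zex i : exists z, (i < n)%N -> x i <= z <= x i.+1 /\
    forall y, x i <= y <= x i.+1 -> `|u y - I y| <= `|u z - I z|.
  have [iN|iN] := boolP (i < n)%N; last by exists 0.
  have cdi : {within `[x i, x i.+1], continuous (fun y => `|u y - I y|)}.
    move=> y; apply: cvg_norm; apply: continuous_subspaceW cd y.
    move=> z /=; rewrite !in_itv/= => /andP[z1 z2].
    have /andP[? ?] := node_itv (ltnW iN); have /andP[? ?] := node_itv iN.
    by apply/andP; split; lra.
  have [z zi zmax] := EVT_max (ltW (gx iN)) cdi.
  exists z => _; split=> [|y yi]; first by move: zi; rewrite in_itv.
  by apply: zmax; rewrite in_itv.
have [z zP] := choice zex.
have zi i : (i < n)%N -> x i <= z i <= x i.+1 by move=> /zP[].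
have db := defect_bound C0 uC x0 xn gx zi hx.
have h0 : 0 <= h.
  have n0 := partition_gt0; rewrite (le_trans _ (hx 0%N n0))// subr_ge0 ltW// gx//.
rewrite -ler_sqr ?nnegrE ?L2norm_ge0 ?mulr_ge0 ?sqr_ge0//.
rewrite L2norm_sqE//; apply: le_trans db.
move: Id; rewrite -x0 -xn => Id; rewrite (Rint_grid gx Id).
apply: ler_sum => i _; have iN := ltn_ord i.
have [zi' zmax] := zP i iN.
have dE : u (z i) - ((x i.+1 - z i) * u (x i) + (z i - x i) * u (x i.+1)) / (x i.+1 - x i) =
    u (z i) - I (z i).
  rewrite /I (interpolant_cell _ iN zi') x0 ua /slope; field.
  by rewrite subr_eq0 gt_eqF// gx.
rewrite dE mulrC -Rint_cst_itv; last by rewrite ltW// gx.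
apply: le_Rint => //.
- apply: itgS Id => // y /=; rewrite !in_itv/= x0 xn => /andP[y1 y2].
  have /andP[? ?] := node_itv (ltnW iN); have /andP[? ?] := node_itv iN.
  by apply/andP; split; lra.
- apply: (@bnd_itg _ _ _ `|(u (z i) - I (z i)) ^+ 2|) => //.
  by apply: (@itv_fin _ _ (x i) (x i.+1)); exact: subset_itv_oo_cc.
- move=> y /=; rewrite in_itv/= => /andP[y1 y2].
  rewrite -(real_normK (num_real (u y - _))) -(real_normK (num_real (u (z i) - _))).
  by rewrite ler_sqr ?nnegrE ?normr_ge0// zmax// !ltW.
Qed.

(** Nothing is assumed at the nodes, where [derive1] of a piecewise linear function has no
    meaningful value; cells and nodes are therefore added one at a time. *)
Lemma itg_step (f : R -> R) (c : nat -> R) :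
  (forall i y, (i < n)%N -> x i < y < x i.+1 -> f y = c i) -> itg DX f.
Proof.
move=> fc; rewrite /DX -x0 -xn.
suff H k : (k <= n)%N -> measurable_fun `]x 0, x k[ f /\
    exists B, forall y, x 0 < y < x k -> `|f y| <= B.
  have [mf [B fB]] := H n (leqnn n).
  apply: (@bnd_itg _ _ _ B) => //.
  by apply: (@itv_fin _ _ (x 0) (x n)); exact: subset_itv_oo_cc.
elim: k => [_|k IH kn].
  rewrite set_itvoo0; split; first exact: measurable_fun_set0.
  by exists 0 => y /andP[/lt_trans H /H]; rewrite ltxx.
have [mf [B fB]] := IH (ltnW kn); have x0k := gl (leq0n k) (ltnW kn).
have xk := gx kn; split.
  have sub : `]x 0, x k.+1[%classic `<=` `]x 0, x k[%classic `|` ([set x k] `|` `]x k, x k.+1[%classic).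
    move=> y /=; rewrite !in_itv/= => /andP[y1 y2].
    have [yk|yk|yk] := ltgtP y (x k); first by left; rewrite y1.
      by right; right; rewrite y2.
    by right; left.
  apply: measurable_funS sub _.
    by apply: measurableU => //; exact: measurableU.
  apply/measurable_funU => //; first exact: measurableU.
  split=> //; apply/measurable_funU => //; split; first exact: measurable_fun_set1.
  apply: (@eq_measurable_fun _ _ _ _ _ (cst (c k))); last exact: measurable_cst.
  by move=> y /set_mem/=; rewrite in_itv/= => yk; rewrite (fc k).
exists (Num.max B (Num.max `|f (x k)| `|c k|)) => y /andP[y1 y2]; rewrite !le_max.
have [yk|yk|yk] := ltgtP y (x k); first by rewrite fB// y1.
  by rewrite (fc k) ?yk// lexx !orbT.
by rewrite yk lexx orbT.
Qed.

Definition cellwise_affine u : Prop :=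
  forall i, (i < n)%N -> exists c0 c1 : R, forall y : R, x i <= y <= x i.+1 -> u y = c0 + c1 * y.

Lemma cellwise_affineE u i y : cellwise_affine u -> (i < n)%N -> x i <= y <= x i.+1 ->
  u y = u (x i) + slope (fun i => u (x i)) i * (y - x i).
Proof.
move=> ua iN yi; have [c0 [c1 uE]] := ua i iN; have h := gx iN.
have h' := ltW h; rewrite /slope (uE _ yi) (uE (x i)) ?lexx// (uE (x i.+1)) ?lexx ?h'//.
by field; rewrite subr_eq0 gt_eqF.
Qed.

Lemma cellwise_affine_interpolant u y : cellwise_affine u -> u a = 0 ->
  a <= y <= b -> u y = interpolant (fun i => u (x i)) y.
Proof.
move=> ua u0; rewrite -{1}x0 -xn => /(grid_cell gx)/(_ partition_gt0)[i iN yi].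
by rewrite (cellwise_affineE ua iN yi) (interpolant_cell _ iN yi) x0 u0 subr0.
Qed.

Lemma interpolant_affine U : cellwise_affine (interpolant U).
Proof.
move=> i iN; exists (U i - U 0 - slope U i * x i), (slope U i) => y yi.
by rewrite (interpolant_cell _ iN yi); ring.
Qed.

Lemma cellwise_derive1 u i y : cellwise_affine u -> (i < n)%N ->
  x i < y < x i.+1 -> derive1 u y = slope (fun i => u (x i)) i.
Proof.
move=> ua iN /andP[y1 y2].
rewrite derive1E.
have E : \near y, u (x i) + slope (fun i => u (x i)) i * (y - x i) = u y.
  have : \forall z \near y, z \in `]x i, x i.+1[.
    by apply: near_in_itvoo; rewrite in_itv/= y1.
  apply: filterS => z; rewrite in_itv/= => /andP[z1 z2].
  by rewrite -(cellwise_affineE ua iN)// !ltW.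
rewrite -(near_eq_derive _ E) ?oner_neq0//.
have q : quad (fun z => u (x i) + slope (fun i => u (x i)) i * (z - x i)) y (slope (fun i => u (x i)) i).
  by exists 0 => h _; rewrite mul0r (_ : _ - _ - _ = 0) ?normr0//; ring.
by have [_ ->] := quad_derive q.
Qed.

Lemma Rint_gradients (I : Type) (r : seq I) (w : I -> R) (W : I -> R -> R) u :
  (forall j, cellwise_affine (W j)) -> cellwise_affine u ->
  L2inner a b (fun y => \sum_(j <- r) w j * derive1 (W j) y) (derive1 u) =
  \sum_(j <- r) w j * stiffness (fun i => u (x i)) (fun i => W j (x i)).
Proof.
move=> Wa ua; rewrite /L2inner.
pose c i := \sum_(j <- r) w j * slope (fun i => W j (x i)) i * slope (fun i => u (x i)) i.
have fc i y : (i < n)%N -> x i < y < x i.+1 ->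
    (\sum_(j <- r) w j * derive1 (W j) y) * derive1 u y = c i.
  move=> iN yi; rewrite (cellwise_derive1 ua iN yi) /c -mulr_suml; congr (_ * _).
  by apply: eq_bigr => j _; rewrite (cellwise_derive1 (Wa j) iN yi).
have := itg_step fc; rewrite /DX -x0 -xn => If.
rewrite (Rint_step gx If fc) /c /stiffness.
under eq_bigr do rewrite mulr_suml.
rewrite exchange_big /=; apply: eq_bigr => j _; rewrite mulr_sumr.
apply: eq_bigr => i _; have := slopeK (fun i => W j (x i)) (ltn_ord i) => <-; ring.
Qed.

End partition.

(** * Quadrature weights *)

Section hat_weights.
Context {R : realType} (tau : R) (K : R -> R).
Local Notation mu := (@lebesgue_measure R).
Hypothesis tau0 : 0 < tau.

Definition tnode (i : nat) : R := i%:R * tau.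

Lemma tnodeS i : tnode i.+1 = tnode i + tau.
Proof. by rewrite /tnode -natr1; ring. Qed.

Lemma tnode_lt i : tnode i < tnode i.+1.
Proof. by rewrite tnodeS ltrDl. Qed.

Lemma tnode_le i j : (i <= j)%N -> tnode i <= tnode j.
Proof. by move=> ij; rewrite ler_wpM2r ?ler_nat// ltW. Qed.

Lemma tnode_ge0 i : 0 <= tnode i.
Proof. by rewrite mulr_ge0// ltW. Qed.

Lemma tnode0 : tnode 0 = 0. Proof. by rewrite /tnode mul0r. Qed.

Lemma tnodeB i j : (j <= i)%N -> tnode (i - j) = tnode i - tnode j.
Proof. by move=> ij; rewrite /tnode natrB// mulrBl. Qed.

(** Normalized to height [tau], so that it is the length of the intersection of two intervals of
    length [tau]. *)
Definition hat (m : nat) (s : R) : R := pp (tau - `|s - tnode m|).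

Lemma hat_ge0 m s : 0 <= hat m s. Proof. exact: pp_ge0. Qed.

Lemma hat_le m s : hat m s <= tau.
Proof. by rewrite /hat ge_max gerBl normr_ge0 ltW. Qed.

Lemma continuous_hat m : continuous (hat m).
Proof.
move=> s; apply: (@continuous_comp _ _ _ (fun s => tau - `|s - tnode m|) (@pp R)).
  apply: cvgB; first exact: cvg_cst.
  by apply: cvg_norm; apply: cvgB; [exact: cvg_id|exact: cvg_cst].
exact: continuous_pp.
Qed.

Lemma Rint_cst_cc (c p q : R) : p <= q -> \int[mu]_(x in `[p, q]) c = c * (q - p).
Proof.
move=> pq; rewrite -Rint_oo_cc ?Rint_cst_itv//.
apply: (@bnd_itg _ _ _ `|c|) => //.
by apply: (@itv_fin _ _ p q); exact: subset_itv_oo_cc.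
Qed.

Lemma Rint_indic_cc (p q c d : R) :
  \int[mu]_(t in `[p, q]) \1_(`[c, d]%classic) t = pp (Num.min q d - Num.max p c).
Proof.
rewrite (@Rint_supp _ _ `[Num.max p c, Num.min q d])//; last 2 first.
- by move=> t /=; rewrite !in_itv/= ge_max le_min => /andP[/andP[-> _] /andP[-> _]].
- move=> t /= tpq nt; rewrite indicE memNset// => /= tcd; apply: nt; move: tpq tcd.
  by rewrite /= !in_itv/= ge_max le_min => /andP[-> ->] /andP[-> ->].
rewrite (@eq_Rint _ _ (cst 1)); last first.
  move=> t /=; rewrite in_itv/= ge_max le_min => /andP[/andP[_ t1] /andP[_ t2]].
  by rewrite indicE mem_set//= in_itv/= t1.
have [h|h] := leP (Num.max p c) (Num.min q d).
  by rewrite (Rint_cst_cc 1 h) mul1r /pp [Num.max _ 0]max_l// subr_ge0.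
by rewrite set_itv_ge ?bnd_simp -?ltNge// Rintegral_set0 /pp [Num.max _ 0]max_r// subr_le0 ltW.
Qed.

(** After the substitution [s = t - y], the order of integration is exchanged: for fixed [s], the
    admissible [t] form the intersection of [[t_(n-1), t_n]] with [[s + t_(j-1), s + t_j]], whose
    length is a hat centred at [t_(n-j)]. *)
Lemma weight_hat (n j : nat) : (0 < j)%N -> (j <= n)%N -> itg `[0, tnode n] K ->
  weight tau K n j = tau^-1 * \int[mu]_(s in `[0, tnode n]) (K s * hat (n - j) s).
Proof.
move=> j0 jn IK; rewrite /weight; congr (_ * _).
have n0 : (0 < n)%N := leq_trans j0 jn.
have pred k : (0 < k)%N -> k.-1%:R * tau = tnode k - tau.
  by case: k => // k _; rewrite tnodeS /tnode/=; ring.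
rewrite (pred n n0) (pred j j0) -/(tnode j) -/(tnode n).
pose A : set R := `[tnode n - tau, tnode n]%classic; pose B : set R := `[0, tnode n]%classic.
(* The condition [t_(j-1) <= t - s <= t_j]; the cut at [min t t_j] is taken care of by [s >= 0]. *)
pose S : set (R * R) := [set p | p.1 - tnode j <= p.2 <= p.1 - (tnode j - tau)].
have tj : 0 <= tnode j - tau.
  by rewrite -(pred j j0) mulr_ge0// ltW.
have tjn := tnode_le jn.
have S1 t s : \1_S (t, s) = \1_(`[t - tnode j, t - (tnode j - tau)]%classic) s :> R.
  by rewrite !indicE /S; congr (nat_of_bool _)%:R; apply/idP/idP => /set_mem h;
    apply/mem_set; move: h; rewrite /= in_itv.
have S2 t s : \1_S (t, s) = \1_(`[s + (tnode j - tau), s + tnode j]%classic) t :> R.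
  by rewrite !indicE /S; congr (nat_of_bool _)%:R; apply/idP/idP => /set_mem/=;
    rewrite ?in_itv/= => /andP[? ?]; apply/mem_set; rewrite /= ?in_itv/=; apply/andP; split; lra.
have mA : measurable A by exact: measurable_itv.
have mB : measurable B by exact: measurable_itv.
have inner t : A t ->
    \int[mu]_(y in `[tnode j - tau, Num.min t (tnode j)]) K (t - y) =
    \int[mu]_(s in B) (K s * \1_S (t, s)).
  rewrite /A /= in_itv/= => /andP[t1 t2].
  rewrite (@Rint_supp _ B `[t - Num.min t (tnode j), t - (tnode j - tau)])//; last 2 first.
  - move=> s /=; rewrite /B /= !in_itv/= => /andP[s1 s2].
    have : Num.min t (tnode j) <= t by rewrite ge_min lexx.
    by move=> ?; apply/andP; split; lra.
  - move=> s; rewrite /B /= !in_itv/= => /andP[s1 s2] ns.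
    rewrite indicE memNset ?mulr0//= => /andP[s3 s4]; apply: ns.
    move: s3 s4 => /= s3 s4; rewrite s4 andbT; case: (leP t (tnode j)) => h; lra.
  have Is : itg `[t - Num.min t (tnode j), t - (tnode j - tau)] K.
    apply: itgS IK => // s /=; rewrite !in_itv/= => /andP[s1 s2].
    have : Num.min t (tnode j) <= t by rewrite ge_min lexx.
    by move=> ?; apply/andP; split; lra.
  rewrite -[X in `[X, _]](subKr t) -[X in `[_, X]](subKr t) (Rint_reflect t Is).
  apply: eq_Rint => s /=; rewrite in_itv/= => /andP[s1 s2].
  rewrite indicE mem_set ?mulr1//=; apply/andP; split=> //.
  have : Num.min t (tnode j) <= tnode j by rewrite ge_min lexx orbT.
  by move=> /= ?; lra.
rewrite (eq_Rint inner).
have mS : measurable S.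
  pose g1 (p : R * R) : R := p.2 - p.1 + tnode j.
  pose g2 (p : R * R) : R := p.1 - (tnode j - tau) - p.2.
  have cf : continuous (fst : R * R -> R) by move=> p; exact: cvg_fst.
  have cs : continuous (snd : R * R -> R) by move=> p; exact: cvg_snd.
  have m1 : measurable_fun setT g1.
    apply: continuous2_measurable => p; apply: cvgD; last exact: cvg_cst.
    by apply: cvgB; [exact: cs|exact: cf].
  have m2 : measurable_fun setT g2.
    apply: continuous2_measurable => p; apply: cvgB; last exact: cs.
    by apply: cvgB; [exact: cf|exact: cvg_cst].
  rewrite (_ : S = (g1 @^-1` `[0, +oo[) `&` (g2 @^-1` `[0, +oo[)).
    apply: measurableI.
      by rewrite -[X in measurable X]setTI; apply: m1 => //; exact: measurable_itv.
    by rewrite -[X in measurable X]setTI; apply: m2 => //; exact: measurable_itv.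
  apply/seteqP; split=> [[t s]|[t s] []] /=; rewrite /S /g1 /g2 /= !in_itv/= !andbT.
    by move=> /andP[? ?]; split; lra.
  by move=> ? ?; apply/andP; split; lra.
pose h t s := K s * \1_S (t, s).
have mh : measurable_fun (A `*` B) (fun p : R * R => h p.1 p.2).
  apply: measurable_funM; last first.
    rewrite (_ : (fun _ => _) = (\1_S : R * R -> R)); last by apply/funext => -[].
    by apply: measurable_funTS; exact: measurable_indic.
  have mK : measurable_fun setT (K \_ B).
    by apply/(measurable_restrictT _ _).1 => //; exact: itg_meas.
  apply: (@eq_measurable_fun _ _ _ _ _ ((K \_ B) \o snd)).
    by move=> [t s] /set_mem[_ /= Bs]; rewrite patchE mem_set.
  by apply: measurable_funTS; apply: measurableT_comp.
pose k := cst (\int[mu]_(s in B) `|K s|) : R -> R.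
have Ik : itg A k.
  apply: (@bnd_itg _ _ _ `|\int[mu]_(s in B) `|K s| |) => //.
    exact: (@itv_fin _ _ (tnode n - tau) (tnode n)).
  exact: measurable_cst.
have hk : {ae mu, forall t, A t -> (\int[mu]_(s in B) `|h t s|%:E <= (k t)%:E)%E}.
  apply: aeW => t At; rewrite /k /= -EFin_Rint//; last exact: itg_norm.
  apply: ge0_le_integral => //.
  - apply/measurable_EFinP; apply: measurableT_comp => //.
    rewrite /h; under eq_fun do rewrite S1.
    by apply: measurable_funM; [exact: itg_meas|exact: measurable_indic].
  - by apply/measurable_EFinP; apply: itg_meas; exact: itg_norm.
  - move=> s _; rewrite lee_fin normrM ler_piMr// indicE.
    by case: (_ \in _); rewrite ?normr1 ?normr0.
have [_ _ _ ->] := Rfubini mA mB mh Ik hk.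
apply: eq_Rint => s Bs; rewrite /h RintZ//; last first.
  apply: (@bnd_itg _ _ _ 1) => //.
  - exact: (@itv_fin _ _ (tnode n - tau) (tnode n)).
  - by under eq_fun do rewrite S2; exact: measurable_indic.
  - by move=> t _; rewrite indicE; case: (_ \in _); rewrite ?normr1 ?normr0.
congr (_ * _).
rewrite (eq_Rint (fun t _ => S2 t s)).
rewrite Rint_indic_cc /hat tnodeB//; congr pp.
have [x1|x1] := leP (tnode n) (s + tnode j).
  rewrite max_r; last lra.
  rewrite ger0_norm; lra.
rewrite max_l; last lra.
rewrite ltr0_norm; lra.
Qed.

Lemma hat_le_indic m s :
  hat m s <= tau * \1_(`[tnode m - tau, tnode m + tau]%classic) s.
Proof.
have t0 := tau0.
rewrite indicE; case: (boolP (_ \in _)) => [_|/negP h]; first by rewrite mulr1 hat_le.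
rewrite mulr0 /hat /pp ge_max lexx andbT subr_le0.
have : ~ (tnode m - tau <= s <= tnode m + tau).
  by move=> hs; apply: h; apply/mem_set; rewrite /= in_itv.
move/negP; rewrite negb_and -!ltNge => /orP[hs|hs].
  by rewrite ltr0_norm; lra.
by rewrite gtr0_norm; lra.
Qed.

Lemma itg_mul_hat (A : set R) m : measurable A -> itg A K -> itg A (fun s => K s * hat m s).
Proof.
move=> mA IK; apply: (@bnd_mul_itg _ _ _ _ tau) => //.
  by apply: measurable_funTS; apply: continuous_measurable_fun; exact: continuous_hat.
by move=> s _; rewrite ger0_norm ?hat_ge0 ?hat_le.
Qed.

(** The hat is at most [tau] on a window of length [2 * tau], and the weight carries a factor
    [tau^-1]. *)
Lemma weight_bounded (B : R) (n j : nat) : (0 < j)%N -> (j <= n)%N ->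
  itg `[0, tnode n] K -> (forall s, 0 <= s <= tnode n -> `|K s| <= B) ->
  `|weight tau K n j| <= 2 * B * tau.
Proof.
move=> j0 jn IK KB; rewrite weight_hat// normrM gtr0_norm ?invr_gt0//.
have B0 : 0 <= B by apply: le_trans (KB 0 _); rewrite ?lexx ?tnode_ge0.
rewrite ler_pdivrMl//; set m := (n - j)%N.
pose E := `[tnode m - tau, tnode m + tau]%classic : set R.
apply: (@le_trans _ _ (\int[mu]_(s in `[0, tnode n]) (B * tau * \1_E s))).
  apply: norm_Rint_le => //.
  - exact: itg_mul_hat.
  - apply: itgZ => //; apply: (@bnd_itg _ _ _ 1) => //.
    + exact: (@itv_fin _ _ 0 (tnode n)).
    + by apply: measurable_indic; exact: measurable_itv.
    + by move=> s _; rewrite indicE; case: (_ \in _); rewrite ?normr1 ?normr0.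
  - apply: aeW => s /=; rewrite in_itv/= => sn; rewrite normrM.
    rewrite -mulrA ler_pM ?KB// ger0_norm ?hat_ge0//; exact: hat_le_indic.
rewrite RintZ//; last first.
  apply: (@bnd_itg _ _ _ 1) => //.
  + exact: (@itv_fin _ _ 0 (tnode n)).
  + by apply: measurable_indic; exact: measurable_itv.
  + by move=> s _; rewrite indicE; case: (_ \in _); rewrite ?normr1 ?normr0.
rewrite Rint_indic_cc.
have : pp (Num.min (tnode n) (tnode m + tau) - Num.max 0 (tnode m - tau)) <= 2 * tau.
  rewrite /pp ge_max mulr_ge0 ?(ltW tau0)// andbT.
  have h1 : Num.min (tnode n) (tnode m + tau) <= tnode m + tau by rewrite ge_min lexx orbT.
  have h2 : tnode m - tau <= Num.max 0 (tnode m - tau) by rewrite le_max lexx orbT.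
  lra.
have Bt : 0 <= B * tau by rewrite mulr_ge0// ltW.
move=> /(ler_wpM2l Bt) h; apply: le_trans h _.
by rewrite le_eqVlt; apply/orP; left; apply/eqP; ring.
Qed.

Lemma hat_far m k s : (m < k)%N -> tnode k <= s -> hat m s = 0.
Proof.
have t0 := tau0; move=> mk ks; have := tnode_le mk; rewrite tnodeS => h.
by rewrite /hat /pp max_r// ger0_norm; lra.
Qed.

Lemma hat_near m k s : (k < m)%N -> s <= tnode k -> hat m s = 0.
Proof.
have t0 := tau0; move=> mk ks; have := tnode_le mk; rewrite tnodeS => h.
by rewrite /hat /pp max_r// ler0_norm; lra.
Qed.

(** At most two hats are nonzero on a cell. The sum omits the hat centred at [t_n], whose
    coefficient would be [g 0]; the condition [g 0 = 0] covers the last cell. *)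
Lemma hat_cell (n k : nat) (s : R) (g : nat -> R) : (k < n)%N ->
  tnode k <= s <= tnode k.+1 -> g 0%N = 0 ->
  \sum_(m < n) hat m s * g (n - m)%N =
  (tnode k.+1 - s) * g (n - k)%N + (s - tnode k) * g (n - k.+1)%N.
Proof.
have t0 := tau0; move=> kn /andP[s1 s2] g0; have := tnodeS k => tS.
transitivity (\sum_(m < n.+1) hat m s * g (n - m)%N).
  by rewrite big_ord_recr /= subnn g0 mulr0 addr0.
rewrite -(big_mkord predT (fun m => hat m s * g (n - m)%N)).
rewrite (@big_cat_nat _ _ _ k)//=; last exact: leqW (ltnW kn).
rewrite big_nat big1 ?add0r; last by move=> m /andP[_ mk]; rewrite (hat_far mk s1) mul0r.
rewrite big_ltn; last exact: leqW.
rewrite big_ltn ?ltnS// big_nat big1 ?addr0; last first.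
  by move=> m /andP[mk _]; rewrite (hat_near mk s2) mul0r.
have -> : hat k s = tnode k.+1 - s.
  by rewrite /hat /pp (_ : `|s - tnode k| = s - tnode k) ?max_l ?ger0_norm; lra.
have -> // : hat k.+1 s = s - tnode k.
by rewrite /hat /pp (_ : `|s - tnode k.+1| = tnode k.+1 - s) ?max_l ?ler0_norm; lra.
Qed.

Lemma hat_sum_le (n : nat) (s : R) : (0 < n)%N -> 0 <= s <= tnode n ->
  \sum_(m < n) hat m s <= tau.
Proof.
move=> n0 sn; have [|k kn sk] := grid_cell (x := tnode) (n := n) (fun i _ => tnode_lt i) (y := s) _ n0.
  by rewrite tnode0.
pose g (j : nat) : R := (j != 0)%:R.
rewrite (eq_bigr (fun m : 'I_n => hat m s * g (n - m)%N)); last first.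
  by move=> m _; rewrite /g subn_eq0 -ltnNge ltn_ord mulr1.
rewrite (hat_cell kn sk)//; have := tnodeS k => tS; move/andP: sk => [s1 s2].
by rewrite /g; case: (_ != _); case: (_ != _); rewrite /= ?mulr1 ?mulr0; lra.
Qed.

Lemma big_nat_sub (n : nat) (F : nat -> R) :
  \sum_(1 <= j < n.+1) F j = \sum_(m < n) F (n - m)%N.
Proof.
rewrite big_nat_rev /= big_add1 big_mkord; apply: eq_bigr => m _.
by rewrite add1n !subSS.
Qed.

(** The inner sum divided by [tau] is, at time [t_n - s], the piecewise linear interpolant of the
    values [g j] with value 0 at time 0. *)
Lemma weight_conv (n : nat) (g : nat -> R) : itg `[0, tnode n] K ->
  \sum_(1 <= j < n.+1) weight tau K n j * g j =
  \int[mu]_(s in `[0, tnode n]) (K s * (tau^-1 * \sum_(m < n) hat m s * g (n - m)%N)).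
Proof.
move=> IK; rewrite (big_nat_sub n (fun j => weight tau K n j * g j)).
have Ih m : itg `[0, tnode n] (fun s => tau^-1 * g (n - m)%N * (K s * hat m s)).
  by apply: itgZ => //; exact: itg_mul_hat.
rewrite (@eq_Rint _ _ (fun s => \sum_(m < n) tau^-1 * g (n - m)%N * (K s * hat m s))).
  rewrite Rint_sum//; apply: eq_bigr => m _.
  rewrite weight_hat ?subn_gt0 ?leq_subr// subKn; last exact/ltnW.
  by rewrite RintZ//; [ring|exact: itg_mul_hat].
by move=> s _; rewrite !mulr_sumr; apply: eq_bigr => m _; ring.
Qed.

(** The size, in units of [M * tau^al], of the interpolation defect on the time cell
    [[t_i, t_(i+1)]]. *)
Definition cusp_coef (al : R) (i : nat) : R :=
  if i == 0%N then 2 / al else i%:R `^ (al - 2).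

Lemma cusp_coef_ge0 al i : 0 < al -> 0 <= cusp_coef al i.
Proof. by move=> al0; rewrite /cusp_coef; case: ifP => _; rewrite ?powR_ge0// divr_ge0// ltW. Qed.

(** On the first cell, function and interpolant are both bounded by [M / al * tau^al]. On the
    others, the second difference bound with [p = t_i] gives [M (i tau)^(al-2) tau^2]. The index
    [n - k.+1] is that of the cell containing [t_n - s]. *)
Lemma cusp_defect (T al M : R) (G : R -> R) (n k : nat) (s : R) :
  0 < al -> 0 <= M -> cusp_bound T al M G -> tnode n <= T -> (k < n)%N ->
  tnode k < s < tnode k.+1 ->
  `|G (tnode n - s) - tau^-1 * \sum_(m < n) hat m s * G (tnode (n - m))| <=
  M * tau `^ al * cusp_coef al (n - k.+1).
Proof.
move=> al0 M0 [G1 G2] nT kn /andP[s1 s2].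
have G0 : G (tnode 0) = 0.
  rewrite tnode0; apply/eqP; rewrite -normr_le0; apply: le_trans (G1 0 _) _.
    by rewrite lexx (le_trans (tnode_ge0 n)).
  by rewrite powR0 ?mulr0// gt_eqF.
rewrite (@hat_cell n k s (fun j => G (tnode j)))//; last by rewrite !ltW.
have tS := tnodeS k; have nk := tnode_le kn; have k0 := tnode_ge0 k.
have e1 : tnode (n - k) = tnode n - tnode k by rewrite tnodeB// ltnW.
have e2 : tnode (n - k.+1) = tnode n - tnode k.+1 by rewrite tnodeB.
set z := tnode n - s.
have ez1 : tnode k.+1 - s = z - tnode (n - k.+1) by rewrite e2 /z; ring.
have ez2 : s - tnode k = tnode (n - k) - z by rewrite e1 /z; ring.
have i1 : tnode (n - k) - tnode (n - k.+1) = tau by rewrite e1 e2 tS; ring.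
have zl : tnode (n - k.+1) < z by rewrite e2 /z; lra.
have zr : z < tnode (n - k) by rewrite e1 /z; lra.
have rT : tnode (n - k) <= T by rewrite e1; lra.
rewrite ez1 ez2 /cusp_coef; case: eqP => [i0|/eqP i0].
  rewrite i0 G0 mulr0 addr0 tnode0 subr0 in zl *.
  rewrite i0 tnode0 subr0 in i1; rewrite i1 in zr rT *.
  have h1 : `|G z| <= M / al * tau `^ al.
    apply: le_trans (G1 z _) _; first by apply/andP; split; lra.
    rewrite ler_wpM2l ?divr_ge0// ?(ltW al0)//.
    by apply: ge0_ler_powR; rewrite ?nnegrE; lra.
  have h2 : `|tau^-1 * (z * G tau)| <= M / al * tau `^ al.
    rewrite mulrA normrM -[leRHS]mul1r ler_pM//.
      by rewrite ger0_norm ?mulr_ge0 ?invr_ge0 ?ler_pdivrMl ?mulr1; lra.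
    by apply: G1; apply/andP; split; lra.
  rewrite (le_trans (ler_normB _ _))//.
  have -> : M * tau `^ al * (2 / al) = M / al * tau `^ al + M / al * tau `^ al.
    by field; rewrite gt_eqF.
  exact: lerD.
have ip : 0 < (n - k.+1)%:R :> R by rewrite ltr0n lt0n.
have tp : 0 < tnode (n - k.+1) by rewrite mulr_gt0.
have H := G2 _ _ _ tp zl zr rT; rewrite i1 in H.
rewrite distrC [tau^-1 * _]mulrC [X in X / tau]addrC; apply: le_trans H _.
rewrite /tnode powRM ?ler0n ?(ltW tau0)// le_eqVlt; apply/orP; left; apply/eqP.
have -> : tau `^ al = tau `^ (al - 2) * tau ^+ 2.
  by rewrite -powR_mulrn ?(ltW tau0)// -powRD ?subrK// gt_eqF ?implybT.
ring.
Qed.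

(** Reversing time in the convolution places the singularities of kernel and function at opposite
    ends: the kernel cell [k] meets the function cell [n - k.+1], and the error is a discrete
    convolution. *)
Lemma conv_truncation (T al M : R) (G : R -> R) (n : nat) :
  0 < al -> 0 <= M -> cusp_bound T al M G -> {within `[0, T], continuous G} ->
  tnode n <= T -> itg `[0, tnode n] K ->
  `|time_conv K G (tnode n) - \sum_(1 <= j < n.+1) weight tau K n j * G (tnode j)| <=
  M * tau `^ al * \sum_(k < n) cusp_coef al (n - k.+1) *
    \int[mu]_(s in `]tnode k, tnode k.+1[) `|K s|.
Proof.
move=> al0 M0 GM cG nT IK.
have n0 := tnode_ge0 n.
have cG' : {within `[0, tnode n], continuous G}.
  apply: continuous_subspaceW cG => s /=; rewrite !in_itv/= => /andP[s0 sn].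
  by apply/andP; split; lra.
have mG : measurable_fun `[0, tnode n] G by apply: itg_meas; exact: itg_cont.
have IG : itg `[0, tnode n] (fun s => G (tnode n - s)).
  by have := itg_reflect (tnode n) (itg_cont cG'); rewrite subrr subr0.
have [BG BG0 GB] := cont_bounded cG'.
have IKG : itg `[0, tnode n] (fun s => K s * G (tnode n - s)).
  apply: (@bnd_mul_itg _ _ _ _ BG) => //; first exact: itg_meas.
  by move=> s /=; rewrite in_itv/= => /andP[? ?]; apply: GB; apply/andP; split; lra.
have -> : time_conv K G (tnode n) = \int[mu]_(s in `[0, tnode n]) (K s * G (tnode n - s)).
  rewrite /time_conv.
  have := Rint_reflect (tnode n) IKG; rewrite subrr subr0 => <-.
  by apply: eq_Rint => s _; rewrite subKr.
rewrite (weight_conv (fun j => G (tnode j)) IK).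
have IS : itg `[0, tnode n] (fun s => K s * (tau^-1 * \sum_(m < n) hat m s * G (tnode (n - m)))).
  apply: (@eq_itg _ _ (fun s => \sum_(m < n) (tau^-1 * G (tnode (n - m)) * (K s * hat m s)))) => //.
    by move=> s _; rewrite !mulr_sumr; apply: eq_bigr => m _; ring.
  by apply: itg_sum => // m; apply: itgZ => //; exact: itg_mul_hat.
rewrite -RintB// -Rint_oo_cc; last by apply: itg_oo_cc; exact: itgB.
have Iabs := itg_norm (itg_oo_cc (itgB (measurable_itv _) IKG IS)).
apply: le_trans (le_normr_Rintegral _ _) _ => //.
  by apply: itg_oo_cc; exact: itgB.
rewrite -[X in `]X, _[]tnode0 in Iabs *.
rewrite (Rint_grid (fun i _ => tnode_lt i) Iabs) mulr_sumr; apply: ler_sum => k _.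
have kn := ltn_ord k.
have sub : `]tnode k, tnode k.+1[%classic `<=` (`[0, tnode n]%classic : set R).
  move=> s /=; rewrite !in_itv/= => /andP[s1 s2].
  have := tnode_ge0 k; have := tnode_le kn => *; apply/andP; split; lra.
have IKk : itg `]tnode k, tnode k.+1[ K by apply: itgS IK.
rewrite mulrA -RintZ//; last exact: itg_norm.
apply: le_Rint => //.
- apply: itgS Iabs => // s /=; rewrite !in_itv/= => /andP[s1 s2].
  have := tnode_le kn; have := tnode_le (leq0n k) => *; apply/andP; split; lra.
- by apply: itgZ => //; exact: itg_norm.
move=> s /=; rewrite in_itv/= => sk; rewrite -mulrBr normrM mulrC ler_wpM2r//.
exact: (cusp_defect al0 M0 GM nT kn sk).
Qed.

End hat_weights.

(** * Discrete convolutions *)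

Section sequences.
Context {R : realType}.
Implicit Types (A a phi : nat -> R) (S : R).

(** Expansion of the nonnegative sum of the [A i * (y i - t)^2] at [t = P / S], where the total
    weight may be replaced by its bound [S]. *)
Lemma weighted_CauchySchwarz (I : Type) (r : seq I) (A y : I -> R) S :
  (forall i, 0 <= A i) -> \sum_(i <- r) A i <= S -> 0 < S ->
  (\sum_(i <- r) A i * y i) ^+ 2 <= S * \sum_(i <- r) A i * y i ^+ 2.
Proof.
move=> A0 AS S0; set P := \sum_(i <- r) A i * y i; set Q := \sum_(i <- r) _.
pose t := P / S.
have : 0 <= \sum_(i <- r) A i * (y i - t) ^+ 2.
  by apply: sumr_ge0 => i _; rewrite mulr_ge0 ?sqr_ge0.
have -> : \sum_(i <- r) A i * (y i - t) ^+ 2 = Q - 2 * t * P + t ^+ 2 * \sum_(i <- r) A i.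
  rewrite /Q /P !mulr_sumr -sumrB -big_split /=; apply: eq_bigr => i _; ring.
move=> h.
have : 0 <= Q - 2 * t * P + t ^+ 2 * S.
  by apply: le_trans h _; rewrite lerD2l ler_wpM2l ?sqr_ge0.
have -> : Q - 2 * t * P + t ^+ 2 * S = (S * Q - P ^+ 2) / S by rewrite /t; field; rewrite gt_eqF.
by rewrite pmulr_lge0 ?invr_gt0// subr_ge0.
Qed.

(** Young's inequality for the convolution of l^1 with l^2: the weighted Cauchy-Schwarz inequality
    for each [n], then exchange of the two sums. *)
Lemma young_sum (N : nat) A (kap : nat -> R) S :
  (forall i, 0 <= A i) -> \sum_(i < N) A i <= S -> 0 < S ->
  \sum_(n < N) (\sum_(k < n.+1) A (n - k)%N * kap k) ^+ 2 <=
  S ^+ 2 * \sum_(k < N) kap k ^+ 2.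
Proof.
move=> A0 AS S0.
have sub m : (m <= N)%N -> \sum_(i < m) A i <= S.
  move=> mN; apply: le_trans AS; rewrite -!(big_mkord predT A).
  by rewrite (@big_cat_nat _ _ _ m 0 N)//= lerDl sumr_ge0.
apply: (@le_trans _ _ (\sum_(n < N) S * \sum_(k < n.+1) A (n - k)%N * kap k ^+ 2)).
  apply: ler_sum => n _; apply: weighted_CauchySchwarz => //.
  apply: le_trans (sub n.+1 (ltn_ord n)).
  by rewrite (reindex_inj rev_ord_inj) /=; apply: ler_sum => i _; rewrite subSS subKn// -ltnS.
rewrite -mulr_sumr expr2 -mulrA ler_wpM2l ?(ltW S0)//.
pose F (n k : nat) : R := if (k <= n)%N then A (n - k)%N * kap k ^+ 2 else 0.
have -> : \sum_(n < N) \sum_(k < n.+1) A (n - k)%N * kap k ^+ 2 = \sum_(n < N) \sum_(k < N) F n k.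
  apply: eq_bigr => n _; rewrite (big_ord_widen N (fun k => A (n - k)%N * kap k ^+ 2)) ?ltn_ord//.
  by rewrite big_mkcond.
rewrite exchange_big mulr_sumr /=; apply: ler_sum => k _.
rewrite -(big_mkord predT (F^~ k)) (@big_cat_nat _ _ _ k)//=; last exact/ltnW.
rewrite big_nat big1 ?add0r; last by move=> n /andP[_ nk]; rewrite /F leqNgt nk.
rewrite -{1}[nat_of_ord k]add0n big_addn big_mkord.
apply: (@le_trans _ _ (\sum_(i < N - k) A i * kap k ^+ 2)).
  by apply: ler_sum => i _; rewrite /F leq_addl addnK.
by rewrite -mulr_suml ler_wpM2r ?sqr_ge0// sub// leq_subr.
Qed.

Lemma sum_window (M p q : nat) : (q <= M)%N ->
  \sum_(i < M) ((p <= i) && (i < q))%N%:R = (q - p)%N%:R :> R.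
Proof.
move=> qM; rewrite -natr_sum; congr (_%:R).
elim: M q qM => [|M IH] q; first by rewrite leqn0 => /eqP ->; rewrite big_ord0.
rewrite big_ord_recr /= leq_eqVlt ltnS => /predU1P[->|qM].
  rewrite ltnSn andbT (eq_bigr (fun i : 'I_M => ((p <= i) && (i < M))%N : nat)); last first.
    by move=> i _; have := ltn_ord i; lia.
  by rewrite IH//; case: leqP => pM /=; lia.
by rewrite IH// [(M < q)%N]ltnNge qM andbF addn0.
Qed.

Definition ndist (n j : nat) : nat := maxn n j - minn n j.

(* The hat kernel is the autocorrelation of a window of length k. *)
Lemma hat_kernel_ge0 (N k : nat) phi :
  0 <= \sum_(n < N) \sum_(j < N) (k - ndist n j)%N%:R * (phi n * phi j).
Proof.
pose win (n i : nat) : R := ((n <= i) && (i < n + k))%N%:R.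
have -> : \sum_(n < N) \sum_(j < N) (k - ndist n j)%N%:R * (phi n * phi j) =
    \sum_(i < N + k) (\sum_(n < N) win n i * phi n) ^+ 2.
  rewrite (eq_bigr (fun n : 'I_N => \sum_(j < N) \sum_(i < N + k) (win n i * phi n) * (win j i * phi j))); last first.
    move=> n _; apply: eq_bigr => j _.
    have h : (minn n j + k <= N + k)%N by rewrite leq_add2r (leq_trans (geq_minl _ _))// ltnW.
    have -> : (k - ndist n j)%N = (minn n j + k - maxn n j)%N by rewrite /ndist; lia.
    rewrite -(sum_window _ h) mulr_suml; apply: eq_bigr => i _.
    have -> : (((maxn n j <= i) && (i < minn n j + k))%N%:R : R) = win n i * win j i.
      rewrite /win -natrM mulnb; congr ((nat_of_bool _)%:R); lia.
    ring.
  rewrite exchange_big /=.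
  under eq_bigr do rewrite exchange_big /=.
  rewrite exchange_big /=; apply: eq_bigr => i _.
  rewrite expr2 mulr_suml; rewrite exchange_big /=; apply: eq_bigr => n _.
  by rewrite mulr_sumr; apply: eq_bigr => j _; ring.
by apply: sumr_ge0 => i _; exact: sqr_ge0.
Qed.

(** Summation by parts, done twice. For a nonnegative, nonincreasing convex sequence it is a
    nonnegative combination of a constant and truncated linear kernels. *)
Lemma convex_decomposition A (L m : nat) : (m <= L.+1)%N ->
  A m = A L.+1 + (A L - A L.+1) * (L.+1 - m)%N%:R +
    \sum_(k < L) (A k - 2 * A k.+1 + A k.+2) * (k.+1 - m)%N%:R.
Proof.
elim: L => [|L IH].
  by case: m => [|[|]]// _; rewrite big_ord0 ?subn0 ?subnn; ring.
rewrite leq_eqVlt => /predU1P[->|mL].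
  rewrite subnn big1; first by ring.
  by move=> k _; rewrite (_ : _ - _ = 0)%N ?mulr0//; apply/eqP; rewrite subn_eq0; have := ltn_ord k; lia.
rewrite ltnS in mL; rewrite [LHS](IH mL) big_ord_recr /= (subSn mL) -natr1; ring.
Qed.

(* Polya's criterion for Toeplitz matrices, proved as Fejer did. *)
Lemma convex_toeplitz_ge0 A (N : nat) phi :
  (forall k, 0 <= A k) -> (forall k, A k.+1 <= A k) ->
  (forall k, 0 <= A k - 2 * A k.+1 + A k.+2) ->
  0 <= \sum_(n < N) \sum_(j < N) A (ndist n j) * (phi n * phi j).
Proof.
move=> A0 Adec Aconv.
pose D k := \sum_(n < N) \sum_(j < N) (k - ndist n j)%N%:R * (phi n * phi j).
have -> : \sum_(n < N) \sum_(j < N) A (ndist n j) * (phi n * phi j) =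
    A N.+1 * (\sum_(n < N) phi n) ^+ 2 + (A N - A N.+1) * D N.+1 +
    \sum_(k < N) (A k - 2 * A k.+1 + A k.+2) * D k.+1.
  transitivity (\sum_(n < N) \sum_(j < N) (A N.+1 * (phi n * phi j) +
    (A N - A N.+1) * ((N.+1 - ndist n j)%N%:R * (phi n * phi j)) +
    \sum_(k < N) (A k - 2 * A k.+1 + A k.+2) * ((k.+1 - ndist n j)%N%:R * (phi n * phi j)))).
    apply: eq_bigr => n _; apply: eq_bigr => j _.
    have d : (ndist n j <= N.+1)%N by rewrite /ndist; have := ltn_ord n; have := ltn_ord j; lia.
    rewrite [in LHS](convex_decomposition A d).
    rewrite 2!mulrDl mulr_suml; congr (_ + _ + _); first by ring.
    by apply: eq_bigr => k _; ring.
  under eq_bigr do rewrite 2!big_split /=.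
  rewrite 2!big_split /=; congr (_ + _ + _).
  - rewrite expr2 mulr_suml mulr_sumr; apply: eq_bigr => n _.
    by rewrite mulr_sumr mulr_sumr.
  - by rewrite mulr_sumr; apply: eq_bigr => n _; rewrite mulr_sumr.
  - under eq_bigr do rewrite exchange_big /=.
    rewrite exchange_big /=; apply: eq_bigr => k _.
    by rewrite mulr_sumr; apply: eq_bigr => n _; rewrite mulr_sumr.
apply: addr_ge0; last first.
  by apply: sumr_ge0 => k _; rewrite mulr_ge0// hat_kernel_ge0.
apply: addr_ge0; first by rewrite mulr_ge0 ?sqr_ge0.
by rewrite mulr_ge0 ?subr_ge0 ?hat_kernel_ge0.
Qed.

(** A lower triangular form is half of the symmetric one whose diagonal is doubled, since the
    diagonal occurs only once in the triangle; hence [2 * a 0] in the conditions on the first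
    terms. *)
Lemma toeplitz_lower_ge0 a (N : nat) phi :
  (forall k, 0 <= a k) -> a 1 <= 2 * a 0 -> (forall k, a k.+2 <= a k.+1) ->
  0 <= 2 * a 0 - 2 * a 1 + a 2 -> (forall k, 0 <= a k.+1 - 2 * a k.+2 + a k.+3) ->
  0 <= \sum_(n < N) \sum_(j < n.+1) a (n - j)%N * (phi j * phi n).
Proof.
move=> a0 a01 adec aconv0 aconv.
pose A k := if k is 0%N then 2 * a 0%N else a k.
suff -> : \sum_(n < N) \sum_(j < n.+1) a (n - j)%N * (phi j * phi n) =
    2^-1 * \sum_(n < N) \sum_(j < N) A (ndist n j) * (phi n * phi j).
  rewrite mulr_ge0 ?invr_ge0//; apply: convex_toeplitz_ge0.
  - by case=> [|k] /=; rewrite ?mulr_ge0.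
  - by case.
  - by case.
pose F (n j : nat) : R := if (j <= n)%N then a (n - j)%N * (phi j * phi n) else 0.
have FE (n : 'I_N) : \sum_(j < n.+1) a (n - j)%N * (phi j * phi n) = \sum_(j < N) F n j.
  rewrite (big_ord_widen N (fun j => a (n - j)%N * (phi j * phi n))) ?ltn_ord//.
  by rewrite big_mkcond.
rewrite (eq_bigr (fun n : 'I_N => \sum_(j < N) F n j)); last by move=> n _; exact: FE.
have -> : \sum_(n < N) \sum_(j < N) A (ndist n j) * (phi n * phi j) =
    \sum_(n < N) \sum_(j < N) (F n j + F j n).
  apply: eq_bigr => n _; apply: eq_bigr => j _; rewrite /F.
  have [nj|nj|nj] := ltngtP (nat_of_ord j) n.
  - rewrite addr0 /ndist (maxn_idPl (ltnW nj)) (minn_idPr (ltnW nj)).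
    case E : (n - j)%N => [|k] /=; first by lia.
    by rewrite -E [phi j * _]mulrC.
  - rewrite add0r /ndist (maxn_idPr (ltnW nj)) (minn_idPl (ltnW nj)).
    by case E : (j - n)%N => [|k] /=; first by lia.
  - by rewrite nj /ndist maxnn minnn subnn /=; ring.
under [in RHS]eq_bigr do rewrite big_split /=.
rewrite big_split /= [X in _ + X]exchange_big /=.
set X := \sum_(n < N) _; by field.
Qed.

End sequences.

(** * Weights of the power kernel *)

Section cusp_sums.
Context {R : realType} (al : R) (al0 : 0 < al) (al1 : al < 1).
Local Notation mu := (@lebesgue_measure R).

(** The coefficients of indices 0 and 1, then the integral of [t^(al-2)] over [[1, +oo[], which
    dominates the rest of the series. *)
Definition cusp_total : R := 2 / al + 1 + 1 / (1 - al).

Lemma cusp_total_gt0 : 0 < cusp_total.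
Proof.
rewrite /cusp_total; have h1 : 0 < 2 / al by rewrite divr_gt0.
have h2 : 0 < 1 / (1 - al) by rewrite divr_gt0// subr_gt0.
lra.
Qed.

Lemma powR_telescope (m : nat) : (0 < m)%N ->
  (m.+1%:R : R) `^ (al - 2) <= ((m%:R) `^ (al - 1) - (m.+1%:R) `^ (al - 1)) / (1 - al).
Proof.
move=> m0; have m0' : 0 < m%:R :> R by rewrite ltr0n.
have al2 : al - 1 != 0 by move: al1; lra.
have mm : m%:R <= m.+1%:R :> R by rewrite ler_nat.
have -> : ((m%:R) `^ (al - 1) - (m.+1%:R) `^ (al - 1)) / (1 - al) =
   \int[mu]_(t in `[(m%:R : R), m.+1%:R]) (t `^ (al - 1 - 1)).
  rewrite Rint_powR_gt0//; field; move: al1 => ?; apply/andP; split; lra.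
rewrite (_ : al - 1 - 1 = al - 2); last by ring.
have -> : (m.+1%:R : R) `^ (al - 2) = (m.+1%:R : R) `^ (al - 2) * (m.+1%:R - m%:R).
  by rewrite -[m.+1%:R in X in _ = _ * X]natr1 addrAC subrr add0r mulr1.
rewrite -Rint_cst_cc//; apply: le_Rint => //.
- apply: (@bnd_itg _ _ _ `|(m.+1%:R : R) `^ (al - 2)|) => //.
  exact: (@itv_fin _ _ m%:R m.+1%:R).
- exact: itg_powR_gt0.
- move=> t /=; rewrite in_itv/= => /andP[t1 t2].
  by apply: powR_anti => //; [move: al1; lra|exact: lt_le_trans t1].
Qed.

Lemma cusp_coef_sum (n : nat) : \sum_(i < n) cusp_coef al i <= cusp_total.
Proof.
have h k : \sum_(i < k.+2) cusp_coef al i <=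
    2 / al + 1 + (1 - (k.+1%:R) `^ (al - 1)) / (1 - al).
  elim: k => [|k IH].
    by rewrite !big_ord_recr big_ord0 /= /cusp_coef /= !powR1 subrr mul0r addr0 add0r.
  rewrite big_ord_recr /=; have := powR_telescope (ltn0Sn k).
  rewrite /cusp_coef /= => t; apply: le_trans (lerD IH t) _.
  by rewrite le_eqVlt; apply/orP; left; apply/eqP; ring.
have al' : 0 < 1 - al by rewrite subr_gt0.
apply: (@le_trans _ _ (\sum_(i < n.+2) cusp_coef al i)).
  rewrite 2!big_ord_recr /= -addrA lerDl addr_ge0 ?cusp_coef_ge0//.
apply: le_trans (h n) _; rewrite /cusp_total lerD2l ler_pM2r ?invr_gt0// lerBlDr lerDl.
Qed.

Lemma truncation_l2 (N : nat) (kap : nat -> R) :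
  \sum_(1 <= n < N.+1) (\sum_(k < n) cusp_coef al (n - k.+1) * kap k) ^+ 2 <=
  cusp_total ^+ 2 * \sum_(k < N) kap k ^+ 2.
Proof.
rewrite big_add1 big_mkord /=.
have := @young_sum R N (cusp_coef al) kap cusp_total (fun i => cusp_coef_ge0 i al0)
  (cusp_coef_sum N) cusp_total_gt0.
apply: le_trans; rewrite le_eqVlt; apply/orP; left; apply/eqP.
by apply: eq_bigr => n _; congr (_ ^+ 2); apply: eq_bigr => k _; rewrite subSS.
Qed.

End cusp_sums.

Lemma powR_expn (R : realType) (e y : R) n : 0 <= y -> (y `^ e) ^+ n = (y ^+ n) `^ e.
Proof.
by move=> y0; rewrite -powR_mulrn ?powR_ge0// -(powR_mulrn n y0) -powRrM -powRrM mulrC.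
Qed.

(** * Monotonicity and convexity of the power kernel weights *)

Section power_weights.
Context {R : realType} (tau al : R).
Local Notation mu := (@lebesgue_measure R).
Hypotheses (tau0 : 0 < tau) (al0 : 0 < al) (al1 : al < 1).

Let K (s : R) : R := s `^ (al - 1).
Let X : R := al + 1.

Definition hatint (m : nat) : R := \int[mu]_(s in `[0, tnode tau m.+1]) (K s * hat tau m s).

Let IK (p q : R) : 0 <= p -> itg `[p, q] K.
Proof. exact: itg_powR. Qed.

Let K_ge0 s : 0 <= K s. Proof. exact: powR_ge0. Qed.

Lemma hatint_ge0 m : 0 <= hatint m.
Proof. by apply: Rintegral_ge0 => s _; rewrite mulr_ge0 ?hat_ge0. Qed.

Lemma hatintE (n m : nat) : (m < n)%N ->
  \int[mu]_(s in `[0, tnode tau n]) (K s * hat tau m s) = hatint m.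
Proof.
move=> mn; apply: Rint_supp => //.
  move=> s /=; rewrite !in_itv/= => /andP[-> /le_trans]; apply.
  exact: tnode_le.
move=> s /=; rewrite !in_itv/= => /andP[s0 sn] /negP; rewrite s0 /= -ltNge => /ltW h.
by rewrite (hat_far tau0 (ltnSn m) h) mulr0.
Qed.

Lemma hatintS m : hatint m.+1 =
  \int[mu]_(s in `[tnode tau m, tnode tau m.+2]) (K s * hat tau m.+1 s).
Proof.
apply: Rint_supp => //.
  move=> s /=; rewrite !in_itv/= => /andP[s0 ->]; rewrite andbT (le_trans _ s0)//.
  exact: tnode_ge0.
move=> s /=; rewrite !in_itv/= => /andP[s0 ->]; rewrite andbT => /negP; rewrite -ltNge => /ltW h.
by rewrite (hat_near tau0 (ltnSn m) h) mulr0.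
Qed.

Let hat_shift m s : hat tau m.+1 (tau + s) = hat tau m s.
Proof. by rewrite /hat tnodeS; congr (pp (_ - `|_|)); ring. Qed.

Let Ihat m p q : 0 <= p -> itg `[p, q] (fun s => K s * hat tau m s).
Proof. by move=> p0; apply: itg_mul_hat => //; exact: IK. Qed.

(** Neighbouring weights are translated onto the same hat, so that comparing them reduces to
    comparing values of the kernel at [s - tau], [s] and [s + tau]. *)
Lemma hatintSr m : let E := `[tnode tau m, tnode tau m.+2]%classic in
  itg E (fun s => K (tau + s) * hat tau m.+1 s) /\
  hatint m.+2 = \int[mu]_(s in E) (K (tau + s) * hat tau m.+1 s).
Proof.
have I1 := @Ihat m.+2 (tnode tau m.+1) (tnode tau m.+3) (tnode_ge0 tau0 _).
have e1 : tnode tau m.+1 - tau = tnode tau m by rewrite tnodeS addrK.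
have e2 : tnode tau m.+3 - tau = tnode tau m.+2 by rewrite tnodeS addrK.
split.
  have := itg_shift tau I1; rewrite e1 e2.
  by apply: eq_itg => // s _; rewrite hat_shift.
rewrite hatintS -(Rint_shift tau I1) e1 e2.
by apply: eq_Rint => s _; rewrite hat_shift.
Qed.

Lemma hatintSl m : let E := `[tnode tau m.+1, tnode tau m.+3]%classic in
  itg E (fun s => K (- tau + s) * hat tau m.+2 s) /\
  hatint m.+1 = \int[mu]_(s in E) (K (- tau + s) * hat tau m.+2 s).
Proof.
have I1 := @Ihat m.+1 (tnode tau m) (tnode tau m.+2) (tnode_ge0 tau0 _).
have e1 : tnode tau m - - tau = tnode tau m.+1 by rewrite tnodeS opprK.
have e2 : tnode tau m.+2 - - tau = tnode tau m.+3 by rewrite [RHS]tnodeS opprK.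
have hs s : hat tau m.+1 (- tau + s) = hat tau m.+2 s.
  by rewrite -hat_shift addrA subrr add0r.
split.
  have := itg_shift (- tau) I1; rewrite e1 e2.
  by apply: eq_itg => // s _; rewrite hs.
rewrite hatintS -(Rint_shift (- tau) I1) e1 e2.
by apply: eq_Rint => s _; rewrite hs.
Qed.

Lemma hatint_decreasing m : hatint m.+2 <= hatint m.+1.
Proof.
have [I2 ->] := hatintSr m; rewrite hatintS.
apply: le_Rint => //; first by apply: Ihat; exact: tnode_ge0.
move=> s /=; rewrite in_itv/= => /andP[s1 s2].
have [h|h] := leP s (tnode tau m); first by rewrite (hat_near tau0 (ltnSn m) h) !mulr0.
have s0 : 0 < s by rewrite (le_lt_trans _ h)// tnode_ge0.
rewrite ler_wpM2r ?hat_ge0//; apply: powR_anti => //; first by move: al1; lra.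
by rewrite lerDr ltW.
Qed.

Lemma hatint_convex m : 0 <= hatint m.+1 - 2 * hatint m.+2 + hatint m.+3.
Proof.
have [I1 ->] := hatintSl m; have [I3 ->] := hatintSr m.+1; rewrite hatintS.
have I2 := @Ihat m.+2 (tnode tau m.+1) (tnode tau m.+3) (tnode_ge0 tau0 _).
rewrite -RintZ// -RintB//; last exact: itgZ.
rewrite -RintD//; last by apply: itgB => //; exact: itgZ.
apply: Rintegral_ge0 => s /=; rewrite in_itv/= => /andP[s1 s2].
have [h|h] := leP s (tnode tau m.+1); first by rewrite (hat_near tau0 (ltnSn m.+1) h) !mulr0 subrr addr0.
have y1 : 0 < - tau + s.
  by rewrite addrC subr_gt0 (le_lt_trans _ h)// tnodeS lerDr tnode_ge0.
have s0 : 0 < s by move: tau0 y1 => ? ?; lra.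
have y2 : 0 < tau + s by move: tau0 s0 => ? ?; lra.
rewrite (_ : _ + _ = (K (- tau + s) - 2 * K s + K (tau + s)) * hat tau m.+2 s); last by ring.
rewrite mulr_ge0 ?hat_ge0//.
(* By the inequality of arithmetic and geometric means, since
   (s - tau) (s + tau) <= s ^ 2 and the exponent is negative. *)
pose e := (al - 1) / 2; have e0 : e <= 0 by rewrite /e; move: al1; lra.
have KE y : 0 < y -> K y = (y `^ e) ^+ 2.
  move=> y0; rewrite /K (_ : al - 1 = e * 2); last by rewrite /e; field.
  by rewrite powRrM powR_mulrn ?powR_ge0.
have le1 : K s <= (- tau + s) `^ e * (tau + s) `^ e.
  rewrite -powRM ?(ltW y1) ?(ltW y2)//.
  apply: (@le_trans _ _ ((s * s) `^ e)).
    by rewrite powRM ?(ltW s0)// KE// expr2.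
  apply: powR_anti => //; first by rewrite mulr_gt0.
  by have := sqr_ge0 tau; nra.
rewrite KE// [K (tau + s)]KE//.
have := sqr_ge0 ((- tau + s) `^ e - (tau + s) `^ e); nra.
Qed.

Let Rint_affine (p q c d : R) : 0 <= p -> p <= q ->
  \int[mu]_(s in `[p, q]) (K s * (c + d * s)) =
  c * ((q `^ al - p `^ al) / al) + d * ((q `^ X - p `^ X) / X).
Proof.
move=> p0 pq; have X0 : 0 < X by rewrite /X; move: al0; lra.
have I1 : itg `[p, q] (fun s => s `^ (X - 1)) by exact: itg_powR.
rewrite (@eq_Rint _ _ (fun s => c * K s + d * s `^ (X - 1))); last first.
  move=> s /=; rewrite in_itv/= => /andP[ps sq].
  rewrite (_ : X - 1 = al); last by rewrite /X addrK.
  by rewrite -(mulr_powRB1 (le_trans p0 ps) al0) /K; ring.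
rewrite RintD//; [|by apply: itgZ => //; exact: IK|exact: itgZ].
by rewrite !RintZ// ?Rint_powR//; exact: IK.
Qed.

Let XE (s : R) : 0 <= s -> s `^ X = s * s `^ al.
Proof.
move=> s0; have X0 : 0 < X by rewrite /X; move: al0; lra.
by rewrite -(mulr_powRB1 s0 X0) /X addrK.
Qed.

Lemma hatint0E : hatint 0 = tau `^ X / (al * X).
Proof.
have X0 : 0 < X by rewrite /X; move: al0; lra.
rewrite /hatint (@eq_Rint _ _ (fun s => K s * (tau + -1 * s))); last first.
  move=> s /=; rewrite in_itv/= tnodeS tnode0 add0r => /andP[s0 s1].
  by rewrite /hat tnode0 subr0 ger0_norm// /pp max_l ?subr_ge0// mulN1r.
rewrite tnodeS tnode0 add0r Rint_affine ?lexx ?ltW// !powR0 ?gt_eqF// XE ?ltW//.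
rewrite /X; field; rewrite !gt_eqF//; move: al0; lra.
Qed.

Lemma hatintE_S m : hatint m.+1 =
  (tnode tau m.+2 `^ X - 2 * tnode tau m.+1 `^ X + tnode tau m `^ X) / (al * X).
Proof.
have X0 : 0 < X by rewrite /X; move: al0; lra.
have t0 := tau0; have t1 := tnode_ge0 tau0 m.
have e1 := tnodeS tau m; have e2 := tnodeS tau m.+1.
have I0 := @Ihat m.+1 (tnode tau m) (tnode tau m.+2) t1.
have := @Rintegral_itvB R (fun s => K s * hat tau m.+1 s) (BLeft (tnode tau m)) (BRight (tnode tau m.+2)) (tnode tau m.+1) I0.
rewrite !bnd_simp => /(_ ltac:(lra) ltac:(lra)) H.
rewrite hatintS -(subrK (\int[mu]_(x in `[tnode tau m, tnode tau m.+1]) (K x * hat tau m.+1 x)) (\int[mu]_(s in _) _)).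
rewrite H Rintegral_itv_obnd_cbnd; last first.
  by apply: itgS I0 => // s /=; rewrite !in_itv/= => /andP[s1 s2]; apply/andP; split; lra.
rewrite (@eq_Rint _ `[tnode tau m, tnode tau m.+1] (fun s => K s * (- tnode tau m + 1 * s))); last first.
  move=> s /=; rewrite in_itv/= => /andP[s1 s2].
  by rewrite /hat ler0_norm ?subr_le0// /pp max_l; [congr (_ * _)|]; lra.
rewrite (@eq_Rint _ `[tnode tau m.+1, tnode tau m.+2] (fun s => K s * (tnode tau m.+2 + -1 * s))); last first.
  move=> s /=; rewrite in_itv/= => /andP[s1 s2].
  by rewrite /hat ger0_norm ?subr_ge0// /pp max_l; [congr (_ * _)|]; lra.
rewrite !Rint_affine; try lra.
rewrite !XE; try lra.
rewrite e2 e1 /X; field; rewrite !gt_eqF//; move: al0; lra.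
Qed.

(** At index 0 the origin cuts the hat in half and the translation argument fails. With the closed
    forms, the two claims become [7 - 4 * 2^X + 3^X >= 0] and [2^X <= 4], where [X = al + 1]. *)
Lemma hatint_start : 0 <= 2 * hatint 0 - 2 * hatint 1 + hatint 2 /\ hatint 1 <= 2 * hatint 0.
Proof.
have X0 : 0 < X by rewrite /X; move: al0; lra.
have c0 : 0 <= tau `^ X / (al * X) by rewrite divr_ge0 ?powR_ge0// mulr_ge0// ltW.
have tE k : tnode tau k `^ X = k%:R `^ X * tau `^ X by rewrite powRM ?ler0n// ltW.
rewrite hatint0E !hatintE_S !tE powR1 mul1r (powR0 (_ : X != 0)) ?gt_eqF// mul0r.
(* With this [v] in [[0, 1]], [2^X = 4 v^3]; since [27 <= 32 = 2^5] and the exponent is nonpositive,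
   [3^X >= 9 v^5]. What remains is a polynomial inequality with the factor [1 - v]. *)
pose v : R := 2 `^ ((al - 1) / 3).
have e0 : (al - 1) / 3 <= 0 by move: al1; lra.
have v0 : 0 <= v by exact: powR_ge0.
have v1 : v <= 1.
  by apply: (@le_trans _ _ (1 `^ ((al - 1) / 3))); [apply: powR_anti => //; lra|rewrite powR1].
have pE (y : R) : 0 < y -> y `^ X = y ^+ 2 * (y `^ ((al - 1) / 3)) ^+ 3.
  move=> y0; rewrite (_ : X = 2 + (al - 1) / 3 * 3); last by rewrite /X; field.
  by rewrite powRD ?(gt_eqF y0) ?implybT// powRrM !powR_mulrn ?powR_ge0// ltW.
have h2 : (2 : R) `^ X = 4 * v ^+ 3 by rewrite pE// -/v; congr (_ * _); ring.
have h3 : 9 * v ^+ 5 <= (3 : R) `^ X.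
  rewrite pE// (_ : 3 ^+ 2 = 9 :> R); last by ring.
  by rewrite ler_pM2l// /v !powR_expn//; apply: powR_anti => //; lra.
split.
  rewrite (_ : _ + _ = (7 - 4 * 2 `^ X + 3 `^ X) * (tau `^ X / (al * X))); last by ring.
  rewrite mulr_ge0// h2.
  apply: (@le_trans _ _ (7 - 16 * v ^+ 3 + 9 * v ^+ 5)); last lra.
  have v2 : v ^+ 2 <= 1 by rewrite expr_le1.
  have -> : 7 - 16 * v ^+ 3 + 9 * v ^+ 5 = (1 - v) * (7 + 7 * v + 7 * v ^+ 2 - 9 * v ^+ 3 - 9 * v ^+ 4) by ring.
  rewrite mulr_ge0 ?subr_ge0//.
  have h4 : v ^+ 4 <= v ^+ 2 by rewrite -subr_ge0 (_ : _ - _ = v ^+ 2 * (1 - v ^+ 2)) ?mulr_ge0 ?sqr_ge0 ?subr_ge0//; ring.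
  have h5 : v ^+ 3 <= v by rewrite -subr_ge0 (_ : _ - _ = v * (1 - v ^+ 2)) ?mulr_ge0 ?subr_ge0//; ring.
  lra.
rewrite -subr_ge0 (_ : _ - _ = (4 - 2 `^ X) * (tau `^ X / (al * X))); last by ring.
rewrite mulr_ge0// h2 subr_ge0 ler_piMr// expr_le1//.
Qed.

End power_weights.

(** * Positivity and truncation errors of the two kernels *)

Section beta_weights.
Context {R : realType} (tau al : R).
Local Notation mu := (@lebesgue_measure R).
Hypotheses (tau0 : 0 < tau) (al0 : 0 < al) (al1 : al < 1).
Let tn := tnode tau.

Lemma Gamma_ge0 (z : R) : 0 <= Gamma z.
Proof. by apply: Rintegral_ge0 => x _; rewrite mulr_ge0 ?powR_ge0 ?expR_ge0. Qed.

Lemma beta_ge0 (t : R) : 0 <= beta al t.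
Proof. by rewrite divr_ge0 ?powR_ge0 ?Gamma_ge0. Qed.

Lemma itg_beta (p q : R) : 0 <= p -> itg `[p, q] (beta al).
Proof.
move=> p0; apply: (@eq_itg _ _ (fun t => (Gamma al)^-1 * t `^ (al - 1))) => //.
  by move=> t _; rewrite /beta mulrC.
by apply: itgZ => //; exact: itg_powR.
Qed.

Lemma Rint_beta (p q : R) : 0 <= p -> p <= q ->
  \int[mu]_(t in `[p, q]) beta al t = (Gamma al)^-1 / al * (q `^ al - p `^ al).
Proof.
move=> p0 pq; rewrite (@eq_Rint _ _ (fun t => (Gamma al)^-1 * t `^ (al - 1))); last first.
  by move=> t _; rewrite /beta mulrC.
by rewrite RintZ//; [rewrite Rint_powR// mulrA mulrAC|exact: itg_powR].
Qed.

Lemma beta_weight (n j : nat) : (0 < j)%N -> (j <= n)%N ->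
  weight tau (beta al) n j = (Gamma al)^-1 / tau * hatint tau al (n - j).
Proof.
move=> j0 jn; rewrite (weight_hat tau0 j0 jn); last exact: itg_beta.
rewrite (@eq_Rint _ _ (fun s => (Gamma al)^-1 * (s `^ (al - 1) * hat tau (n - j) s))); last first.
  by move=> s _; rewrite /beta; ring.
rewrite RintZ//; last by apply: itg_mul_hat => //; exact: itg_powR.
rewrite hatintE//; first by rewrite mulrA mulrC; ring.
by rewrite ltn_subrL (leq_trans j0 jn) j0.
Qed.

Lemma beta_weight_ge0 (n j : nat) : (0 < j)%N -> (j <= n)%N -> 0 <= weight tau (beta al) n j.
Proof.
move=> j0 jn; rewrite beta_weight// mulr_ge0 ?hatint_ge0//.
by rewrite divr_ge0 ?invr_ge0 ?Gamma_ge0// ltW.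
Qed.

(** The hats sum to at most [tau] at each [s], so the weights sum to at most the integral of [beta]
    over [[0, t_n]]. *)
Lemma beta_weight_sum (n : nat) : (0 < n)%N ->
  \sum_(1 <= j < n.+1) weight tau (beta al) n j <= (Gamma al)^-1 / al * tn n `^ al.
Proof.
move=> n0; have Ib := @itg_beta 0 (tn n) (lexx 0).
rewrite (eq_bigr (fun j => weight tau (beta al) n j * 1)); last by move=> j _; rewrite mulr1.
rewrite (weight_conv tau0 (fun=> 1) Ib).
have := Rint_beta (lexx 0) (tnode_ge0 tau0 n).
rewrite [0 `^ al]powR0 ?gt_eqF// subr0 => <-.
apply: le_Rint => //.
  apply: (@eq_itg _ _ (fun s => \sum_(m < n) tau^-1 * (beta al s * hat tau m s))) => //.
    by move=> s _; rewrite !mulr_sumr; apply: eq_bigr => m _; ring.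
  by apply: itg_sum => // m; apply: itgZ => //; exact: itg_mul_hat.
move=> s /=; rewrite in_itv/= => sn; rewrite ler_piMr ?beta_ge0//.
rewrite ler_pdivrMl// mulr1; under eq_bigr do rewrite mulr1.
exact: hat_sum_le.
Qed.

Lemma beta_weight_form_ge0 (N : nat) (phi : nat -> R) :
  0 <= \sum_(1 <= n < N.+1) \sum_(1 <= j < n.+1) weight tau (beta al) n j * (phi j * phi n).
Proof.
rewrite big_add1 big_mkord /=.
rewrite (eq_bigr (fun n : 'I_N => (Gamma al)^-1 / tau *
    \sum_(j < n.+1) hatint tau al (n - j) * (phi j.+1 * phi n.+1))); last first.
  move=> n _; rewrite big_add1 big_mkord /= mulr_sumr; apply: eq_bigr => j _.
  by rewrite beta_weight ?ltnS// ?subSS ?mulrA//; have := ltn_ord j; rewrite ltnS.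
rewrite -mulr_sumr mulr_ge0 ?divr_ge0 ?invr_ge0 ?Gamma_ge0 ?(ltW tau0)//.
have [h1 h2] := hatint_start tau0 al0 al1.
apply: (@toeplitz_lower_ge0 _ (hatint tau al) N (fun j => phi j.+1)) => //.
- by move=> k; exact: hatint_ge0.
- by move=> k; exact: hatint_decreasing.
- by move=> k; exact: hatint_convex.
Qed.

Lemma cell_beta (k : nat) :
  \int[mu]_(s in `]tn k, tn k.+1[) `|beta al s| =
  (Gamma al)^-1 / al * tau `^ al * ((k.+1%:R) `^ al - (k%:R) `^ al).
Proof.
rewrite (@eq_Rint _ _ (beta al)); last by move=> s _; rewrite ger0_norm ?beta_ge0.
rewrite Rint_oo_cc; last by apply: itg_oo_cc; apply: itg_beta; exact: tnode_ge0.
rewrite Rint_beta ?tnode_ge0//; last by rewrite ltW// tnode_lt.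
by rewrite /tn /tnode !powRM ?ler0n ?(ltW tau0)//; ring.
Qed.

(** As [al - 1] is negative, [(k+1)^al <= k^(al-1) (k+1)] for [k >= 1], so the increment is at most
    [k^(al-1) <= 1]; for [k = 0] it equals 1. *)
Lemma powR_increment (k : nat) : 0 <= (k.+1%:R : R) `^ al - (k%:R) `^ al <= 1.
Proof.
have mono : (k%:R : R) `^ al <= (k.+1%:R) `^ al.
  by apply: ge0_ler_powR; rewrite ?nnegrE ?ler0n ?ler_nat ?(ltW al0).
rewrite subr_ge0 mono /=; case: k mono => [|k] _.
  by rewrite powR1 powR0 ?gt_eqF// subr0.
have k0 : 0 < k.+1%:R :> R by rewrite ltr0n.
have h : (k.+2%:R : R) `^ al <= k.+1%:R `^ (al - 1) * k.+2%:R.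
  rewrite -(mulr_powRB1 (ler0n _ k.+2) al0) mulrC ler_wpM2r//.
  by apply: powR_anti; rewrite ?ler_nat//; move: al1; lra.
have h' : (k.+1%:R : R) `^ al = k.+1%:R `^ (al - 1) * k.+1%:R.
  by rewrite -(mulr_powRB1 (ler0n _ k.+1) al0) mulrC.
have h1 : (k.+1%:R : R) `^ (al - 1) <= 1.
  apply: (@le_trans _ _ (1 `^ (al - 1))); last by rewrite powR1.
  by apply: powR_anti; rewrite ?ler1n//; move: al1; lra.
rewrite h'; apply: (@le_trans _ _ (k.+1%:R `^ (al - 1) * (k.+2%:R - k.+1%:R))).
  by rewrite mulrBr lerB.
by rewrite -[k.+2%:R]natr1 addrAC subrr add0r mulr1.
Qed.

Let trunc (kap : nat -> R) n := tau `^ al * \sum_(k < n) cusp_coef al (n - k.+1) * kap k.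

Let trunc_l2 (N : nat) kap : \sum_(1 <= n < N.+1) trunc kap n ^+ 2 <=
  (tau `^ al * cusp_total al) ^+ 2 * \sum_(k < N) kap k ^+ 2.
Proof.
rewrite /trunc; under eq_bigr do rewrite exprMn.
rewrite -mulr_sumr [(tau `^ al * _) ^+ 2]exprMn -[leRHS]mulrA.
by apply: ler_wpM2l; [exact: sqr_ge0|exact: truncation_l2].
Qed.

(** Squared increments are bounded by increments, whose sum telescopes to [N^al]. Bounding every
    increment by 1 would produce [N] instead and only the order [2 al]. *)
Lemma beta_truncation (N : nat) :
  tau * \sum_(1 <= n < N.+1)
    trunc (fun k => \int[mu]_(s in `]tn k, tn k.+1[) `|beta al s|) n ^+ 2 <=
  (cusp_total al * ((Gamma al)^-1 / al)) ^+ 2 * tn N `^ al * (tau `^ (1 / 2 + 3 / 2 * al)) ^+ 2.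
Proof.
set c := (Gamma al)^-1 / al.
have sq : \sum_(k < N) (\int[mu]_(s in `]tn k, tn k.+1[) `|beta al s|) ^+ 2 <=
    (c * tau `^ al) ^+ 2 * N%:R `^ al.
  rewrite (eq_bigr (fun k : 'I_N => (c * tau `^ al) ^+ 2 * ((k.+1%:R) `^ al - (k%:R) `^ al) ^+ 2)); last first.
    by move=> k _; rewrite cell_beta exprMn.
  rewrite -mulr_sumr ler_wpM2l ?sqr_ge0//.
  apply: (@le_trans _ _ (\sum_(k < N) ((k.+1%:R) `^ al - (k%:R) `^ al))).
    apply: ler_sum => k _; have /andP[d0 d1] := powR_increment k.
    by rewrite expr2 ler_piMr.
  rewrite -(big_mkord predT (fun k => (k.+1%:R : R) `^ al - (k%:R) `^ al)) telescope_sumr//.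
  by rewrite powR0 ?gt_eqF// subr0.
have t2 := trunc_l2 N (fun k => \int[mu]_(s in `]tn k, tn k.+1[) `|beta al s|).
apply: le_trans (ler_wpM2l (ltW tau0) t2) _.
apply: (@le_trans _ _ (tau * ((tau `^ al * cusp_total al) ^+ 2 * ((c * tau `^ al) ^+ 2 * N%:R `^ al)))).
  by rewrite ler_wpM2l ?(ltW tau0)// ler_wpM2l ?sqr_ge0.
have -> : tn N `^ al = N%:R `^ al * tau `^ al by rewrite powRM ?ler0n// ltW.
have -> : (tau `^ (1 / 2 + 3 / 2 * al)) ^+ 2 = tau * (tau `^ al) ^+ 3.
  rewrite -!powR_mulrn ?powR_ge0// -!powRrM -[X in _ = X * _](powRr1 (ltW tau0)) -powRD.
    by congr (_ `^ _); field.
  by rewrite (gt_eqF tau0) implybT.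
rewrite le_eqVlt; apply/orP; left; apply/eqP; ring.
Qed.

(** Cell integrals of size [tau] give the order [al + 1], higher than [1/2 + 3/2 al] since
    [al < 1]. *)
Lemma bounded_truncation (N : nat) (K : R -> R) (B : R) : itg `[0, tn N] K ->
  (forall s, 0 <= s <= tn N -> `|K s| <= B) ->
  tau * \sum_(1 <= n < N.+1)
    trunc (fun k => \int[mu]_(s in `]tn k, tn k.+1[) `|K s|) n ^+ 2 <=
  (cusp_total al * B) ^+ 2 * tn N * (tau `^ al * tau) ^+ 2.
Proof.
move=> IK KB; have t2 := trunc_l2 N (fun k => \int[mu]_(s in `]tn k, tn k.+1[) `|K s|).
have sq : \sum_(k < N) (\int[mu]_(s in `]tn k, tn k.+1[) `|K s|) ^+ 2 <= N%:R * (B * tau) ^+ 2.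
  rewrite mulr_natl -[X in _ *+ X](card_ord N) -sumr_const; apply: ler_sum => k _.
  have k0 : 0 <= tn k by exact: tnode_ge0.
  have kN : tn k.+1 <= tn N by exact: tnode_le.
  have kS : tn k.+1 = tn k + tau by exact: tnodeS.
  have sub : `]tn k, tn k.+1[%classic `<=` (`[0, tn N]%classic : set R).
    by move=> s /=; rewrite !in_itv/= => /andP[s1 s2]; apply/andP; split; lra.
  have h0 : 0 <= \int[mu]_(s in `]tn k, tn k.+1[) `|K s| by exact: Rintegral_ge0.
  suff : \int[mu]_(s in `]tn k, tn k.+1[) `|K s| <= B * tau.
    by move=> h; rewrite ler_sqr ?nnegrE// (le_trans h0 h).
  have -> : B * tau = B * (tn k.+1 - tn k) by rewrite kS; ring.
  rewrite -Rint_cst_itv; last by rewrite kS lerDl ltW.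
  apply: le_Rint => //.
  - by apply: itg_norm; apply: itgS IK.
  - apply: (@bnd_itg _ _ _ `|B|) => //.
    by apply: (@itv_fin _ _ (tn k) (tn k.+1)); exact: subset_itv_oo_cc.
  - by move=> s /sub /=; rewrite in_itv; exact: KB.
apply: le_trans (ler_wpM2l (ltW tau0) t2) _.
apply: (@le_trans _ _ (tau * ((tau `^ al * cusp_total al) ^+ 2 * (N%:R * (B * tau) ^+ 2)))).
  by rewrite ler_wpM2l ?(ltW tau0)// ler_wpM2l ?sqr_ge0.
rewrite /tn /tnode le_eqVlt; apply/orP; left; apply/eqP; ring.
Qed.

End beta_weights.

(** * Consequences of the regularity assumptions *)

Section clamping.
Context {R : realType}.
Local Notation mu := (@lebesgue_measure R).

(** The projection on [[p, q]]. Composing with it extends a function continuously from the rectangle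
    to the whole plane, without enlarging its range; the extension is then handled with the usual
    topology. *)
Definition clamp (p q x : R) : R := Num.max p (Num.min x q).

Lemma clamp_itv (p q x : R) : p <= q -> p <= clamp p q x <= q.
Proof. by move=> pq; rewrite /clamp le_max lexx /= ge_max pq ge_min lexx orbT. Qed.

Lemma clamp_id (p q x : R) : p <= x <= q -> clamp p q x = x.
Proof. by move=> /andP[px xq]; rewrite /clamp min_l// max_r. Qed.

Lemma continuous_clamp (p q : R) : continuous (clamp p q).
Proof.
move=> x; apply: (@continuous_max _ _ (cst p) (fun x => Num.min x q)); first exact: cvg_cst.
by apply: (@continuous_min _ _ id (cst q)); [exact: cvg_id|exact: cvg_cst].
Qed.

Lemma continuous_clamp1 (p q : R) (u : R -> R) : p <= q ->
  {within `[p, q], continuous u} -> continuous (u \o clamp p q).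
Proof.
move=> pq /subspace_continuousP cu x.
have ck := clamp_itv x pq.
have h : `[p, q]%classic (clamp p q x) by rewrite /= in_itv.
have := cu _ h; apply: cvg_comp => A [e /= e0 eA].
have cb : \forall y \near x, ball (clamp p q x) e (clamp p q y).
  exact: (@continuous_clamp p q x (ball (clamp p q x) e) (nbhsx_ballx _ _ e0)).
change (\forall y \near x, A (clamp p q y)).
by apply: filterS cb => y ye; apply: eA => //; rewrite /= in_itv/= clamp_itv.
Qed.

Lemma continuous_clamp2 (T a b : R) (u : R -> R -> R) : 0 <= T -> a <= b ->
  {within `[0, T] `*` `[a, b], continuous (fun p : R * R => u p.1 p.2)} ->
  continuous (fun p : R * R => u (clamp 0 T p.1) (clamp a b p.2)).
Proof.
move=> T0 ab /subspace_continuousP cu [t x] /=.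
have h : (`[0, T]%classic `*` `[a, b]%classic) (clamp 0 T t, clamp a b x).
  by split; rewrite /= in_itv/= clamp_itv.
have c2 : (clamp 0 T p.1, clamp a b p.2) @[p --> (t, x)] --> (clamp 0 T t, clamp a b x).
  apply: cvg_pairR.
    by apply: (cvg_comp _ _ (@cvg_fst _ _ (nbhs t) (nbhs x) _)); exact: continuous_clamp.
  by apply: (cvg_comp _ _ (@cvg_snd _ _ (nbhs t) (nbhs x) _)); exact: continuous_clamp.
apply: (@cvg_comp _ _ _ (fun p : R * R => (clamp 0 T p.1, clamp a b p.2)) (fun p => u p.1 p.2)
  _ (within (`[0, T]%classic `*` `[a, b]%classic) (nbhs (clamp 0 T t, clamp a b x)))).
  move=> A AA.
  have cb : \forall p \near (t, x), (`[0, T]%classic `*` `[a, b]%classic) (clamp 0 T p.1, clamp a b p.2) ->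
      A (clamp 0 T p.1, clamp a b p.2) by exact: (c2 _ AA).
  change (\forall p \near (t, x), A (clamp 0 T p.1, clamp a b p.2)).
  by apply: filterS cb => p; apply; split; rewrite /= in_itv/= clamp_itv.
exact: (cu _ h).
Qed.

Lemma bounded_clamp2 (T a b : R) (u : R -> R -> R) : 0 <= T -> a <= b ->
  {within `[0, T] `*` `[a, b], continuous (fun p : R * R => u p.1 p.2)} ->
  exists B, forall t x, `|u (clamp 0 T t) (clamp a b x)| <= B.
Proof.
move=> T0 ab cu.
have cK := continuous_compact cu (compact_setX (@segment_compact R 0 T) (@segment_compact R a b)).
have [B [Breal BP]] := compact_bounded cK.
exists (B + 1) => t x; apply: (BP (B + 1)); first by rewrite ltrDl.
exists (clamp 0 T t, clamp a b x) => //.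
by split; rewrite /= in_itv/= clamp_itv.
Qed.

Lemma eq_weak_deriv (p q : R) (u u' v : R -> R) :
  (forall x, p < x < q -> u x = u' x) -> weak_deriv p q u v -> weak_deriv p q u' v.
Proof.
move=> uu' [[mu2 op Ku] lv uv]; split=> //.
- split=> //.
    by apply: eq_measurable_fun mu2 => x /set_mem /=; rewrite in_itv; exact: uu'.
  move=> K KD cK; have -> : (\int[mu]_(x in K) `|u' x|%:E = \int[mu]_(x in K) `|u x|%:E)%E.
    by apply: eq_integral => x /set_mem /KD; rewrite /= in_itv/= => /uu' ->.
  exact: Ku.
- move=> phi phit; rewrite -uv//; apply: eq_Rint => x /=.
  by rewrite in_itv/= => /uu' ->.
Qed.

End clamping.

Section sobolev.
Context {R : realType} (a b : R).
Local Notation mu := (@lebesgue_measure R).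

Lemma Hm_derivs2_test (D : nat -> R -> R) (u : R -> R) : Hm_derivs a b 2 u D ->
  forall phi, C1_test a b phi -> C1_test a b (derive1 phi) ->
  \int[mu]_(x in `]a, b[) (u x * derive1 (derive1 phi) x) =
  \int[mu]_(x in `]a, b[) (D 2 x * phi x).
Proof.
move=> [D0 wd _] phi p0 p1; rewrite -D0.
have [_ _ ->//] := wd 0%N isT; have [_ _ ->//] := wd 1%N isT.
by rewrite opprK.
Qed.

Lemma Hnorm_ge0 (m : nat) (u : R -> R) : (0 <= Hnorm a b m u)%E.
Proof. by apply/ereal_infP => _ [D _ <-]; rewrite lee_fin sqrtr_ge0. Qed.

(** The norm is an infimum over families of weak derivatives, not known to be attained; the strict
    gap between [Y] and [X] yields an actual family. *)
Lemma Hnorm_H2_bounded (u : R -> R) (X Y : R) : (Hnorm a b 2 u <= Y%:E)%E -> Y < X ->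
  H2_bounded a b u X.
Proof.
move=> uY YX; have : (Hnorm a b 2 u < X%:E)%E by rewrite (le_lt_trans uY)// lte_fin.
move=> /ereal_inf_lt[_ [D uD <-]]; rewrite lte_fin => /ltW DX.
have D2 := Hm_derivs2_test uD; have [D0 _ DL] := uD.
have le (i : 'I_3) : L2norm a b (D i) <= X.
  apply: le_trans DX; rewrite -ler_sqr ?nnegrE ?L2norm_ge0 ?sqrtr_ge0//.
  rewrite sqr_sqrtr; last by apply: sumr_ge0 => k _; exact: sqr_ge0.
  by rewrite (bigD1 i)//= lerDl; apply: sumr_ge0 => k _; exact: sqr_ge0.
split; [rewrite -D0; exact: DL|rewrite -D0; exact: (le ord0)|].
exists (D 2%N); split=> //; first exact: DL.
exact: (le (@Ordinal 3 2 isT)).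
Qed.

End sobolev.

(** * Measurability of the derivative of q *)

Section kernel_q.
Context {R : realType}.
Local Notation mu := (@lebesgue_measure R).

(** A derivative is the pointwise limit of the forward difference quotients with step [1 / (n + 1)],
    here of the clamped, continuous function. The end point [T], where forward steps leave the
    interval, is a single point and is added separately. *)
Lemma deriv_within_measurable (T : R) (u du : R -> R) : 0 < T ->
  (forall t, 0 <= t <= T -> deriv_within `[0, T] u t (du t)) ->
  measurable_fun `[0, T] du.
Proof.
move=> T0 ud.
have cu : {within `[0, T], continuous u}.
  apply/subspace_continuousP => t tT.
  have tT' : 0 <= t <= T by move: tT; rewrite /= in_itv.
  have /cvgrPdist_lt/(_ 1 ltr01) lim := ud t tT'.
  have lim' : \forall s \near t, s != t -> `[0, T]%classic s -> `|du t - (u s - u t) / (s - t)| < 1 := lim.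
  apply/cvgrPdist_lt => e e0.
  have l0 : 0 < `|du t| + 1 by rewrite ltr_wpDl.
  have d0 : 0 < e / (`|du t| + 1) by rewrite divr_gt0.
  have near_t : \forall s \near t, `|t - s| < e / (`|du t| + 1).
    exact: nbhsx_ballx _ _ d0.
  suff : \forall s \near t, `[0, T]%classic s -> `|u t - u s| < e by [].
  apply: filterS2 lim' near_t => s h st Ds.
  have [->|nst] := eqVneq s t; first by rewrite subrr normr0.
  have nst0 : s - t != 0 by rewrite subr_eq0.
  have := h nst Ds; set Q := (u s - u t) / (s - t) => Q1.
  have Qb : `|Q| <= `|du t| + 1.
    by have := ler_normB (du t) (du t - Q); rewrite subKr => /le_trans; apply; rewrite lerD2l ltW.
  rewrite distrC (_ : u s - u t = Q * (s - t)); last by rewrite /Q divfK.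
  rewrite normrM [`|s - t|]distrC; rewrite ltr_pdivlMr// in st.
  by apply: le_lt_trans st; rewrite mulrC ler_wpM2l.
have cU := continuous_clamp1 (ltW T0) cu.
have step n : 0 < n.+1%:R^-1 :> R by rewrite invr_gt0.
have m1 : measurable_fun `[0, T[ du.
  apply: (@measurable_fun_cvg _ (measurableTypeR R) R `[0, T[%classic (fun n t =>
     ((u \o clamp 0 T) (t + n.+1%:R^-1) - (u \o clamp 0 T) t) / n.+1%:R^-1)).
    move=> n; apply: measurable_funM => //; apply: measurable_funB.
      apply: measurable_funTS; apply: measurableT_comp.
        exact: continuous_measurable_fun.
      exact: measurable_funD.
    by apply: measurable_funTS; exact: continuous_measurable_fun.
  move=> t /=; rewrite in_itv/= => /andP[t0 tT].
  have tT' : 0 <= t <= T by rewrite t0 ltW.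
  have := ud t tT'; rewrite /deriv_within => lim.
  have seq : t + n.+1%:R^-1 @[n --> \oo] --> within `[0, T]%classic t^'.
    move=> A [e /= e0 eA].
    have hmin : 0 < Num.min e (T - t) by rewrite lt_min e0 subr_gt0.
    have : \forall n \near \oo, n.+1%:R^-1 < Num.min e (T - t).
      by have := @near_infty_natSinv_lt R (PosNum hmin).
    apply: filterS => n; rewrite lt_min => /andP[n1 n2]; have s0 := step n.
    apply: eA; rewrite /= ?in_itv/=.
    - by rewrite opprD addNKr normrN gtr0_norm.
    - by rewrite -subr_eq0 addrAC subrr add0r gt_eqF.
    - by rewrite addr_ge0 ?(ltW s0)//= -lerBrDl ltW.
  have := cvg_comp _ _ seq lim.
  apply: cvg_trans; apply: near_eq_cvg.
  have : \forall n \near \oo, n.+1%:R^-1 < T - t.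
    have Tt : 0 < T - t by rewrite subr_gt0.
    by have := @near_infty_natSinv_lt R (PosNum Tt).
  apply: filterS => n nT /=; have s0 := step n.
  rewrite !clamp_id ?tT'//; last by rewrite addr_ge0 ?(ltW s0)//= -lerBrDl ltW.
  by rewrite addrAC subrr add0r.
have sub : `[0, T]%classic `<=` (`[0, T[%classic : set R) `|` [set T].
  move=> t /=; rewrite !in_itv/= => /andP[-> ]; rewrite le_eqVlt => /predU1P[->|->]; first by right.
  by left.
apply: measurable_funS sub _; first exact: measurableU.
by apply/measurable_funU => //; split=> //; exact: measurable_fun_set1.
Qed.

End kernel_q.

(** * Exchange of a convolution in time with a pairing in space *)

Section convolution_pairing.
Context {R : realType} (t a b : R) (K : R -> R).
Local Notation mu := (@lebesgue_measure R).
Let DX : set R := `]a, b[%classic.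
Let DS : set R := `]0, t[%classic.
Let mDX : measurable DX. Proof. exact: measurable_itv. Qed.
Let mDS : measurable DS. Proof. exact: measurable_itv. Qed.
Hypothesis IK : itg `[0, t] K.

Let IKt : itg `[0, t] (fun s => K (t - s)).
Proof. by have := itg_reflect t IK; rewrite subrr subr0. Qed.

Let IKo : itg DS (fun s => K (t - s)).
Proof. exact: itg_oo_cc. Qed.

Lemma time_conv_oo (g : R -> R) : itg DS (fun s => K (t - s) * g s) ->
  time_conv K g t = \int[mu]_(s in DS) (K (t - s) * g s).
Proof. by move=> I; rewrite Rint_oo_cc. Qed.

(** [G] is the slice integral given by Fubini's theorem: it is integrable by construction, whereas
    the convolution times [L] is identified with it for almost every [x] only. *)
Lemma conv_pairing (u : R -> R -> R) (L g : R -> R) (M : R) :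
  measurable_fun (DS `*` DX) (fun p : R * R => u p.1 p.2) ->
  measurable_fun DX L -> measurable_fun DS g ->
  {ae mu, forall s, DS s -> itg DX (fun x => u s x * L x) /\
     \int[mu]_(x in DX) (u s x * L x) = g s /\
     \int[mu]_(x in DX) `|u s x * L x| <= M} ->
  exists G : R -> R, [/\ itg DX G,
    {ae mu, forall x, DX x -> G x = time_conv K (u ^~ x) t * L x} &
    \int[mu]_(x in DX) G x = time_conv K g t].
Proof.
move=> mu2 mL mg ug.
pose h s x := u s x * L x * K (t - s).
have mh : measurable_fun (DS `*` DX) (fun p : R * R => h p.1 p.2).
  apply: (@measurable_rect _ u (fun s => K (t - s)) L) => //; exact: itg_meas.
have Ik : itg DS (fun s => M * `|K (t - s)|) by apply: itgZ => //; exact: itg_norm.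
have hk : {ae mu, forall s, DS s -> (\int[mu]_(x in DX) `|h s x|%:E <= (M * `|K (t - s)|)%:E)%E}.
  apply: filterS ug => s /[apply] -[Iu [_ uM]].
  rewrite /h (@eq_integral _ _ _ mu DX (fun x => (`|K (t - s)| * `|u s x * L x|)%:E)); last first.
    by move=> x _; rewrite normrM mulrC.
  rewrite EFin_Rint//; last by apply: itgZ => //; exact: itg_norm.
  rewrite RintZ//; last exact: itg_norm.
  by rewrite lee_fin mulrC ler_wpM2r.
have [I1 I2 I3 I4] := Rfubini mDS mDX mh Ik hk.
exists (fun x => \int[mu]_(s in DS) h s x); split; [exact: I2| |].
  apply: filterS I3 => x /[apply] Ix.
  have [L0|L0] := eqVneq (L x) 0.
    rewrite L0 mulr0 (@eq_Rint _ _ (cst 0)) ?Rintegral_cst ?mul0r//.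
    by move=> s _; rewrite /h L0 mulr0 mul0r.
  have Ixl : itg DS (fun s => K (t - s) * u s x).
    apply: (eq_itg mDS _ (itgZ (L x)^-1 mDS Ix)) => s _.
    by rewrite /h; field.
  rewrite (time_conv_oo Ixl) mulrC -(RintZ _ mDS Ixl); apply: eq_Rint => s _; rewrite /h; ring.
rewrite -I4.
have gM : {ae mu, forall s, DS s -> `|g s| <= M}.
  apply: filterS ug => s /[apply] -[Iu [<- uM]].
  by apply: le_trans (le_normr_Rintegral _ _) uM.
have Ig : itg DS (fun s => K (t - s) * g s).
  apply: (le_itg_ae mDS _ _ (itgZ M mDS (itg_norm IKo))).
    by apply: measurable_funM mg; exact: itg_meas IKo.
  apply: filterS gM => s /[apply] gM.
  by rewrite normrM mulrC ler_wpM2r.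
rewrite (time_conv_oo Ig); apply: (ae_eq_Rint mDS).
- exact: itg_meas I1.
- exact: itg_meas Ig.
- apply: filterS ug => s /[apply] -[Iu [<- _]].
  rewrite /h -(RintZ _ mDX Iu); apply: eq_Rint => x _; ring.
Qed.

End convolution_pairing.

(** * Error estimate *)

Section discrete_gronwall.
Context {R : realType}.
Implicit Types (y X : nat -> R).

Lemma sum_sqr_le (m : nat) y :
  (\sum_(1 <= j < m.+1) y j) ^+ 2 <= m%:R * \sum_(1 <= j < m.+1) y j ^+ 2.
Proof.
case: m => [|m]; first by rewrite !big_geq// expr0n mul0r.
have E (f : nat -> R) : \sum_(1 <= j < m.+2) f j = \sum_(1 <= j < m.+2) 1 * f j.
  by apply: eq_bigr => j _; rewrite mul1r.
rewrite (E y) (E (fun j => y j ^+ 2)); apply: weighted_CauchySchwarz => //.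
by rewrite sumr_const_nat subn1.
Qed.

(** With [E m] the partial sums of the squares and [g = 4 kap^2 T tau], Young's and Cauchy-Schwarz
    inequalities give [E m <= 2 SX + g / 2 * (E 1 + ... + E m)]. The condition [g <= 1] lets the
    left side absorb the last term; iterating gives [(1 + g)^N <= exp (g N)], with
    [g N = 4 kap^2 T^2]. *)
Lemma discrete_gronwall (N : nat) (T tau kap : R) y X :
  0 < T -> 0 <= tau -> tau * N%:R = T -> 4 * kap ^+ 2 * T * tau <= 1 ->
  (forall n, 0 <= y n) ->
  (forall m, (m <= N)%N -> \sum_(1 <= n < m.+1) y n ^+ 2 <=
     \sum_(1 <= n < m.+1) y n * (X n + kap * tau * \sum_(1 <= j < n.+1) y j)) ->
  \sum_(1 <= n < N.+1) y n ^+ 2 <=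
  4 * expR (4 * kap ^+ 2 * T ^+ 2) * \sum_(1 <= n < N.+1) X n ^+ 2.
Proof.
move=> T0 tau0 NT small y0 H.
pose E m := \sum_(1 <= n < m.+1) y n ^+ 2.
pose SX := \sum_(1 <= n < N.+1) X n ^+ 2.
have E0 m : 0 <= E m by apply: sumr_ge0 => n _; exact: sqr_ge0.
have SX0 : 0 <= SX by apply: sumr_ge0 => n _; exact: sqr_ge0.
pose g := 4 * kap ^+ 2 * T * tau.
have g0 : 0 <= g.
  by rewrite /g mulr_ge0// mulr_ge0 ?(ltW T0)// mulr_ge0 ?sqr_ge0.
have g1' : g <= 1 := small.
have key m : (m <= N)%N -> E m <= 2 * SX + g / 2 * \sum_(1 <= n < m.+1) E n.
  move=> mN.
  have h1 : \sum_(1 <= n < m.+1) y n * (X n + kap * tau * \sum_(1 <= j < n.+1) y j) <=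
      2^-1 * E m + \sum_(1 <= n < m.+1) X n ^+ 2 + g / 4 * \sum_(1 <= n < m.+1) E n.
    rewrite /E !mulr_sumr -!big_split /=; apply: ler_sum_nat => n /andP[n1 nm].
    set Z := kap * tau * _.
    have Z2 : Z ^+ 2 <= g / 4 * E n.
      rewrite /Z exprMn.
      apply: le_trans (ler_wpM2l (sqr_ge0 _) (sum_sqr_le n y)) _.
      rewrite mulrA ler_wpM2r ?E0//.
      have -> : g / 4 = (kap * tau) ^+ 2 * N%:R by rewrite /g -NT; field.
      by rewrite ler_wpM2l ?sqr_ge0// ler_nat (leq_trans _ mN).
    rewrite -/(E n); have := sqr_ge0 (y n - (X n + Z)); have := sqr_ge0 (X n - Z).
    by rewrite mulr_sumr -/(E n) in Z2 *; nra.
  have h2 : \sum_(1 <= n < m.+1) X n ^+ 2 <= SX.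
    rewrite /SX (@big_cat_nat _ _ _ m.+1 1 N.+1)//= lerDl.
    by apply: sumr_ge0 => n _; exact: sqr_ge0.
  have := le_trans (H m mN) h1; rewrite -/(E m); lra.
pose S m := 4 * SX + g * \sum_(1 <= n < m) E n.
have ES m : (m <= N)%N -> E m <= S m.
  case: m => [|m] mN.
    by rewrite /S /E !big_geq// mulr0 addr0 mulr_ge0.
  have := key m.+1 mN; rewrite big_nat_recr//= /S.
  set Q := \sum_(1 <= n < m.+1) E n.
  have : g / 2 * E m.+1 <= 2^-1 * E m.+1 by rewrite ler_wpM2r//; lra.
  by rewrite mulrDr; lra.
have Sm m : (m <= N)%N -> S m.+1 <= 4 * SX * (1 + g) ^+ m.
  elim: m => [|m IH] mN; first by rewrite /S big_geq// mulr0 addr0 expr0 mulr1.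
  have e1 := IH (ltnW mN); have e2 := ES m.+1 mN.
  have -> : S m.+2 = S m.+1 + g * E m.+1 by rewrite /S big_nat_recr//=; ring.
  rewrite exprSr mulrA mulrDr mulr1.
  have : g * E m.+1 <= g * S m.+1 by rewrite ler_wpM2l.
  have : g * S m.+1 <= g * (4 * SX * (1 + g) ^+ m) by rewrite ler_wpM2l.
  lra.
have SN : S N <= S N.+1.
  rewrite /S lerD2l ler_wpM2l//; case: (N) => [|k]; first by rewrite !big_geq.
  by rewrite [leRHS]big_nat_recr//= lerDl.
apply: le_trans (ES N (leqnn N)) _; apply: le_trans SN _; apply: le_trans (Sm N (leqnn N)) _.
rewrite mulrAC ler_wpM2r// ler_wpM2l//.
have g1 : 0 <= 1 + g by lra.
apply: (@le_trans _ _ (expR g ^+ N)); first by rewrite lerXn2r ?nnegrE ?expR_ge0// expR_ge1Dx.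
rewrite -expRM_natl ler_expR /g -NT le_eqVlt; apply/orP; left; apply/eqP; ring.
Qed.

End discrete_gronwall.

(** Linear arithmetic behind the error inequality, isolated on abstract reals. First letters: M
    mass, S and T the sums weighted by [q'] and [beta], K stiffness, A exact convolutions. Second
    letters: W scheme, O solution, R its interpolation error, H the discrete error, with KE for the
    stiffness form of the latter; [t] is its norm. *)
Lemma error_combination (R : realType) (lam s2 t rq qT Cb C0 tq tb ST MF MO MW SW SO TW TO
    KW KO TR SR TH SH KE MR AQ AB AK : R) :
  MW + SW + lam * TW + s2 * KW = MF -> MO + AQ + lam * AB - s2 * AK = MF ->
  `|AQ - SO| <= C0 * t * tq -> `|lam * (AB - TO)| <= lam * (C0 * t * tb) ->
  `|s2 * (AK - KO)| <= s2 * (C0 * t * tb) ->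
  MO - MW = MR + t ^+ 2 -> SO - SW = SR + SH -> TO - TW = TR + TH -> KO + KW = - KE ->
  `|MR| <= t * rq -> `|SR| <= qT * (t * rq) -> `|SH| <= t * ST ->
  `|lam * TR| <= lam * (Cb * (t * rq)) ->
  t ^+ 2 + lam * TH + s2 * KE <=
  t * (rq * (1 + qT + lam * Cb) + C0 * tq + (lam + s2) * C0 * tb + ST).
Proof.
move=> e1 e2; rewrite !ler_norml => /andP[b1 _] /andP[b2 _] /andP[_ b3] d0 d1 d2 d3.
move=> /andP[b4 _] /andP[b5 _] /andP[b6 _] /andP[b7 _].
have d2' : lam * (TO - TW) = lam * (TR + TH) by rewrite d2.
have d3' : s2 * (KO + KW) = s2 * - KE by rewrite d3.
lra.
Qed.

Lemma powR_order_le (R : realType) (al tau : R) : al < 1 -> 0 < tau -> tau <= 1 ->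
  (tau `^ al * tau) ^+ 2 <= (tau `^ (1 / 2 + 3 / 2 * al)) ^+ 2.
Proof.
move=> al1 tau0 tau1.
have -> : tau `^ al * tau = tau `^ (al + 1).
  by rewrite powRD ?(gt_eqF tau0) ?implybT// powRr1// ltW.
rewrite ler_sqr ?nnegrE ?powR_ge0//; apply: ger_powR; first by rewrite tau0.
lra.
Qed.

(** * Energy estimate for the discrete error *)

Section error_analysis.
Context {R : realType} (T lam s2 a b al C0 C1 Cq : R).
Context (om F : R -> R -> R) (dq : R -> R).
Local Notation mu := (@lebesgue_measure R).
Let DX : set R := `]a, b[%classic.
Let mDX : measurable DX. Proof. exact: measurable_itv. Qed.
Hypotheses (T0 : 0 < T) (lam0 : 0 <= lam) (s20 : 0 <= s2) (ab : a < b).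
Hypotheses (al0 : 0 < al) (al1 : al < 1) (C00 : 0 <= C0) (C10 : 0 <= C1).
Hypothesis c_om : forall t, continuous (om t).
Hypothesis c_pair : forall psi : R -> R, {within `[a, b], continuous psi} ->
  {within `[0, T], continuous (fun t => L2inner a b (om t) psi)}.
Hypothesis c_omt : forall x, continuous (om ^~ x).
Hypothesis om_ab : forall t, om t a = 0 /\ om t b = 0.
Hypothesis mass_bound : forall psi : R -> R, {within `[a, b], continuous psi} ->
  cusp_bound T al (C0 * L2norm a b psi) (fun t => L2inner a b (om t) psi).
Hypothesis stiff_bound : forall (I : finType) (m P Q : I -> R),
  (forall i, a <= P i <= b) -> (forall i, a <= Q i <= b) ->
  \sum_i m i * (Q i - P i) = 0 ->
  cusp_bound T al (C0 * L2norm a b (kL m P Q)) (fun t => kf m P Q (om t)).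
Hypothesis om_kink : forall t, 0 <= t <= T -> kink_bounded a b C1 (om t).
Hypotheses (Idq : itg `[0, T] dq) (dqC : forall t, 0 <= t <= T -> `|dq t| <= Cq).
Hypothesis tested : forall (I : finType) (m P Q : I -> R),
  (forall i, a <= P i <= b) -> (forall i, a <= Q i <= b) ->
  \sum_i m i * (Q i - P i) = 0 -> forall t, 0 < t <= T ->
  L2inner a b (om t) (kL m P Q) +
  time_conv dq (fun s => L2inner a b (om s) (kL m P Q)) t +
  lam * time_conv (beta al) (fun s => L2inner a b (om s) (kL m P Q)) t -
  s2 * time_conv (beta al) (fun s => kf m P Q (om s)) t =
  L2inner a b (F t) (kL m P Q).

Section scheme.
Variables (N n : nat) (x : nat -> R) (h : R) (W : nat -> R -> R).
Hypotheses (N0 : (0 < N)%N) (x0 : x 0 = a) (xn : x n = b).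
Hypothesis gx : forall i, (i < n)%N -> x i < x i.+1.
Hypothesis hx : forall i, (i < n)%N -> x i.+1 - x i <= h.
Let Sh (u : R -> R) : Prop :=
  [/\ {within `[a, b], continuous u}, cellwise_affine n x u, u a = 0 & u b = 0].
Hypothesis WSh : forall j, Sh (W j).
Let tau : R := T / N%:R.
Let w := weight tau dq.
Let wt := weight tau (beta al).
Let tn := tnode tau.
Hypothesis scheme : forall m, (0 < m <= N)%N -> forall L, Sh L ->
  L2inner a b (W m) L + L2inner a b (fun y => \sum_(1 <= j < m.+1) w m j * W j y) L +
  lam * L2inner a b (fun y => \sum_(1 <= j < m.+1) wt m j * W j y) L +
  s2 * L2inner a b (fun y => \sum_(1 <= j < m.+1) wt m j * derive1 (W j) y) (derive1 L) =
  L2inner a b (F (tn m)) L.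

Let tau0 : 0 < tau. Proof. by rewrite divr_gt0// ltr0n. Qed.

Let tN : tn N = T.
Proof. by rewrite /tn /tnode /tau mulrC divfK// pnatr_eq0 -lt0n. Qed.

Let tn_itv m : (m <= N)%N -> 0 <= tn m <= T.
Proof. by move=> mN; rewrite -tN tnode_ge0// tnode_le. Qed.

(** The total error is split as [rho + th]: [rho] is the interpolation error of [om], and [th],
    built from the nodal errors [err], belongs to the finite element space and may be used as a test
    function. *)
Let err m i := om (tn m) (x i) - W m (x i).
Let th m := interpolant n x (err m).
Let oI m := interpolant n x (fun i => om (tn m) (x i)).
Let rho m y := om (tn m) y - oI m y.

Let err0 m : err m 0 = 0.
Proof. by rewrite /err x0; have [-> _] := om_ab (tn m); have [_ _ -> _] := WSh m; rewrite subrr. Qed.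

Let errn m : err m n = 0.
Proof. by rewrite /err xn; have [_ ->] := om_ab (tn m); have [_ _ _ ->] := WSh m; rewrite subrr. Qed.

Let c_th m : continuous (th m). Proof. exact: continuous_interpolant. Qed.

Let th_Sh m : Sh (th m).
Proof.
split; first exact: continuous_subspaceT.
- exact: interpolant_affine.
- by rewrite /th -x0 (interpolant_node ab x0 xn gx)// err0 subrr.
- by rewrite /th -xn (interpolant_node ab x0 xn gx)// err0 errn subrr.
Qed.

Let split_error m y : a <= y <= b -> om (tn m) y - W m y = rho m y + th m y.
Proof.
move=> yab; have [_ Wa W0 _] := WSh m.
rewrite (cellwise_affine_interpolant ab x0 xn gx Wa W0 yab) /rho.
suff -> : th m y = oI m y - interpolant n x (fun i => W m (x i)) y by ring.
rewrite /th /oI /interpolant /kL -sumrB; apply: eq_bigr => i _.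
by rewrite /slope /err; ring.
Qed.

Let cont_L2' u : continuous u -> is_L2 a b u.
Proof. by move=> cu; apply/cont_L2/continuous_subspaceT. Qed.

Let th_L2 m : is_L2 a b (th m). Proof. exact: cont_L2'. Qed.
Let om_L2 t : is_L2 a b (om t). Proof. exact: cont_L2'. Qed.
Let rho_L2 m : is_L2 a b (rho m).
Proof.
by apply: cont_L2' => y; apply: cvgB; [exact: c_om|exact: continuous_interpolant].
Qed.
Let W_L2 m : is_L2 a b (W m). Proof. by apply: cont_L2; have [] := WSh m. Qed.

Let rho_le m : (m <= N)%N -> L2norm a b (rho m) <= C1 * h ^+ 2.
Proof.
move=> mN; apply: (interpolation_error ab x0 xn gx C10 (om_kink (tn_itv mN))) => //.
  exact: continuous_subspaceT.
by have [] := om_ab (tn m).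
Qed.

Let inner_le u m : is_L2 a b u -> `|L2inner a b u (th m)| <= L2norm a b (th m) * L2norm a b u.
Proof. by move=> uL; rewrite mulrC; exact: CauchySchwarz. Qed.

Let inner_sum (I : Type) (s : seq I) (c : I -> R) (u : I -> R -> R) m :
  (forall j, is_L2 a b (u j)) ->
  L2inner a b (fun y => \sum_(j <- s) c j * u j y) (th m) =
  \sum_(j <- s) c j * L2inner a b (u j) (th m).
Proof.
move=> uL; rewrite /L2inner (@eq_Rint _ _ (fun y => \sum_(j <- s) c j * (u j y * th m y))).
  rewrite Rint_sum//; last by move=> j; apply: itgZ => //; exact: L2_itgM.
  by apply: eq_bigr => j _; rewrite RintZ//; exact: L2_itgM.
by move=> y _; rewrite mulr_suml; apply: eq_bigr => j _; rewrite mulrA.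
Qed.

Let inner_diff j m : L2inner a b (om (tn j)) (th m) - L2inner a b (W j) (th m) =
  L2inner a b (rho j) (th m) + L2inner a b (th j) (th m).
Proof.
rewrite /L2inner -RintB//; [|exact: L2_itgM|exact: L2_itgM].
rewrite -RintD//; [|exact: L2_itgM|exact: L2_itgM].
apply: eq_Rint => y /=; rewrite in_itv/= => /andP[y1 y2].
by rewrite -mulrBl split_error ?mulrDl// !ltW.
Qed.

Let kfm m u := kf (fun i : 'I_n => slope x (err m) i) (fun i : 'I_n => x i)
  (fun i : 'I_n => x i.+1) u.

Let PI (i : 'I_n) : a <= x i <= b.
Proof. by apply: (node_itv x0 xn gx); exact: ltnW. Qed.
Let QI (i : 'I_n) : a <= x i.+1 <= b.
Proof. exact: (node_itv x0 xn gx). Qed.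
Let mom m : \sum_(i < n) slope x (err m) i * (x i.+1 - x i) = 0.
Proof. by apply: (interpolant_moment gx). Qed.

Let kf_diff j m : kfm m (om (tn j)) + stiffness n x (err m) (fun i => W j (x i)) =
  - stiffness n x (err m) (err j).
Proof.
have := stiffness_kf n x (err m) (om (tn j)); rewrite -/(kfm m _) => /(congr1 -%R).
rewrite opprK => <-; rewrite /stiffness -sumrN -big_split -sumrN /=.
by apply: eq_bigr => i _; rewrite /err; ring.
Qed.

Let trunc (K : R -> R) m : R := tau `^ al * \sum_(k < m) cusp_coef al (m - k.+1) *
    \int[mu]_(s in `]tn k, tn k.+1[) `|K s|.

Let conv_err K G M m : (m <= N)%N -> 0 <= M -> cusp_bound T al M G ->
  {within `[0, T], continuous G} -> itg `[0, T] K ->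
  `|time_conv K G (tn m) - \sum_(1 <= j < m.+1) weight tau K m j * G (tn j)| <=
  M * trunc K m.
Proof.
move=> mN M0 GM cG IK; have /andP[t0 tT] := tn_itv mN.
rewrite /trunc mulrA; apply: (conv_truncation tau0 al0 M0 GM cG tT).
apply: itgS IK => // s /=; rewrite !in_itv/= => /andP[-> s1].
exact: le_trans s1 tT.
Qed.

Let w_le m j : (m <= N)%N -> (0 < j)%N -> (j <= m)%N -> `|w m j| <= 2 * Cq * tau.
Proof.
move=> mN j0 jm; have /andP[t0 tT] := tn_itv mN.
apply: (weight_bounded tau0 j0 jm).
  apply: itgS Idq => // s /=; rewrite !in_itv/= => /andP[-> s1].
  exact: le_trans s1 tT.
by move=> s /andP[s0 s1]; apply: dqC; rewrite s0 (le_trans s1).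
Qed.

Let Cq0 : 0 <= Cq.
Proof. by apply: le_trans (dqC (_ : 0 <= 0 <= T)) => //; rewrite lexx ltW. Qed.

Let Cb : R := (Gamma al)^-1 / al * T `^ al.

Let Cb0 : 0 <= Cb.
Proof. by rewrite mulr_ge0 ?powR_ge0// divr_ge0 ?invr_ge0 ?Gamma_ge0// ltW. Qed.

Let wt_sum m : (0 < m <= N)%N -> \sum_(1 <= j < m.+1) wt m j <= Cb.
Proof.
move=> /andP[m0 mN]; apply: le_trans (beta_weight_sum tau0 al0 m0) _.
rewrite ler_wpM2l//; first by rewrite divr_ge0 ?invr_ge0 ?Gamma_ge0// ltW.
have /andP[t0 tT] := tn_itv mN.
by apply: ge0_ler_powR; rewrite ?nnegrE ?(ltW al0)// ltW.
Qed.

(** The consistency error: interpolation in space as seen by the mass, [q'] and [beta] terms, then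
    truncation of the convolution with [q'], then truncation of the two convolutions with [beta]. *)
Let Y m : R := C1 * h ^+ 2 * (1 + 2 * Cq * T + lam * Cb) + C0 * trunc dq m +
  (lam + s2) * C0 * trunc (beta al) m.

(** The scheme is subtracted from the exact equation, both tested with [th m]. The interpolation
    error [rho] leaves no trace in the stiffness term, which only sees values at the nodes. *)
Let basic m : (0 < m <= N)%N ->
  L2norm a b (th m) ^+ 2 +
  lam * \sum_(1 <= j < m.+1) wt m j * L2inner a b (th j) (th m) +
  s2 * \sum_(1 <= j < m.+1) wt m j * stiffness n x (err m) (err j) <=
  L2norm a b (th m) * (Y m + 2 * Cq * tau * \sum_(1 <= j < m.+1) L2norm a b (th j)).
Proof.
move=> mN; have /andP[m0 mN'] := mN; have tm := tn_itv mN'.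
have tm0 : 0 < tn m <= T.
  by move: tm => /andP[_ ->]; rewrite andbT mulr_gt0// ltr0n.
have scm := scheme mN (th_Sh m).
rewrite !inner_sum// in scm.
have [_ tha _ _] := th_Sh m.
have Wa j : cellwise_affine n x (W j) by have [] := WSh j.
rewrite (Rint_gradients x0 xn gx _ _ Wa tha) in scm.
have stE V : stiffness n x (fun i => th m (x i)) V = stiffness n x (err m) V.
  apply: eq_bigr => i _; rewrite /slope /th !(interpolant_node ab x0 xn gx) ?err0 ?subr0//.
  exact: ltnW.
have stb : \sum_(1 <= j < m.+1) wt m j * stiffness n x (fun i => th m (x i)) (fun i => W j (x i)) =
    \sum_(1 <= j < m.+1) wt m j * stiffness n x (err m) (fun i => W j (x i)).
  by apply: eq_bigr => j _; rewrite stE.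
rewrite stb in scm.
have exm := tested PI QI (mom m) tm0.
rewrite -/(th m) in exm.
have cw : {within `[a, b], continuous (th m)} by exact: continuous_subspaceT.
have Mth : 0 <= C0 * L2norm a b (th m) by rewrite mulr_ge0 ?L2norm_ge0.
have Ib : itg `[0, T] (beta al) by exact: itg_beta.
have ckf : {within `[0, T], continuous (fun t => kfm m (om t))}.
  apply: continuous_subspaceT => t; apply: cvg_bigsum => i.
  by apply: cvgM; [exact: cvg_cst|apply: cvgB; exact: c_omt].
have e1 := conv_err mN' Mth (mass_bound cw) (c_pair cw) Idq.
have e2 := conv_err mN' Mth (mass_bound cw) (c_pair cw) Ib.
have e3 := conv_err mN' Mth (stiff_bound PI QI (mom m)) ckf Ib.
rewrite -/w -/wt -/(kfm m _) in e1 e2 e3.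
set t0 := L2norm a b (th m) in Mth e1 e2 e3 *.
have t00 : 0 <= t0 by exact: L2norm_ge0.
set rq := C1 * h ^+ 2.
have rq0 : 0 <= rq by rewrite mulr_ge0 ?sqr_ge0.
have rho_in j : (j <= N)%N -> `|L2inner a b (rho j) (th m)| <= t0 * rq.
  by move=> jN; apply: le_trans (inner_le m (rho_L2 j)) _; rewrite ler_wpM2l ?rho_le.
(* The errors of the three convolution terms, split according to
   om - W = rho + th. *)
have sumdiff (c : nat -> R) : \sum_(1 <= j < m.+1) c j * L2inner a b (om (tn j)) (th m) -
    \sum_(1 <= j < m.+1) c j * L2inner a b (W j) (th m) =
    \sum_(1 <= j < m.+1) c j * L2inner a b (rho j) (th m) +
    \sum_(1 <= j < m.+1) c j * L2inner a b (th j) (th m).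
  rewrite -sumrB -big_split /=; apply: eq_bigr => j _.
  by rewrite -mulrBr inner_diff mulrDr.
have d1 := sumdiff (w m); have d2 := sumdiff (wt m); have d0 := inner_diff m m.
have d3 : \sum_(1 <= j < m.+1) wt m j * kfm m (om (tn j)) +
    \sum_(1 <= j < m.+1) wt m j * stiffness n x (err m) (fun i => W j (x i)) =
    - \sum_(1 <= j < m.+1) wt m j * stiffness n x (err m) (err j).
  rewrite -big_split -sumrN /=; apply: eq_bigr => j _.
  by rewrite -mulrDr kf_diff mulrN.
have E0 : L2inner a b (th m) (th m) = t0 ^+ 2.
  by rewrite /t0 L2norm_sqE//; apply: eq_Rint => y _; rewrite expr2.
have b0 := rho_in m mN'.
have b1 : `|\sum_(1 <= j < m.+1) w m j * L2inner a b (rho j) (th m)| <= 2 * Cq * T * (t0 * rq).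
  apply: le_trans (ler_norm_sum _ _ _) _.
  apply: (@le_trans _ _ (\sum_(1 <= j < m.+1) 2 * Cq * tau * (t0 * rq))).
    apply: ler_sum_nat => j /andP[j1 jm]; rewrite normrM ler_pM ?w_le//.
    by apply: rho_in; rewrite ltnS in jm; exact: leq_trans jm mN'.
  rewrite sumr_const_nat subn1 /= -(mulr_natl _ m) mulrA.
  apply: ler_wpM2r; first by rewrite mulr_ge0.
  have mT : m%:R * tau <= T by case/andP: tm.
  have -> : m%:R * (2 * Cq * tau) = 2 * Cq * (m%:R * tau) by ring.
  by rewrite ler_wpM2l// mulr_ge0.
have b2 : `|\sum_(1 <= j < m.+1) w m j * L2inner a b (th j) (th m)| <=
    t0 * (2 * Cq * tau * \sum_(1 <= j < m.+1) L2norm a b (th j)).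
  apply: le_trans (ler_norm_sum _ _ _) _; rewrite !mulr_sumr.
  apply: ler_sum_nat => j /andP[j1 jm]; rewrite normrM mulrCA ler_pM ?w_le//.
  exact: inner_le.
have b3 : `|\sum_(1 <= j < m.+1) wt m j * L2inner a b (rho j) (th m)| <= Cb * (t0 * rq).
  apply: le_trans (ler_norm_sum _ _ _) _.
  apply: (@le_trans _ _ (\sum_(1 <= j < m.+1) wt m j * (t0 * rq))).
    apply: ler_sum_nat => j /andP[j1 jm]; rewrite normrM.
    rewrite ger0_norm ?beta_weight_ge0// ler_wpM2l ?beta_weight_ge0//.
    by apply: rho_in; rewrite ltnS in jm; exact: leq_trans jm mN'.
  by rewrite -mulr_suml ler_wpM2r ?wt_sum// mulr_ge0.
rewrite E0 in d0.
have scale (c d B : R) : 0 <= c -> `|d| <= B -> `|c * d| <= c * B.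
  by move=> c0 dB; rewrite normrM ger0_norm// ler_wpM2l.
have e2' := scale _ _ _ lam0 e2; have e3' := scale _ _ _ s20 e3.
have b3' := scale _ _ _ lam0 b3.
exact: (error_combination scm exm e1 e2' e3' d0 d1 d2 d3 b0 b1 b2 b3').
Qed.

(** Positivity of the weights is applied at each point [y] to the sequence [th j y], then
    integrated. *)
Let form_mass_ge0 k : 0 <= \sum_(1 <= m < k.+1) \sum_(1 <= j < m.+1)
  wt m j * L2inner a b (th j) (th m).
Proof.
have Ith c j m : itg DX (fun y => c * (th j y * th m y)) by apply: itgZ => //; exact: L2_itgM.
have -> : \sum_(1 <= m < k.+1) \sum_(1 <= j < m.+1) wt m j * L2inner a b (th j) (th m) =
    \int[mu]_(y in DX) \sum_(1 <= m < k.+1) \sum_(1 <= j < m.+1) wt m j * (th j y * th m y).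
  rewrite Rint_sum//; last by move=> m; exact: itg_sum.
  apply: eq_bigr => m _; rewrite Rint_sum//; apply: eq_bigr => j _.
  by rewrite RintZ//; exact: L2_itgM.
by apply: Rintegral_ge0 => y _; exact: (beta_weight_form_ge0 tau0 al0 al1).
Qed.

(** Positivity of the weights is applied on each cell to the sequence of slopes of the error. *)
Let form_stiff_ge0 k : 0 <= \sum_(1 <= m < k.+1) \sum_(1 <= j < m.+1)
  wt m j * stiffness n x (err m) (err j).
Proof.
have -> : \sum_(1 <= m < k.+1) \sum_(1 <= j < m.+1) wt m j * stiffness n x (err m) (err j) =
    \sum_(i < n) (x i.+1 - x i) * \sum_(1 <= m < k.+1) \sum_(1 <= j < m.+1)
      wt m j * (slope x (err j) i * slope x (err m) i).
  under [RHS]eq_bigr do rewrite mulr_sumr.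
  rewrite [RHS]exchange_big; apply: eq_bigr => m _.
  under [RHS]eq_bigr do rewrite mulr_sumr.
  rewrite [RHS]exchange_big; apply: eq_bigr => j _; rewrite /stiffness mulr_sumr.
  apply: eq_bigr => i _; rewrite -(slopeK gx (err j) (ltn_ord i)); ring.
apply: sumr_ge0 => i _; rewrite mulr_ge0 ?subr_ge0 ?(ltW (gx _))//.
exact: (beta_weight_form_ge0 tau0 al0 al1).
Qed.

(** The memory terms have a sign only after summation over all times up to [k], so the inequalities
    are added before these terms are dropped. *)
Let energy k : (k <= N)%N -> \sum_(1 <= m < k.+1) L2norm a b (th m) ^+ 2 <=
  \sum_(1 <= m < k.+1) L2norm a b (th m) *
    (Y m + 2 * Cq * tau * \sum_(1 <= j < m.+1) L2norm a b (th j)).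
Proof.
move=> kN; apply: (@le_trans _ _ (\sum_(1 <= m < k.+1) (L2norm a b (th m) ^+ 2 +
  lam * \sum_(1 <= j < m.+1) wt m j * L2inner a b (th j) (th m) +
  s2 * \sum_(1 <= j < m.+1) wt m j * stiffness n x (err m) (err j)))).
  rewrite 2!big_split /= -2!mulr_sumr -addrA lerDl.
  by rewrite addr_ge0// mulr_ge0 ?form_mass_ge0 ?form_stiff_ge0.
apply: ler_sum_nat => m /andP[m1 mk]; apply: basic.
by rewrite m1; rewrite ltnS in mk; exact: leq_trans mk kN.
Qed.

(** The first term comes from [rho]. In the second, 8 is the product of 2, from the square of
    [rho + th], and of 4, from the discrete Gronwall inequality; 3 comes from the square of the
    three-term consistency error. *)
Definition error_const : R :=
  2 * T * C1 ^+ 2 + 8 * expR (4 * (2 * Cq) ^+ 2 * T ^+ 2) * 3 *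
  (T * (C1 * (1 + 2 * Cq * T + lam * ((Gamma al)^-1 / al * T `^ al))) ^+ 2 +
   (C0 * (cusp_total al * Cq)) ^+ 2 * T +
   ((lam + s2) * C0 * (cusp_total al * ((Gamma al)^-1 / al))) ^+ 2 * T `^ al).

Lemma scheme_error : tau <= 1 -> 4 * (2 * Cq) ^+ 2 * T * tau <= 1 ->
  tau * \sum_(1 <= m < N.+1) L2norm a b (fun y => om (tn m) y - W m y) ^+ 2 <=
  error_const * ((tau `^ (1 / 2 + 3 / 2 * al)) ^+ 2 + (h ^+ 2) ^+ 2).
Proof.
move=> tau1 small; set P := tau `^ _.
have tNr : tau * N%:R = T by move: tN; rewrite /tn /tnode mulrC.
have G := discrete_gronwall T0 (ltW tau0) tNr small (fun m => L2norm_ge0 a b (th m)) energy.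
set E := expR _ in G *.
have E0 : 0 <= E by exact: expR_ge0.
pose rq := C1 * h ^+ 2.
have rq0 : 0 <= rq by rewrite mulr_ge0 ?sqr_ge0.
have split1 : \sum_(1 <= m < N.+1) L2norm a b (fun y => om (tn m) y - W m y) ^+ 2 <=
    2 * N%:R * rq ^+ 2 + 2 * \sum_(1 <= m < N.+1) L2norm a b (th m) ^+ 2.
  have -> : 2 * N%:R * rq ^+ 2 = \sum_(1 <= m < N.+1) 2 * rq ^+ 2.
    by rewrite sumr_const_nat subn1 /= -(mulr_natl _ N); ring.
  rewrite mulr_sumr -big_split /=; apply: ler_sum_nat => m /andP[m1 mN]; rewrite ltnS in mN.
  have eL : L2norm a b (fun y => om (tn m) y - W m y) <= L2norm a b (rho m) + L2norm a b (th m).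
    apply: le_trans (L2norm_triangle (rho_L2 m) (th_L2 m)).
    rewrite le_eqVlt; apply/orP; left; apply/eqP; rewrite /L2norm; congr (fine ('N[_]_ _ [_])).
    apply/funext => y; rewrite /= !patchE; case: ifPn => // /set_mem /=.
    by rewrite in_itv/= => /andP[y1 y2]; rewrite split_error// !ltW.
  have e0 := L2norm_ge0 a b (fun y => om (tn m) y - W m y).
  have r0 := L2norm_ge0 a b (rho m); have r1 := rho_le mN; have t0 := L2norm_ge0 a b (th m).
  apply: (@le_trans _ _ ((rq + L2norm a b (th m)) ^+ 2)).
    by rewrite ler_sqr ?nnegrE ?addr_ge0//; apply: le_trans eL _; rewrite lerD2r.
  by have := sqr_ge0 (rq - L2norm a b (th m)); nra.
have bq := bounded_truncation tau0 al0 al1 (K := dq) (B := Cq) (N := N).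
rewrite -/tn tN in bq; have {}bq := bq Idq dqC.
have bb := beta_truncation tau0 al0 al1 N; rewrite -/tn tN in bb.
pose c1 := 1 + 2 * Cq * T + lam * Cb.
have Ysq : tau * \sum_(1 <= m < N.+1) Y m ^+ 2 <=
    3 * (T * (rq * c1) ^+ 2 + C0 ^+ 2 * (tau * \sum_(1 <= m < N.+1) trunc dq m ^+ 2) +
      ((lam + s2) * C0) ^+ 2 * (tau * \sum_(1 <= m < N.+1) trunc (beta al) m ^+ 2)).
  have -> : T * (rq * c1) ^+ 2 = tau * \sum_(1 <= m < N.+1) (rq * c1) ^+ 2.
    by rewrite sumr_const_nat subn1 /= -(mulr_natl _ N) -tNr; ring.
  rewrite !(mulrCA _ tau) -!mulrDr mulrCA ler_wpM2l ?(ltW tau0)//.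
  rewrite !mulr_sumr -!big_split /= mulr_sumr; apply: ler_sum_nat => m _.
  rewrite /Y -/rq -/c1.
  set u := rq * c1; set v := C0 * _; set z := (lam + s2) * C0 * _.
  have -> : C0 ^+ 2 * trunc dq m ^+ 2 = v ^+ 2 by rewrite [RHS]exprMn.
  have -> : ((lam + s2) * C0) ^+ 2 * trunc (beta al) m ^+ 2 = z ^+ 2 by rewrite [RHS]exprMn.
  have := sqr_ge0 (u - v); have := sqr_ge0 (u - z); have := sqr_ge0 (v - z); nra.
have tauP : (tau `^ al * tau) ^+ 2 <= P ^+ 2 := powR_order_le al1 tau0 tau1.
have q1 : tau * \sum_(1 <= m < N.+1) trunc dq m ^+ 2 <= (cusp_total al * Cq) ^+ 2 * T * P ^+ 2.
  by apply: le_trans bq _; apply: ler_wpM2l tauP; rewrite mulr_ge0 ?sqr_ge0// ltW.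
have q2 : tau * \sum_(1 <= m < N.+1) trunc (beta al) m ^+ 2 <=
  (cusp_total al * ((Gamma al)^-1 / al)) ^+ 2 * T `^ al * P ^+ 2 := bb.
have Yb : tau * \sum_(1 <= m < N.+1) Y m ^+ 2 <=
    3 * (T * (rq * c1) ^+ 2 + C0 ^+ 2 * ((cusp_total al * Cq) ^+ 2 * T * P ^+ 2) +
      ((lam + s2) * C0) ^+ 2 * ((cusp_total al * ((Gamma al)^-1 / al)) ^+ 2 * T `^ al * P ^+ 2)).
  apply: le_trans Ysq _; apply: ler_wpM2l => //; apply: lerD; first apply: lerD => //.
    by apply: ler_wpM2l q1; exact: sqr_ge0.
  by apply: ler_wpM2l q2; exact: sqr_ge0.
apply: le_trans (ler_wpM2l (ltW tau0) split1) _.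
have G' : tau * (2 * \sum_(1 <= m < N.+1) L2norm a b (th m) ^+ 2) <=
    8 * E * (tau * \sum_(1 <= m < N.+1) Y m ^+ 2).
  rewrite (_ : 8 * E * _ = tau * (2 * (4 * E * \sum_(1 <= m < N.+1) Y m ^+ 2))); last by ring.
  by rewrite ler_wpM2l ?(ltW tau0)// ler_wpM2l.
have EY : 8 * E * (tau * \sum_(1 <= m < N.+1) Y m ^+ 2) <= 8 * E * (3 * (T * (rq * c1) ^+ 2 + C0 ^+ 2 * ((cusp_total al * Cq) ^+ 2 * T * P ^+ 2) +
      ((lam + s2) * C0) ^+ 2 * ((cusp_total al * ((Gamma al)^-1 / al)) ^+ 2 * T `^ al * P ^+ 2))).
  by apply: ler_wpM2l Yb; rewrite mulr_ge0.
rewrite mulrDr; apply: le_trans (lerD (lexx _) (le_trans G' EY)) _.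
have -> : tau * (2 * N%:R * rq ^+ 2) = 2 * T * C1 ^+ 2 * (h ^+ 2) ^+ 2.
  by rewrite -tNr /rq; ring.
rewrite /error_const -/Cb -/c1 -/E.
pose A1 := 2 * T * C1 ^+ 2; pose A2 := T * (C1 * c1) ^+ 2.
pose A3 := (C0 * (cusp_total al * Cq)) ^+ 2 * T.
pose A4 := ((lam + s2) * C0 * (cusp_total al * ((Gamma al)^-1 / al))) ^+ 2 * T `^ al.
have A10 : 0 <= A1 by rewrite /A1 mulr_ge0 ?sqr_ge0// mulr_ge0// ltW.
have A20 : 0 <= A2 by rewrite /A2 mulr_ge0 ?sqr_ge0// ltW.
have A30 : 0 <= A3 by rewrite /A3 mulr_ge0 ?sqr_ge0// ltW.
have A40 : 0 <= A4 by rewrite /A4 mulr_ge0 ?sqr_ge0// powR_ge0.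
have -> : 8 * E * (3 * (T * (rq * c1) ^+ 2 + C0 ^+ 2 * ((cusp_total al * Cq) ^+ 2 * T * P ^+ 2) +
      ((lam + s2) * C0) ^+ 2 * ((cusp_total al * ((Gamma al)^-1 / al)) ^+ 2 * T `^ al * P ^+ 2))) =
    8 * E * 3 * (A2 * (h ^+ 2) ^+ 2 + A3 * P ^+ 2 + A4 * P ^+ 2).
  by rewrite /A2 /A3 /A4 /rq; ring.
have h4 : 0 <= (h ^+ 2) ^+ 2 by exact: sqr_ge0.
have P2 : 0 <= P ^+ 2 by exact: sqr_ge0.
rewrite -/A1 -/A2 -/A3 -/A4.
have E8 : 0 <= 8 * E * 3 by rewrite !mulr_ge0.
have s1 : A2 * (h ^+ 2) ^+ 2 + A3 * P ^+ 2 + A4 * P ^+ 2 <= (A2 + A3 + A4) * (P ^+ 2 + (h ^+ 2) ^+ 2).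
  by have := mulr_ge0 A20 P2; have := mulr_ge0 A30 h4; have := mulr_ge0 A40 h4; lra.
have := ler_wpM2l E8 s1; have := mulr_ge0 A10 P2; lra.
Qed.

End scheme.
End error_analysis.

(** * The continuous equation tested with kinks *)

Section tested_equation.
Context {R : realType} (T a b s2 lam al : R) (dq : R -> R) (om omega om_xx F : R -> R -> R) (B C1 : R).
Local Notation mu := (@lebesgue_measure R).
Let DX : set R := `]a, b[%classic.
Let mDX : measurable DX. Proof. exact: measurable_itv. Qed.
Hypotheses (ab : a < b) (al0 : 0 < al) (C10 : 0 <= C1).
Hypothesis c_om : continuous (fun p : R * R => om p.1 p.2).
Hypothesis om_bnd : forall t x, `|om t x| <= B.
Hypothesis om_eq : forall t x, 0 <= t <= T -> a <= x <= b -> om t x = omega t x.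
Hypothesis om_kink : forall t, 0 <= t <= T -> kink_bounded a b C1 (om t).
Hypothesis Idq : itg `[0, T] dq.
Hypothesis mxx : measurable_fun (`]0, T[ `*` `]a, b[) (fun p : R * R => om_xx p.1 p.2).
Hypothesis H2xx : {ae mu, forall t, 0 < t < T -> H2_second_deriv a b (omega t) (om_xx t)}.
Hypothesis eqn : forall t, 0 < t <= T -> {ae mu, forall x, a < x < b ->
  omega t x + time_conv dq (omega ^~ x) t - s2 * time_conv (beta al) (om_xx ^~ x) t
  + lam * time_conv (beta al) (omega ^~ x) t = F t x}.
Hypothesis FL2 : forall t, 0 < t <= T -> is_L2 a b (F t).
Variables (I : finType) (m P Q : I -> R).
Hypotheses (PI : forall i, a <= P i <= b) (QI : forall i, a <= Q i <= b).
Hypothesis mom : \sum_i m i * (Q i - P i) = 0.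

Lemma time_conv_eq (K g g' : R -> R) (t : R) :
  (forall s, 0 <= s <= t -> g s = g' s) -> time_conv K g t = time_conv K g' t.
Proof. by move=> gg'; apply: eq_Rint => s /=; rewrite in_itv/= => /gg' ->. Qed.

Lemma Rint_absM_le (u v : R -> R) : is_L2 a b u -> is_L2 a b v ->
  \int[mu]_(x in DX) `|u x * v x| <= L2norm a b u * L2norm a b v.
Proof.
move=> uL vL; have := CauchySchwarz (L2_norm uL) (L2_norm vL); rewrite !L2norm_abs//.
apply: le_trans; rewrite (@eq_Rint _ _ (fun x => `|u x| * `|v x|)); last first.
  by move=> x _; rewrite normrM.
exact: ler_norm.
Qed.

(** The equation only provides some [om_xx t] in L^2 for almost every [t]; the kink bounds on [om t]
    make its norm uniform in time, as Fubini's theorem requires for the convolution with [beta]. *)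
Lemma second_deriv_facts : {ae mu, forall t, 0 < t < T ->
  [/\ is_L2 a b (om_xx t), L2norm a b (om_xx t) <= 8 * C1 &
   \int[mu]_(x in DX) (om_xx t x * kL m P Q x) = kf m P Q (om t)]}.
Proof.
apply: filterS H2xx => t H t0T; have [D HD D2] := H t0T.
have /andP[t0 tT] := t0T; have tT' : 0 <= t <= T by rewrite !ltW.
have vL : is_L2 a b (om_xx t) by rewrite -D2; have [_ _] := HD; apply.
have cu : {within `[a, b], continuous (om t)}.
  by apply: continuous_subspaceT; exact: continuous_om_x.
have uv phi : C1_test a b phi -> C1_test a b (derive1 phi) ->
    \int[mu]_(x in DX) (om t x * derive1 (derive1 phi) x) = \int[mu]_(x in DX) (om_xx t x * phi x).
  move=> p0 p1; rewrite -D2 -(Hm_derivs2_test HD)//; apply: eq_Rint => x.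
  by rewrite /DX /= in_itv/= => /andP[ax xb]; rewrite om_eq// !ltW.
have kfE (J : finType) (m' P' Q' : J -> R) := @kink_formula _ _ _ ab (om t) (om_xx t) J m' P' Q' cu vL uv.
split=> //; last by rewrite kfE.
exact: (kink_bounded_L2norm ab C10 vL (om_kink tT') kfE).
Qed.

(** At a fixed time the equation holds for almost every [x]; it is multiplied by the kinks and
    integrated. Each convolution is exchanged with the pairing, and the pairing with [om_xx] becomes
    point values of [om], so no space derivative is left. *)
Lemma kink_tested_equation (t : R) : 0 < t <= T ->
  L2inner a b (om t) (kL m P Q) +
  time_conv dq (fun s => L2inner a b (om s) (kL m P Q)) t +
  lam * time_conv (beta al) (fun s => L2inner a b (om s) (kL m P Q)) t -
  s2 * time_conv (beta al) (fun s => kf m P Q (om s)) t =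
  L2inner a b (F t) (kL m P Q).
Proof.
move=> t0T; have /andP[t0 tT] := t0T.
set L := kL m P Q; pose DS := `]0, t[%classic : set R.
have LL : is_L2 a b L by exact: kL_L2.
have oL s : is_L2 a b (om s) by exact: om_L2.
have mL : measurable_fun DX L by have /is_L2P[] := LL.
have sub : (`]0, t[ : set R) `*` DX `<=` (`]0, T[ : set R) `*` (`]a, b[ : set R).
  move=> [s x] [/= + Dx]; rewrite !in_itv/= => /andP[s0 st]; split => //=.
  by rewrite s0 (lt_le_trans st).
have mo : measurable_fun ((`]0, t[ : set R) `*` DX) (fun p : R * R => om p.1 p.2).
  by apply: measurable_funTS; exact: continuous2_measurable.
have mx : measurable_fun ((`]0, t[ : set R) `*` DX) (fun p : R * R => om_xx p.1 p.2).
  apply: measurable_funS sub mxx; apply: measurableX; exact: measurable_itv.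
have B0 : 0 <= B by apply: le_trans (om_bnd 0 0).
pose M1 := B * Num.sqrt (b - a) * L2norm a b L.
pose M2 := 8 * C1 * L2norm a b L.
have mg1 : measurable_fun (`]0, t[ : set R) (fun s => L2inner a b (om s) L).
  have /cont_bounded[CL _ LC] : {within `[a, b], continuous L}.
    by apply: continuous_subspaceT; exact: kL_continuous.
  have LC' x : DX x -> `|L x| <= CL.
    by rewrite /DX /= in_itv/= => /andP[? ?]; rewrite LC// !ltW.
  have := pairing_continuous (T := t) c_om om_bnd mL LC'.
  by move=> c; apply: itg_meas; apply: itg_oo_cc; exact: itg_cont.
have mg2 : measurable_fun (`]0, t[ : set R) (fun s => kf m P Q (om s)).
  apply: measurable_funTS; apply: continuous_measurable_fun => s; apply: cvg_bigsum => i.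
  by apply: cvgM; [exact: cvg_cst|apply: cvgB; exact: continuous_om_t].
have u1 : {ae mu, forall s, DS s -> itg DX (fun x => om s x * L x) /\
     \int[mu]_(x in DX) (om s x * L x) = L2inner a b (om s) L /\
     \int[mu]_(x in DX) `|om s x * L x| <= M1}.
  apply: aeW => s _; split; first exact: L2_itgM.
  split=> //; apply: le_trans (Rint_absM_le (oL s) LL) _.
  by rewrite ler_wpM2r ?L2norm_ge0//; exact: om_L2norm.
have u2 : {ae mu, forall s, DS s -> itg DX (fun x => om_xx s x * L x) /\
     \int[mu]_(x in DX) (om_xx s x * L x) = kf m P Q (om s) /\
     \int[mu]_(x in DX) `|om_xx s x * L x| <= M2}.
  apply: filterS second_deriv_facts => s H; rewrite /DS /= in_itv/= => /andP[s0 st].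
  have [|xL xn xk] := H; first by rewrite s0 (lt_le_trans st).
  split; first exact: L2_itgM.
  split=> //; apply: le_trans (Rint_absM_le xL LL) _.
  by rewrite ler_wpM2r ?L2norm_ge0.
have Iq : itg `[0, t] dq.
  by apply: itgS Idq => // s /=; rewrite !in_itv/= => /andP[-> st]; exact: le_trans st tT.
have Ib : itg `[0, t] (beta al) by exact: itg_beta.
have [G1 [IG1 E1 <-]] := conv_pairing Iq mo mL mg1 u1.
have [G2 [IG2 E2 <-]] := conv_pairing Ib mo mL mg1 u1.
have [G3 [IG3 E3 <-]] := conv_pairing Ib mx mL mg2 u2.
have IoL : itg DX (fun x => om t x * L x) by exact: L2_itgM.
have IFL : itg DX (fun x => F t x * L x) by apply: L2_itgM => //; exact: FL2.
rewrite /L2inner -!RintZ// -RintD//.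
rewrite -RintD//; [|exact: itgD|exact: itgZ].
rewrite -RintB//; [|by apply: itgD => //; [exact: itgD|exact: itgZ]|exact: itgZ].
apply: ae_eq_Rint => //.
- apply: itg_meas; apply: itgB => //; last exact: itgZ.
  by apply: itgD => //; [exact: itgD|exact: itgZ].
- exact: itg_meas.
apply: filterS3 (filterI (eqn t0T) E1) E2 E3 => x [Ex E1x] E2x E3x Dx.
rewrite E1x// E2x// E3x//.
have xab : a < x < b by move: Dx; rewrite /DX /= in_itv.
have xab' : a <= x <= b by case/andP: xab => ? ?; rewrite !ltW.
rewrite -(Ex xab) om_eq ?(ltW t0)//.
have e s : 0 <= s <= t -> om s x = omega s x.
  by move=> /andP[s0 st]; apply: om_eq => //; rewrite s0 (le_trans st).
rewrite (time_conv_eq dq e) (time_conv_eq (beta al) e); ring.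
Qed.

End tested_equation.

Section partitions.
Context {R : realType} (a b : R) (s : seq R).
Hypothesis pab : itv_partition a b s.

Lemma node_lt i : (i < size s)%N -> node a s i < node a s i.+1.
Proof. by move=> iN; have [/(pathP a) ps _] := pab; exact: ps. Qed.

Lemma node_last : node a s (size s) = b.
Proof. exact: itv_partition_nth_size. Qed.

Lemma elt_le_mesh i : (i < size s)%N -> node a s i.+1 - node a s i <= mesh a s.
Proof.
move=> iN; apply: (@le_bigmax_seq _ _ _ _ _ (Ordinal iN) predT (fun i : 'I_(size s) => elt_size a s i)) => //.
exact: mem_index_enum.
Qed.

End partitions.

Lemma eq_L2norm (R : realType) (a b : R) (u v : R -> R) :
  (forall x, a < x < b -> u x = v x) -> L2norm a b u = L2norm a b v.
Proof.
move=> uv; rewrite /L2norm; congr (fine ('N[_]_ _ [_])); apply/funext => x.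
rewrite /= !patchE; case: ifPn => // /set_mem /=.
by rewrite in_itv/= => /uv ->.
Qed.

Theorem theorem4p1 (R : realType) (T sigma r a b : R)
    (astar : R) (alpha dq : R -> R)
    (f : R -> R -> R) (ct d2c : R -> R) (omega : R -> R -> R) (kappa : R) :
  0 < T -> 0 < sigma -> 0 <= r -> a < b ->
  variable_exponent T astar alpha ->
  q_regular T alpha dq ->
  data_regular T sigma r a b alpha f ct d2c ->
  solves_T T sigma r a b alpha dq f ct d2c omega ->
  regularity_R T a b (alpha 0) omega ->
  exists C tau0 : R, [/\ 0 < C, 0 < tau0 &
    forall (N : nat) (s : seq R) (W : nat -> R -> R),
      (0 < N)%N -> T / N%:R < tau0 ->
      itv_partition a b s -> quasi_uniform kappa a s ->
      fd_scheme T sigma r a b (alpha 0) dq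
        (Fsource sigma r alpha f ct d2c) N s W ->
      let tau := T / N%:R in
      Num.sqrt (tau * \sum_(1 <= n < N.+1)
                        L2norm a b (fun x => omega (n%:R * tau) x - W n x) ^+ 2)
      <= C * (tau `^ (1 / 2 + 3 / 2 * alpha 0) + mesh a s ^+ 2)].
Proof.
move=> T0 sigma0 _ ab [_ _ astar1 alpha_itv _] [q_deriv [Cq q_bnd]] [_ _ FL2].
move=> [c_omega omega_ab omega0 [om_xx [mxx H2xx eqn]]] [wt [wtt [mwt mwtt wd1 wd2 [C reg]]]].
set al := alpha 0 in reg eqn *.
have T00 : 0 <= (0 : R) <= T by rewrite lexx ltW.
have /andP[al0 al_star] := alpha_itv 0 T00.
have al1 : al < 1 := le_lt_trans al_star astar1.
(* The hypotheses constrain [omega] on the closed rectangle only; [om] is its continuous bounded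
   extension to the plane. *)
pose om t x := omega (clamp 0 T t) (clamp a b x).
have om_eq t x : 0 <= t <= T -> a <= x <= b -> om t x = omega t x.
  by move=> tT xab; rewrite /om !clamp_id.
have c_om : continuous (fun p : R * R => om p.1 p.2) := continuous_clamp2 (ltW T0) (ltW ab) c_omega.
have [B om_bnd] := bounded_clamp2 (ltW T0) (ltW ab) c_omega.
have om0 x : a <= x <= b -> om 0 x = 0 by move=> xab; rewrite om_eq// omega0.
have om_ab t : om t a = 0 /\ om t b = 0.
  have [oa ob] := omega_ab _ (clamp_itv t (ltW T0)).
  by rewrite /om [clamp a b a]clamp_id ?[clamp a b b]clamp_id ?lexx ?(ltW ab).
(* Strictly above [C], because the Sobolev norm is an infimum that may not be attained. *)
pose C0 := `|C| + 1.
have C00 : 0 <= C0 by rewrite addr_ge0.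
have CC0 : C < C0 by rewrite (le_lt_trans (ler_norm _))// ltrDl.
have reg1 : {ae (@lebesgue_measure R), forall t, 0 < t < T -> H2_bounded a b (wt t) (C0 * t `^ (al - 1))}.
  apply: filterS reg => t H /andP[t0 tT].
  (* The instance [m = 1], that is, the H^2 norm. *)
  have := H; rewrite t0 (ltW tT) => /(_ isT 1%N isT) h.
  apply: (@Hnorm_H2_bounded _ _ _ _ _ (C * t `^ (al - 1))); last first.
    by rewrite ltr_pM2r// powR_gt0.
  apply: le_trans h; apply: leeDr.
  by apply: mule_ge0; [rewrite lee_fin ltW|exact: Hnorm_ge0].
have reg2 : {ae (@lebesgue_measure R), forall t, 0 < t < T -> H2_bounded a b (wtt t) (C0 * t `^ (al - 2))}.
  apply: filterS reg => t H /andP[t0 tT].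
  have := H; rewrite t0 (ltW tT) => /(_ isT 1%N isT) h.
  apply: (@Hnorm_H2_bounded _ _ _ _ _ (C * t `^ (al - 2))); last first.
    by rewrite ltr_pM2r// powR_gt0.
  have -> : C * t `^ (al - 2) = t^-1 * (C * t `^ (al - 1)).
    rewrite (_ : al - 2 = al - 1 - 1); last by ring.
    rewrite [in LHS]powRD ?(gt_eqF t0) ?implybT//.
    by rewrite powRN powRr1 ?(ltW t0)//; ring.
  rewrite EFinM lee_pdivlMl//; apply: le_trans h; apply: leeDl; exact: Hnorm_ge0.
have wd1' : {ae (@lebesgue_measure R), forall x, a < x < b -> weak_deriv 0 T (om ^~ x) (wt ^~ x)}.
  apply: filterS wd1 => x H xab; have := H xab; apply: eq_weak_deriv => t /andP[t0 tT].
  by have /andP[ax xb] := xab; rewrite om_eq// !ltW.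
have mass psi := @mass_cusp R T a b al C0 B om wt wtt ab al0 al1 C00 c_om om_bnd om0 mwt mwtt wd1' wd2 reg1 reg2 psi.
have stiff I m P Q := @stiff_cusp R T a b al C0 B om wt wtt ab al0 al1 C00 c_om om_bnd om0 mwt mwtt wd1' wd2 reg1 reg2 I m P Q.
have psi_facts (psi : R -> R) : {within `[a, b], continuous psi} ->
    measurable_fun (`]a, b[%classic : set R) psi /\
    exists D, forall x, `]a, b[%classic x -> `|psi x| <= D.
  move=> cpsi; split; first by apply: itg_meas; apply: itg_oo_cc; exact: itg_cont.
  have [D _ psiD] := cont_bounded cpsi; exists D => x.
  by rewrite /= in_itv/= => /andP[ax xb]; rewrite psiD// !ltW.
have mass_bound (psi : R -> R) : {within `[a, b], continuous psi} ->
    cusp_bound T al (C0 * L2norm a b psi) (fun t => L2inner a b (om t) psi).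
  by move=> /psi_facts[mpsi bpsi]; exact: mass.
have c_pair (psi : R -> R) : {within `[a, b], continuous psi} ->
    {within `[0, T], continuous (fun t => L2inner a b (om t) psi)}.
  by move=> /psi_facts[mpsi [D bpsi]]; exact: (pairing_continuous c_om om_bnd mpsi bpsi).
(* The growth bound of the stiffness form at time [T], its largest value on [[0, T]]: it serves as a
   uniform H^2 bound on the solution itself. *)
pose C1 := C0 / al * T `^ al.
have C10 : 0 <= C1 by rewrite mulr_ge0 ?powR_ge0// divr_ge0// ltW.
have om_kink t : 0 <= t <= T -> kink_bounded a b C1 (om t).
  move=> tT I m P Q PI QI mpq; have [+ _] := stiff I m P Q PI QI mpq.
  move=> /(_ t tT) h; apply: le_trans h _.
  have tal : t `^ al <= T `^ al.
    case/andP: tT => t0 tT; apply: ge0_ler_powR; rewrite ?nnegrE ?(ltW al0)//; exact: ltW.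
  have c0 : 0 <= C0 * L2norm a b (kL m P Q) / al.
    by rewrite divr_ge0 ?mulr_ge0 ?L2norm_ge0// ltW.
  apply: le_trans (ler_wpM2l c0 tal) _; rewrite le_eqVlt; apply/orP; left; apply/eqP.
  rewrite /C1; ring.
have dqC t : 0 <= t <= T -> `|dq t| <= Cq.
  by move=> /q_bnd; apply: le_trans; rewrite lerDr.
have mdq := deriv_within_measurable T0 q_deriv.
have Idq : itg `[0, T] dq.
  by apply: (@bnd_itg _ _ _ Cq) => //; exact: (@itv_fin _ _ 0 T).
pose s2 := 2^-1 * sigma ^+ 2.
have s20 : 0 <= s2 by rewrite mulr_ge0 ?sqr_ge0.
have lam0 : 0 <= lambda sigma r by rewrite mulr_ge0 ?sqr_ge0.
pose F := Fsource sigma r alpha f ct d2c.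
have tested (I : finType) (m P Q : I -> R) (PI : forall i, a <= P i <= b)
    (QI : forall i, a <= Q i <= b) (mpq : \sum_i m i * (Q i - P i) = 0) :=
  @kink_tested_equation R T a b s2 (lambda sigma r) al dq om omega om_xx F B C1 ab al0 C10
    c_om om_bnd om_eq om_kink Idq mxx H2xx eqn FL2 I m P Q PI QI mpq.
pose K := error_const T (lambda sigma r) s2 al C0 C1 Cq.
(* The threshold for the discrete Gronwall inequality with [kap = 2 * Cq]; adding 1 keeps the
   denominator positive even if [Cq = 0]. *)
have tauc0 : 0 < 1 / (4 * (2 * Cq) ^+ 2 * T + 1).
  by rewrite divr_gt0// ltr_wpDl// mulr_ge0 ?(ltW T0)// mulr_ge0 ?sqr_ge0.
exists (Num.sqrt K + 1), (Num.min 1 (1 / (4 * (2 * Cq) ^+ 2 * T + 1))); split.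
- by rewrite ltr_wpDl ?sqrtr_ge0.
- by rewrite lt_min ltr01.
move=> N s W N0; rewrite lt_min => /andP[tau1 tauc] pab _ scheme.
set tau := T / N%:R in tau1 tauc *; cbv zeta.
have tau0 : 0 < tau by rewrite divr_gt0// ltr0n.
(* The scheme says nothing about [W j] for [j = 0] or [j > N]; the value 0 there makes every [W' j]
   a finite element function. *)
pose W' j : R -> R := if (0 < j <= N)%N then W j else cst 0.
have W'E j : (0 < j <= N)%N -> W' j = W j by rewrite /W' => ->.
have W'Sh j : [/\ {within `[a, b], continuous (W' j)}, cellwise_affine (size s) (node a s) (W' j),
    W' j a = 0 & W' j b = 0].
  rewrite /W'; case: ifP => [jN|_]; first by have [[]] := scheme j jN.
  split=> //; first by apply: continuous_subspaceT; exact: cst_continuous.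
  by move=> i _; exists 0, 0 => y _; rewrite mul0r addr0.
have scheme' m : (0 < m <= N)%N -> forall L : R -> R,
    [/\ {within `[a, b], continuous L}, cellwise_affine (size s) (node a s) L, L a = 0 & L b = 0] ->
  L2inner a b (W' m) L + L2inner a b (fun y => \sum_(1 <= j < m.+1) weight tau dq m j * W' j y) L +
  lambda sigma r * L2inner a b (fun y => \sum_(1 <= j < m.+1) weight tau (beta al) m j * W' j y) L +
  s2 * L2inner a b (fun y => \sum_(1 <= j < m.+1) weight tau (beta al) m j * derive1 (W' j) y) (derive1 L) =
  L2inner a b (F (tnode tau m)) L.
  move=> mN L LSh; have [_ H] := scheme m mN.
  have jN j : (1 <= j < m.+1)%N -> (0 < j <= N)%N.
    by case/andP: mN => _ mN /andP[-> jm]; rewrite ltnS in jm; exact: leq_trans jm mN.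
  have E1 c : (fun y => \sum_(1 <= j < m.+1) c j * W' j y) = (fun y => \sum_(1 <= j < m.+1) c j * W j y).
    by apply/funext => y; apply: eq_big_nat => j /jN jN'; rewrite W'E.
  have E2 c : (fun y => \sum_(1 <= j < m.+1) c j * derive1 (W' j) y) =
      (fun y => \sum_(1 <= j < m.+1) c j * derive1 (W j) y).
    by apply/funext => y; apply: eq_big_nat => j /jN jN'; rewrite W'E.
  rewrite (W'E m mN) E1 E1 E2 /F /tnode /s2.
  exact: (H L LSh).
have small : 4 * (2 * Cq) ^+ 2 * T * tau <= 1.
  have d0 : 0 < 4 * (2 * Cq) ^+ 2 * T + 1.
    by rewrite ltr_wpDl// mulr_ge0 ?(ltW T0)// mulr_ge0 ?sqr_ge0.
  move: tauc; rewrite ltr_pdivlMr// mulrDr mulr1 => h.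
  by rewrite mulrC; apply: ltW; apply: le_lt_trans h; rewrite lerDl ltW.
have n0 : node a s 0 = a by [].
have est := @scheme_error R T (lambda sigma r) s2 a b al C0 C1 Cq om F dq T0 lam0 s20 ab al0 al1 C00 C10
  (continuous_om_x c_om) c_pair (continuous_om_t c_om) om_ab mass_bound stiff om_kink Idq dqC tested
  N (size s) (node a s) (mesh a s) W' N0 n0 (node_last pab) (node_lt pab) (@elt_le_mesh R a s) W'Sh scheme'
  (ltW tau1) small.
set Pw := tau `^ _ in est *.
have K0 : 0 <= K.
  rewrite /K /error_const addr_ge0//; first by rewrite mulr_ge0 ?sqr_ge0// mulr_ge0// ltW.
  apply: mulr_ge0; first by rewrite mulr_ge0// mulr_ge0// expR_ge0.
  apply: addr_ge0; last by apply: mulr_ge0; rewrite ?sqr_ge0 ?powR_ge0.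
  by apply: addr_ge0; apply: mulr_ge0; rewrite ?sqr_ge0// ltW.
have -> : \sum_(1 <= n < N.+1) L2norm a b (fun x => omega (n%:R * tau) x - W n x) ^+ 2 =
    \sum_(1 <= m < N.+1) L2norm a b (fun y => om (tnode tau m) y - W' m y) ^+ 2.
  apply: eq_big_nat => m /andP[m1 mN]; congr (_ ^+ 2); apply: eq_L2norm => x /andP[ax xb].
  have mN' : (0 < m <= N)%N by rewrite m1.
  have mT : 0 <= m%:R * tau <= T.
    rewrite mulr_ge0 ?(ltW tau0)//= (_ : T = N%:R * tau).
      by rewrite ler_wpM2r ?(ltW tau0)// ler_nat -ltnS.
    by rewrite /tau mulrC divfK// pnatr_eq0 -lt0n.
  by rewrite (W'E m mN') /tnode om_eq// !ltW.
have h0 : 0 <= Pw + mesh a s ^+ 2 by rewrite addr_ge0 ?powR_ge0 ?sqr_ge0.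
(* The squared estimate has [Pw^2 + mesh^4], which is at most [(Pw + mesh^2)^2], both terms being
   nonnegative. *)
apply: (@le_trans _ _ (Num.sqrt (K * (Pw + mesh a s ^+ 2) ^+ 2))).
  rewrite ler_wsqrtr//; apply: le_trans est _; rewrite ler_wpM2l//.
  rewrite [leRHS]sqrrD; have : 0 <= Pw * mesh a s ^+ 2 by rewrite mulr_ge0 ?powR_ge0 ?sqr_ge0.
  lra.
rewrite sqrtrM// sqrtr_sqr ger0_norm//.
by rewrite ler_wpM2r// lerDl.
Qed.
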